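(* Let $\kappa$ be a strongly compact cardinal and let $f$ be $V$-generic for the fast function forcing $\mathbb{F}_\kappa$. Then in $V[f]$ the function $f$ has the Menas property: for every $\lambda\ge\kappa$ there is a fine measure $\mu$ on $P_\kappa\lambda$ in $V[f]$ whose ultrapower embedding $j:V[f]\to N$ satisfies $j(f)(\kappa)\ge |[\mathrm{id}]_\mu|^{N}$.
   Context: Fast function forcing $\mathbb{F}_\kappa$: conditions are partial functions $p:\kappa\to\kappa$ such that $\mathrm{dom}(p)$ is a set of inaccessible cardinals below $\kappa$ of size less than $\kappa$, and for every $\gamma\in\mathrm{dom}(p)$, $p``\gamma\subseteq\gamma$ and $|p\upharpoonright\gamma|<\gamma$; ordered by inclusion; $f$ is the union of the generic filter, a partial function $\kappa\to\kappa$. A fine measure on $P_\kappa\lambda$ is a $\kappa$-complete ultrafilter on $P_\kappa\lambda$ containing $\{x:\alpha\in x\}$ for each $\alpha<\lambda$; $[\mathrm{id}]_\mu$ denotes the element of the ultrapower represented by the identity function. *)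

(* Defs.v *)
(* Plain Rocq, no library: set theory is developed inside arbitrary
   first-order structures for the language of set theory. *)
Set Implicit Arguments.
Unset Strict Implicit.

Record memstruct := MemStruct { carrier :> Type; mem : carrier -> carrier -> Prop }.
Arguments mem {m} _ _.
Notation "x ∈ y" := (mem x y) (at level 70, no associativity).

Definition substructure (M : memstruct) (C : M -> Prop) : memstruct :=
  MemStruct (fun x y : {a : M | C a} => proj1_sig x ∈ proj1_sig y).

(** * First-order formulas, in de Bruijn notation *)

Inductive formula : Type :=
| FMem : nat -> nat -> formula
| FEq  : nat -> nat -> formula
| FBot : formula
| FImp : formula -> formula -> formula
| FAll : formula -> formula.

Definition scons (T : Type) (x : T) (e : nat -> T) (n : nat) : T :=
  match n with 0 => x | S m => e m end.

Fixpoint sat (M : memstruct) (e : nat -> M) (phi : formula) : Prop :=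
  match phi with
  | FMem m n => e m ∈ e n
  | FEq m n => e m = e n
  | FBot => False
  | FImp phi1 phi2 => sat e phi1 -> sat e phi2
  | FAll phi1 => forall x : M, sat (scons x e) phi1
  end.

(** * Basic set-theoretic notions of a structure *)

Section Notions.
Context {M : memstruct}.
Implicit Types a b c d g p r s w x y z : M.

Definition subset a b := forall x, x ∈ a -> x ∈ b.
Definition is_empty a := forall x, ~ x ∈ a.
Definition is_upair z a b := forall x, x ∈ z <-> x = a \/ x = b.
Definition is_opair z a b :=
  exists s p, is_upair s a a /\ is_upair p a b /\ is_upair z s p.
Definition is_union u a := forall x, x ∈ u <-> exists y : M, y ∈ a /\ x ∈ y.
Definition is_powerset p a := forall x, x ∈ p <-> subset x a.
Definition is_succ y x := forall z, z ∈ y <-> z ∈ x \/ z = x.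

(* [app g x y]: the ordered pair (x, y) belongs to g. *)
Definition app g x y := exists z, is_opair z x y /\ z ∈ g.
Definition is_function g :=
  (forall z, z ∈ g -> exists x y, is_opair z x y) /\
  (forall x y y', app g x y -> app g x y' -> y = y').
Definition is_dom d g := forall x, x ∈ d <-> exists y, app g x y.
Definition fun_on a g := is_function g /\ is_dom a g.
Definition maps g a b := fun_on a g /\ forall x y, app g x y -> y ∈ b.
Definition injection g a b :=
  maps g a b /\ forall x x' y, app g x y -> app g x' y -> x = x'.
Definition bijection g a b :=
  injection g a b /\ forall y, y ∈ b -> exists x, app g x y.
Definition is_restriction r g a :=
  forall z, z ∈ r <-> z ∈ g /\ exists x y, is_opair z x y /\ x ∈ a.

Definition equinumerous a b := exists g, bijection g a b.
Definition card_le a b := exists g, injection g a b.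
Definition card_lt a b := card_le a b /\ ~ card_le b a.

(** ** Ordinals and cardinals *)

Definition transitive_set a := forall x, x ∈ a -> subset x a.

Definition ordinal a :=
  transitive_set a /\
  (forall x, x ∈ a -> ~ x ∈ x) /\
  (forall x y z, x ∈ a -> y ∈ a -> z ∈ a -> x ∈ y -> y ∈ z -> x ∈ z) /\
  (forall x y, x ∈ a -> y ∈ a -> x ∈ y \/ x = y \/ y ∈ x) /\
  (forall b, subset b a -> ~ is_empty b ->
     exists x, x ∈ b /\ forall y, y ∈ b -> ~ y ∈ x).

Definition ord_le a b := a ∈ b \/ a = b.

Definition limit_ordinal a :=
  ordinal a /\ ~ is_empty a /\
  forall x, x ∈ a -> exists y, y ∈ a /\ x ∈ y.
Definition is_omega w :=
  limit_ordinal w /\ forall x, x ∈ w -> ~ limit_ordinal x.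

Definition cardinal k := ordinal k /\ forall a, a ∈ k -> ~ equinumerous a k.
Definition is_cardinality k a := cardinal k /\ equinumerous a k.
Definition uncountable_cardinal k := cardinal k /\ exists w, is_omega w /\ w ∈ k.

Definition regular k :=
  cardinal k /\ limit_ordinal k /\
  forall a g, a ∈ k -> maps g a k ->
    exists b, b ∈ k /\ forall x y, app g x y -> y ∈ b.
Definition strong_limit k :=
  forall a p, a ∈ k -> is_powerset p a -> card_lt p k.
Definition inaccessible k :=
  uncountable_cardinal k /\ regular k /\ strong_limit k.

(** ** Fine measures and strong compactness *)

Definition complete_ultrafilter k X U :=
  (forall a, a ∈ U -> subset a X) /\
  (forall a, is_empty a -> ~ a ∈ U) /\
  (forall a b, a ∈ U -> subset a b -> subset b X -> b ∈ U) /\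
  (* The empty family yields X ∈ U. *)
  (forall A b, subset A U -> card_lt A k ->
     (forall x, x ∈ b <-> x ∈ X /\ forall a, a ∈ A -> x ∈ a) -> b ∈ U) /\
  (forall a b, subset a X -> (forall x, x ∈ b <-> x ∈ X /\ ~ x ∈ a) ->
     a ∈ U \/ b ∈ U).

Definition is_Pkl k l P := forall x, x ∈ P <-> subset x l /\ card_lt x k.

Definition fine_measure k l P mu :=
  is_Pkl k l P /\ complete_ultrafilter k P mu /\
  forall a b, a ∈ l -> (forall x, x ∈ b <-> x ∈ P /\ a ∈ x) -> b ∈ mu.

Definition strongly_compact k :=
  uncountable_cardinal k /\
  forall l, ordinal l -> ord_le k l -> exists P mu, fine_measure k l P mu.

(** ** Fast function forcing *)

Definition fast_condition k p :=
  is_function p /\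
  (forall x y, app p x y -> x ∈ k /\ y ∈ k /\ inaccessible x) /\
  (forall d, is_dom d p -> card_lt d k) /\
  (forall c y, app p c y ->
     (forall a b, a ∈ c -> app p a b -> b ∈ c) /\
     (forall r, is_restriction r p c -> card_lt r c)).

Definition is_fast_forcing k F := forall p, p ∈ F <-> fast_condition k p.

(** ** Names and their values *)

(* [T] witnesses that [t] is hereditarily a set of pairs (name, condition);
   by Foundation this is the usual recursive definition of a P-name. *)
Definition is_name P t :=
  exists T, t ∈ T /\
    forall s, s ∈ T -> forall z, z ∈ s ->
      exists r p, is_opair z r p /\ r ∈ T /\ p ∈ P.

(* x = val(t, G), by the recursion
   val(t, G) = { val(r, G) : exists p ∈ G, (r, p) ∈ t };
   [h] is an attempt at this recursion, defined at [t]. *)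
Definition is_val G t x :=
  exists h, is_function h /\ app h t x /\
    forall s u, app h s u ->
      (forall r p, p ∈ G -> app s r p -> exists y, app h r y) /\
      (forall y, y ∈ u <-> exists r p, p ∈ G /\ app s r p /\ app h r y).

(** ** Ultrapowers *)

Definition almost_all X mu (Q : M -> Prop) :=
  exists s, s ∈ mu /\ forall x, x ∈ s <-> x ∈ X /\ Q x.
Definition ult_eq X mu g g' :=
  almost_all X mu (fun x => exists y, app g x y /\ app g' x y).
Definition ult_mem X mu g g' :=
  almost_all X mu (fun x => exists y y', app g x y /\ app g' x y' /\ y ∈ y').

(* a = [g]_mu, the Mostowski collapse of the class of [g] modulo [mu], by the
   recursion [g]_mu = { [v]_mu : v ∈_mu g }.  As the class of [g] is proper,
   the attempt [h] at this recursion is only required to contain, up to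
   =_mu, the members of each function in its domain. *)
Definition ult_class X mu g a :=
  exists h, is_function h /\ app h g a /\
    forall u b, app h u b ->
      fun_on X u /\
      (forall v, fun_on X v -> ult_mem X mu v u ->
         exists v' y, ult_eq X mu v v' /\ app h v' y) /\
      (forall y, y ∈ b <-> exists v, ult_mem X mu v u /\ app h v y).

(* The (transitive) class of all [g]_mu, for g a function on X. *)
Definition in_ult X mu a := exists g, fun_on X g /\ ult_class X mu g a.

(* b = j(a), where j is the ultrapower embedding. *)
Definition is_ult_emb X mu a b :=
  exists c, fun_on X c /\ (forall x, x ∈ X -> app c x a) /\ ult_class X mu c b.

Definition is_id_class X mu b :=
  exists c, fun_on X c /\ (forall x, x ∈ X -> app c x x) /\ ult_class X mu c b.

End Notions.

Definition ultrapower (M : memstruct) (X mu : M) : memstruct :=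
  substructure (in_ult X mu).

Definition menas_property (M : memstruct) (k f : M) : Prop :=
  forall l : M, ordinal l -> ord_le k l ->
  exists P mu : M, fine_measure k l P mu /\
  exists jf k' idmu : ultrapower P mu,
    is_ult_emb P mu f (proj1_sig jf) /\
    proj1_sig k' = k /\
    is_id_class P mu (proj1_sig idmu) /\
    (* computed in the structure N = ultrapower P mu *)
    exists b c : ultrapower P mu,
      app jf k' b /\ is_cardinality c idmu /\ ord_le c b.

(** * ZFC *)

Record ZFC (M : memstruct) : Prop := {
  zfc_extensionality : forall a b : M, (forall x, x ∈ a <-> x ∈ b) -> a = b;
  zfc_foundation : forall a : M, ~ is_empty a ->
    exists x, x ∈ a /\ forall y, y ∈ a -> ~ y ∈ x;
  zfc_pairing : forall a b : M, exists z, is_upair z a b;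
  zfc_union : forall a : M, exists u, is_union u a;
  zfc_powerset : forall a : M, exists p, is_powerset p a;
  zfc_infinity : exists w : M,
    (exists o, is_empty o /\ o ∈ w) /\
    (forall x, x ∈ w -> exists y, is_succ y x /\ y ∈ w);
  zfc_separation : forall (phi : formula) (e : nat -> M) (a : M),
    exists b, forall x, x ∈ b <-> x ∈ a /\ sat (scons x e) phi;
  zfc_replacement : forall (phi : formula) (e : nat -> M) (a : M),
    (forall x, x ∈ a -> exists! y, sat (scons x (scons y e)) phi) ->
    exists b, forall y, y ∈ b <->
      exists x, x ∈ a /\ sat (scons x (scons y e)) phi;
  zfc_choice : forall a : M, (forall x, x ∈ a -> ~ is_empty x) ->
    exists g, fun_on a g /\ forall x y, app g x y -> y ∈ x
}.

(** * Generic extensions *)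

(* [le q p]: the condition q is stronger than p.  [i] embeds the ground model
   V into W. *)
Definition dense (V : memstruct) (P : V) (le : V -> V -> Prop) (D : V) : Prop :=
  subset D P /\ forall p, p ∈ P -> exists q, q ∈ D /\ le q p.

Record generic_filter (V W : memstruct) (i : V -> W)
    (P : V) (le : V -> V -> Prop) (G : W) : Prop := {
  gf_sub : forall x : W, x ∈ G -> exists p, p ∈ P /\ x = i p;
  gf_nonempty : ~ is_empty G;
  gf_up : forall p q, p ∈ P -> q ∈ P -> le q p -> i q ∈ G -> i p ∈ G;
  gf_directed : forall p q, i p ∈ G -> i q ∈ G ->
    exists r, i r ∈ G /\ le r p /\ le r q;
  gf_generic : forall D, dense P le D -> exists p, p ∈ D /\ i p ∈ G
}.

(* W = V[G].  For a ground model that need not be well-founded, V[G] is, up to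
   isomorphism over V and G, the model of ZFC that contains V as a transitive
   class and G as an element and all of whose elements are values of names
   in V. *)
Record generic_extension (V W : memstruct) (i : V -> W)
    (P : V) (le : V -> V -> Prop) (G : W) : Prop := {
  ge_zfc : ZFC W;
  ge_inj : forall x y, i x = i y -> x = y;
  ge_mem : forall x y, i x ∈ i y <-> x ∈ y;
  ge_transitive : forall a (y : W), y ∈ i a -> exists b, y = i b;
  ge_filter : generic_filter i P le G;
  ge_val : forall x : W, exists t, is_name P t /\ is_val G (i t) x
}.

(* Main.v *)
Require Import Defs.
From Stdlib Require Import Classical ClassicalEpsilon Setoid.
Set Implicit Arguments.
Unset Strict Implicit.

(** In [V] fix a fine measure [U] on [P_kappa(theta)] with [theta] so large that every name
    for a subset of [(P_kappa(lambda))^V * kappa] is coded below [theta], and let [j : V -> M]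
    be its ultrapower.  The condition [{(kappa, d)}] of [j(F)], for [d < j(kappa)] large enough,
    factors [j(F)] below it as [F * F_tail], where in [M] the tail is closed under increasing
    unions of length [d].  Since [j] maps the set of names into a set of size at most [d] in [M],
    a single tail condition [q] decides every name at the seed, up to a condition in [F].  Hence
    [V[f]] contains the ultrafilter [mu] of those sets that some [r ∪ {(kappa, d)} ∪ q], with [r]
    in the generic filter, forces to contain the seed.  The seed is chosen so that its
    intersection with [j(kappa)] is [kappa] and its size is at most [d]; so [j(f)(kappa) = d]
    gives the Menas property of [f].

    No ultrapower of [V] is formed: [M], [q] and the seed are handled through functions on
    [P_kappa(theta)] modulo [U].  Instead of the full forcing theorem, only the relation
    [p ⊩ t = ǎ] with [a] in [V] is used; it yields nice names for the subsets of ground model sets. *)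

(** * Definability with parameters *)

(** The structures are arbitrary models of ZFC, possibly ill-founded, so inductions and recursions
    inside them must go through predicates shown to be first-order definable with parameters. Nor is
    [V] treated as a class of [W]: what [W] has to know about [V] is packed into sets of [V] and
    passed on by [i].

    No generic filter for the tail of j(F) is at hand in V[f], so the names have to be settled in
    advance. At an index x only the names coded in x matter. They are fewer than kappa, as are the
    conditions below the value of the critical function at x, so some d < kappa exceeds the number
    of tasks. No condition of F has kappa in its domain; hence the value d at kappa is free, and d
    can also be made to exceed the size of the seed.

    Names describe sets of pairs (y, b) with b < kappa, not sets of points y. One decision then
    settles a whole family indexed by b, and a positive decision supplies an index, which becomes
    constant by the completeness of [U] or by pressing down below the critical point. In this way
    completeness, and the fact that x ∩ kappa represents kappa, pass to V[f]. *)

Fixpoint ren (f : nat -> nat) (phi : formula) : formula :=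
  match phi with
  | FMem m n => FMem (f m) (f n)
  | FEq m n => FEq (f m) (f n)
  | FBot => FBot
  | FImp a b => FImp (ren f a) (ren f b)
  | FAll a => FAll (ren (fun n => match n with 0 => 0 | S m => S (f m) end) a)
  end.

Section Definability.
Context {M : memstruct}.
Implicit Types (e : nat -> M) (Q : (nat -> M) -> Prop).

Lemma sat_ext phi : forall e e', (forall n, e n = e' n) -> sat e phi <-> sat e' phi.
Proof.
  induction phi as [m n|m n| |a IHa b IHb|a IHa]; simpl; intros e e' H.
  - now rewrite (H m), (H n).
  - now rewrite (H m), (H n).
  - tauto.
  - now rewrite (IHa e e' H), (IHb e e' H).
  - split; intros K x; apply (IHa (scons x e) (scons x e')); auto;
      intros [|n]; simpl; auto.
Qed.

Lemma sat_ren phi : forall f e, sat e (ren f phi) <-> sat (fun n => e (f n)) phi.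
Proof.
  induction phi as [m n|m n| |a IHa b IHb|a IHa]; simpl; intros f e; try tauto.
  - now rewrite IHa, IHb.
  - split; intros K x; specialize (K x).
    + apply IHa in K. revert K. apply sat_ext. intros [|n]; reflexivity.
    + apply IHa. revert K. apply sat_ext. intros [|n]; reflexivity.
Qed.

Inductive tm := Var (n : nat) | Cst (c : M).

Definition teval e (t : tm) : M := match t with Var n => e n | Cst c => c end.

(* First-order definability with parameters; a predicate of several arguments
   is presented as a predicate of an environment. *)
Definition Definable Q :=
  exists phi (tau : nat -> tm), forall e, sat (fun n => teval e (tau n)) phi <-> Q e.

Lemma def_iff Q Q' : Definable Q -> (forall e, Q e <-> Q' e) -> Definable Q'.
Proof. intros (phi & tau & H) K. exists phi, tau. intros e. now rewrite H. Qed.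

Lemma def_false : Definable (fun _ => False).
Proof. exists FBot, (fun n => Var n). reflexivity. Qed.

(** The two formulas come with separate assignments of terms; they are merged by moving the
    variables of the first to even and those of the second to odd indices. *)
Lemma def_imp Q Q' : Definable Q -> Definable Q' -> Definable (fun e => Q e -> Q' e).
Proof.
  intros (phi & tau & H) (phi' & tau' & H').
  exists (FImp (ren (fun n => 2 * n) phi) (ren (fun n => S (2 * n)) phi')).
  exists (fun n => if Nat.even n then tau (Nat.div2 n) else tau' (Nat.div2 n)).
  assert (E : forall n, Nat.even (2 * n) = true /\ Nat.div2 (2 * n) = n
                        /\ Nat.even (S (2 * n)) = false /\ Nat.div2 (S (2 * n)) = n).
  { induction n as [|n IH]; [simpl; auto|].
    replace (2 * S n) with (S (S (2 * n))).
    - destruct IH as (h1 & h2 & h3 & h4). cbn [Nat.even Nat.div2] in *. auto.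
    - simpl. now rewrite <- plus_n_Sm. }
  intros e. rewrite <- H, <- H'. cbn [sat]. rewrite !sat_ren.
  rewrite (sat_ext phi (e' := fun n => teval e (tau n))).
  - rewrite (sat_ext phi' (e' := fun n => teval e (tau' n))); [tauto|].
    intros n. destruct (E n) as (_ & _ & -> & ->). reflexivity.
  - intros n. destruct (E n) as (-> & -> & _). reflexivity.
Qed.

(** Exactly the indices that [tau] sends to variable 0 are captured by the new quantifier; they are
    all renamed to 0, and the others are shifted past it. *)
Lemma def_all (Q : M -> (nat -> M) -> Prop) :
  Definable (fun e => Q (e 0) (fun n => e (S n))) -> Definable (fun e => forall x, Q x e).
Proof.
  intros (phi & tau & H).
  exists (FAll (ren (fun n => match tau n with Var 0 => 0 | _ => S n end) phi)).
  exists (fun n => match tau n with Var (S m) => Var m | Var 0 => Var 0 | Cst c => Cst c end).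
  intros e. simpl. split; intros K x; specialize (K x).
  - rewrite sat_ren in K. apply (H (scons x e)). revert K. apply sat_ext.
    intros n. destruct (tau n) as [[|m]|c] eqn:E; simpl; rewrite ?E; reflexivity.
  - rewrite sat_ren. apply (H (scons x e)) in K. revert K. apply sat_ext.
    intros n. destruct (tau n) as [[|m]|c] eqn:E; simpl; rewrite ?E; reflexivity.
Qed.

Lemma def_subst Q (s : nat -> tm) :
  Definable Q -> Definable (fun e => Q (fun n => teval e (s n))).
Proof.
  intros (phi & tau & H).
  exists phi, (fun n => match tau n with Var m => s m | Cst c => Cst c end).
  intros e. rewrite <- H. apply sat_ext. intros n. destruct (tau n); reflexivity.
Qed.

Lemma def_ren Q (f : nat -> nat) : Definable Q -> Definable (fun e => Q (fun n => e (f n))).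
Proof. intros H. exact (def_subst (fun n => Var (f n)) H). Qed.

Lemma def_not Q : Definable Q -> Definable (fun e => ~ Q e).
Proof. intros H. apply def_imp; [exact H | apply def_false]. Qed.

Lemma def_true : Definable (fun _ => True).
Proof. apply (def_iff (def_not def_false)). tauto. Qed.

Lemma def_and Q Q' : Definable Q -> Definable Q' -> Definable (fun e => Q e /\ Q' e).
Proof.
  intros H H'. apply (def_iff (def_not (def_imp H (def_not H')))).
  intros e. destruct (classic (Q e)), (classic (Q' e)); tauto.
Qed.

Lemma def_or Q Q' : Definable Q -> Definable Q' -> Definable (fun e => Q e \/ Q' e).
Proof.
  intros H H'. apply (def_iff (def_imp (def_not H) H')).
  intros e. destruct (classic (Q e)), (classic (Q' e)); tauto.
Qed.

Lemma def_equiv Q Q' : Definable Q -> Definable Q' -> Definable (fun e => Q e <-> Q' e).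
Proof. intros H H'. apply def_and; apply def_imp; assumption. Qed.

Lemma def_ex (Q : M -> (nat -> M) -> Prop) :
  Definable (fun e => Q (e 0) (fun n => e (S n))) -> Definable (fun e => exists x, Q x e).
Proof.
  intros H. apply (def_iff (def_not (def_all (Q := fun x e => ~ Q x e) (def_not H)))).
  intros e. split; [apply not_all_not_ex | firstorder].
Qed.

(** Definability of the graph: variable 0 holds the value, and the environment of [t] is shifted by
    one. *)
Definition DF (t : (nat -> M) -> M) := Definable (fun e => e 0 = t (fun n => e (S n))).

Lemma DF_tm (s : tm) : DF (fun e => teval e s).
Proof.
  exists (FEq 0 1).
  exists (fun n => match n with
                   | 0 => Var 0
                   | _ => match s with Var m => Var (S m) | Cst c => Cst c end end).
  intros e. destruct s; simpl; tauto.
Qed.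

Lemma DF_var n : DF (fun e => e n).
Proof. exact (DF_tm (Var n)). Qed.

Lemma DF_cst c : DF (fun _ => c).
Proof. exact (DF_tm (Cst c)). Qed.

Lemma DF_ren (t : (nat -> M) -> M) f : DF t -> DF (fun e => t (fun n => e (f n))).
Proof. intros H. exact (def_ren (fun n => match n with 0 => 0 | S m => S (f m) end) H). Qed.

Lemma def_at (Q : M -> (nat -> M) -> Prop) t :
  DF t -> Definable (fun e => Q (e 0) (fun n => e (S n))) -> Definable (fun e => Q (t e) e).
Proof.
  intros Ht H. apply (@def_iff (fun e => exists u, u = t e /\ Q u e)).
  - apply def_ex. apply def_and; [exact Ht | exact H].
  - intros e. split; [intros (u & -> & K); exact K | eauto].
Qed.

Lemma def_mem s t : DF s -> DF t -> Definable (fun e => s e ∈ t e).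
Proof.
  intros Hs Ht. apply (def_at (Q := fun u e => u ∈ t e) Hs).
  apply (def_at (Q := fun v e => e 0 ∈ v) (DF_ren S Ht)).
  exists (FMem 1 0), Var. reflexivity.
Qed.

Lemma def_eq s t : DF s -> DF t -> Definable (fun e => s e = t e).
Proof. intros Hs Ht. apply (def_at (Q := fun u e => u = t e) Hs). exact Ht. Qed.

Definition Def1 (Q : M -> Prop) := Definable (fun e => Q (e 0)).
Definition Def2 (Q : M -> M -> Prop) := Definable (fun e => Q (e 0) (e 1)).
Definition Def3 (Q : M -> M -> M -> Prop) := Definable (fun e => Q (e 0) (e 1) (e 2)).

Lemma def_sub1 (Q : M -> Prop) a : Def1 Q -> DF a -> Definable (fun e => Q (a e)).
Proof.
  intros H Ha. apply (def_at (Q := fun u e => Q u) Ha). exact H.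
Qed.

Lemma def_sub2 (Q : M -> M -> Prop) a b :
  Def2 Q -> DF a -> DF b -> Definable (fun e => Q (a e) (b e)).
Proof.
  intros H Ha Hb. apply (def_at (Q := fun u e => Q u (b e)) Ha).
  apply (def_at (Q := fun v e => Q (e 0) v) (DF_ren S Hb)).
  exact (def_ren (fun n => match n with 0 => 1 | _ => 0 end) H).
Qed.

Lemma def_sub3 (Q : M -> M -> M -> Prop) a b c :
  Def3 Q -> DF a -> DF b -> DF c -> Definable (fun e => Q (a e) (b e) (c e)).
Proof.
  intros H Ha Hb Hc. apply (def_at (Q := fun u e => Q u (b e) (c e)) Ha).
  apply (def_at (Q := fun v e => Q (e 0) v (c (fun n => e (S n)))) (DF_ren S Hb)).
  apply (def_at (Q := fun v e => Q (e 1) (e 0) v) (DF_ren (fun n => S (S n)) Hc)).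
  exact (def_ren (fun n => match n with 0 => 2 | 1 => 1 | _ => 0 end) H).
Qed.

End Definability.

(** Hooks, redefined by [::=] whenever a new family of terms or notions has been shown definable;
    [def] thus grows with the development. *)
Ltac DF_ext := fail.
Ltac def_ext := fail.

Ltac DF_step :=
  lazymatch goal with
  | |- DF (fun e => e _) => apply DF_var
  | |- DF (fun _ => ?c) => apply DF_cst
  | H : DF ?t |- DF ?t => exact H
  | H : DF ?t |- DF (fun e => ?t (fun n => e (@?f n))) => exact (DF_ren f H)
  | _ => DF_ext
  end.

Ltac def_step :=
  cbv beta;
  lazymatch goal with
  | |- Def1 _ => unfold Def1
  | |- Def2 _ => unfold Def2
  | |- Def3 _ => unfold Def3
  | |- DF _ => DF_step
  | |- Definable (fun e => @?s e ∈ @?t e) => apply (@def_mem _ s t)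
  | |- Definable (fun e => @?s e = @?t e) => apply (@def_eq _ s t)
  | |- Definable (fun e => @?A e /\ @?B e) => apply (@def_and _ A B)
  | |- Definable (fun e => @?A e \/ @?B e) => apply (@def_or _ A B)
  | |- Definable (fun e => @?A e <-> @?B e) => apply (@def_equiv _ A B)
  | |- Definable (fun e => ~ @?A e) => apply (@def_not _ A)
  | |- Definable (fun e => exists x : carrier _, @?Q e x) =>
      apply (@def_ex _ (fun x e => Q e x))
  | |- Definable (fun e => forall x : carrier _, @?Q e x) =>
      apply (@def_all _ (fun x e => Q e x))
  | |- Definable (fun e => @?A e -> @?B e) => apply (@def_imp _ A B)
  | |- Definable (fun e => False) => apply def_false
  | |- Definable (fun e => True) => apply def_true
  | H : Definable ?Q |- Definable ?Q => exact H
  | H : Definable ?Q |- Definable (fun e => ?Q (fun n => e (@?f n))) => exact (def_ren f H)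
  | H : Def1 ?Q |- Definable (fun e => ?Q (@?a e)) => apply (def_sub1 (a := a) H)
  | H : Def2 ?Q |- Definable (fun e => ?Q (@?a e) (@?b e)) =>
      apply (def_sub2 (a := a) (b := b) H)
  | H : Def3 ?Q |- Definable (fun e => ?Q (@?a e) (@?b e) (@?c e)) =>
      apply (def_sub3 (a := a) (b := b) (c := c) H)
  | _ => def_ext
  end.

Ltac def := repeat def_step.

Section DefinableNotions.
Context {M : memstruct}.
Implicit Types a b c d g : (nat -> M) -> M.

Lemma def_subset a b : DF a -> DF b -> Definable (fun e => subset (a e) (b e)).
Proof. intros. unfold subset. def. Qed.

Lemma def_is_empty a : DF a -> Definable (fun e => is_empty (a e)).
Proof. intros. unfold is_empty. def. Qed.

Lemma def_is_upair c a b :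
  DF c -> DF a -> DF b -> Definable (fun e => is_upair (c e) (a e) (b e)).
Proof. intros. unfold is_upair. def. Qed.

Lemma def_is_succ a b : DF a -> DF b -> Definable (fun e => is_succ (a e) (b e)).
Proof. intros. unfold is_succ. def. Qed.

Lemma def_is_powerset a b : DF a -> DF b -> Definable (fun e => is_powerset (a e) (b e)).
Proof. intros. unfold is_powerset, subset. def. Qed.

Lemma def_is_opair c a b :
  DF c -> DF a -> DF b -> Definable (fun e => is_opair (c e) (a e) (b e)).
Proof. intros. unfold is_opair, is_upair. def. Qed.

Lemma def_app g a b : DF g -> DF a -> DF b -> Definable (fun e => app (g e) (a e) (b e)).
Proof. intros. unfold app, is_opair, is_upair. def. Qed.

End DefinableNotions.

Ltac def_ext ::=
  lazymatch goal with
  | |- Definable (fun e => subset (@?a e) (@?b e)) => apply (@def_subset _ a b)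
  | |- Definable (fun e => is_empty (@?a e)) => apply (@def_is_empty _ a)
  | |- Definable (fun e => is_succ (@?a e) (@?b e)) => apply (@def_is_succ _ a b)
  | |- Definable (fun e => is_powerset (@?a e) (@?b e)) => apply (@def_is_powerset _ a b)
  | |- Definable (fun e => is_upair (@?c e) (@?a e) (@?b e)) => apply (@def_is_upair _ c a b)
  | |- Definable (fun e => is_opair (@?c e) (@?a e) (@?b e)) => apply (@def_is_opair _ c a b)
  | |- Definable (fun e => app (@?c e) (@?a e) (@?b e)) => apply (@def_app _ c a b)
  | |- Definable ?Q => progress unfold is_union, is_function, is_dom, fun_on, maps, injection,
      bijection, is_restriction, equinumerous, card_le, card_lt, transitive_set, ordinal, ord_le,
      limit_ordinal, is_omega, cardinal, is_cardinality, uncountable_cardinal, regular,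
      strong_limit, inaccessible, is_Pkl, fast_condition, almost_all, ult_eq, ult_mem,
      ult_class, in_ult, unique
  end.

(** * Sets and ordinals in a model of ZFC *)

Existing Class ZFC.

Section Sets.
Context {M : memstruct} {Z : ZFC M}.
Implicit Types a b c d g p r s u v w x y z : M.

Lemma set_ext a b : (forall x, x ∈ a <-> x ∈ b) -> a = b.
Proof. apply (zfc_extensionality Z). Qed.

Lemma subset_antisym a b : subset a b -> subset b a -> a = b.
Proof. intros H K. apply set_ext. split; auto. Qed.

(** In a predicate of one argument all variables may be read as that argument, so they are sent to
    0; the parameters move from the terms into the environment of the schema. *)
Lemma sep a (Q : M -> Prop) : Def1 Q -> exists b, forall x, x ∈ b <-> x ∈ a /\ Q x.
Proof.
  intros (phi & tau & H).
  destruct (zfc_separation Z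
    (ren (fun n => match tau n with Var _ => 0 | Cst _ => S n end) phi)
    (fun n => match tau n with Var _ => a | Cst c => c end) a) as [b Hb].
  exists b. intros x. rewrite Hb. apply and_iff_compat_l.
  rewrite <- (H (fun _ => x)), sat_ren. apply sat_ext.
  intros n. destruct (tau n) eqn:E; simpl; rewrite ?E; reflexivity.
Qed.

Lemma replacement_total a (Q : M -> M -> Prop) :
  Def2 Q -> (forall x, x ∈ a -> exists! y, Q x y) ->
  exists b, forall y, y ∈ b <-> exists x, x ∈ a /\ Q x y.
Proof.
  intros (phi & tau & H) K.
  set (f := fun n => match tau n with Var 0 => 0 | Var _ => 1 | Cst _ => S (S n) end).
  set (rho := fun n => match tau n with Var _ => a | Cst c => c end).
  assert (E : forall x y, sat (scons x (scons y rho)) (ren f phi) <-> Q x y).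
  { intros x y. rewrite <- (H (scons x (fun _ => y))), sat_ren. apply sat_ext.
    intros n. unfold f, rho. destruct (tau n) as [[|m]|c] eqn:E; simpl; rewrite ?E; reflexivity. }
  destruct (zfc_replacement Z (phi := ren f phi) (e := rho) (a := a)) as [b Hb].
  - intros x Hx. destruct (K x Hx) as (y & Hy & U). exists y.
    split; [now apply E|]. intros y' Hy'. apply U. now apply E.
  - exists b. intros y. rewrite Hb. split; intros (x & Hx & Hxy); exists x; split; auto; now apply E.
Qed.

(** The axiom asks for a total relation; separating the domain of [Q] first allows partial ones. *)
Lemma repl a (Q : M -> M -> Prop) :
  Def2 Q -> (forall x y y', x ∈ a -> Q x y -> Q x y' -> y = y') ->
  exists b, forall y, y ∈ b <-> exists x, x ∈ a /\ Q x y.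
Proof.
  intros HQ K.
  destruct (@sep a (fun x => exists y, Q x y)) as [a' Ha']; [def|].
  destruct (@replacement_total a' Q HQ) as [b Hb].
  - intros x Hx. apply Ha' in Hx as (Hx & y & Hy). exists y. split; auto.
    intros y' Hy'. eauto.
  - exists b. intros y. rewrite Hb. split; intros (x & Hx & Hxy); exists x; split; auto.
    + now apply Ha' in Hx.
    + apply Ha'. eauto.
Qed.

(** Chosen by [epsilon], the set operations are functions and can be nested inside terms; uniqueness
    of the chosen set makes each graph definable by its defining relation. *)
Definition up a b : M := epsilon (inhabits a) (fun z => is_upair z a b).
Definition sg a : M := up a a.
Definition pr a b : M := up (sg a) (up a b).
Definition Un a : M := epsilon (inhabits a) (fun z => is_union z a).
Definition Pw a : M := epsilon (inhabits a) (fun z => is_powerset z a).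
Definition bu a b : M := Un (up a b).
Definition sc a : M := bu a (sg a).

Lemma up_is a b : is_upair (up a b) a b.
Proof. unfold up. apply epsilon_spec, (zfc_pairing Z). Qed.

Lemma in_up a b x : x ∈ up a b <-> x = a \/ x = b.
Proof. apply up_is. Qed.

Lemma in_sg a x : x ∈ sg a <-> x = a.
Proof. unfold sg. rewrite in_up. tauto. Qed.

Lemma in_Un a x : x ∈ Un a <-> exists y, y ∈ a /\ x ∈ y.
Proof. revert x. apply (epsilon_spec (inhabits a) (fun z => is_union z a)), (zfc_union Z). Qed.

Lemma in_Pw a x : x ∈ Pw a <-> subset x a.
Proof. revert x. apply (epsilon_spec (inhabits a) (fun z => is_powerset z a)), (zfc_powerset Z). Qed.

Lemma in_bu a b x : x ∈ bu a b <-> x ∈ a \/ x ∈ b.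
Proof.
  unfold bu. rewrite in_Un. split.
  - intros (y & Hy & Hx). apply in_up in Hy as [->| ->]; auto.
  - intros [H|H]; [exists a|exists b]; rewrite in_up; auto.
Qed.

Lemma in_sc a x : x ∈ sc a <-> x ∈ a \/ x = a.
Proof. unfold sc. now rewrite in_bu, in_sg. Qed.

Lemma is_upair_up z a b : is_upair z a b <-> z = up a b.
Proof.
  split.
  - intros H. apply set_ext. intros x. rewrite (H x). now rewrite in_up.
  - intros ->. apply up_is.
Qed.

Lemma is_opair_pr z a b : is_opair z a b <-> z = pr a b.
Proof.
  unfold is_opair. split.
  - intros (s & p & Hs & Hp & H). apply is_upair_up in Hs, Hp, H. now subst.
  - intros ->. exists (sg a), (up a b). repeat split; try (apply up_is); apply in_up; auto.
Qed.

Lemma is_powerset_Pw y x : is_powerset y x <-> y = Pw x.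
Proof.
  split.
  - intros H. apply set_ext. intros z. now rewrite (H z), in_Pw.
  - intros ->. intros z. apply in_Pw.
Qed.

Lemma up_inj a b c d : up a b = up c d -> (a = c /\ b = d) \/ (a = d /\ b = c).
Proof.
  intros H.
  assert (Ha : a ∈ up c d) by (rewrite <- H; apply in_up; auto).
  assert (Hb : b ∈ up c d) by (rewrite <- H; apply in_up; auto).
  assert (Hc : c ∈ up a b) by (rewrite H; apply in_up; auto).
  assert (Hd : d ∈ up a b) by (rewrite H; apply in_up; auto).
  apply in_up in Ha, Hb, Hc, Hd. intuition congruence.
Qed.

Lemma pr_inj a b c d : pr a b = pr c d -> a = c /\ b = d.
Proof.
  intros H. apply up_inj in H.
  destruct H as [[H K]|[H K]]; apply up_inj in H, K; intuition congruence.
Qed.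

Lemma app_pr g x y : app g x y <-> pr x y ∈ g.
Proof.
  unfold app. split.
  - intros (z & Hz & H). apply is_opair_pr in Hz. now subst.
  - intros H. exists (pr x y). split; [now apply is_opair_pr|auto].
Qed.

Lemma DF_up (s t : (nat -> M) -> M) : DF s -> DF t -> DF (fun e : nat -> M => up (s e) (t e)).
Proof.
  intros. apply (@def_iff _ (fun e => is_upair (e 0) (s (fun n => e (S n))) (t (fun n => e (S n))))).
  - def.
  - intros e. apply is_upair_up.
Qed.

Lemma DF_sg (s : (nat -> M) -> M) : DF s -> DF (fun e : nat -> M => sg (s e)).
Proof. intros. now apply DF_up. Qed.

Lemma DF_pr (s t : (nat -> M) -> M) : DF s -> DF t -> DF (fun e : nat -> M => pr (s e) (t e)).
Proof. intros. apply DF_up; apply DF_up; auto. Qed.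

Lemma DF_Un (s : (nat -> M) -> M) : DF s -> DF (fun e : nat -> M => Un (s e)).
Proof.
  intros. apply (@def_iff _ (fun e => is_union (e 0) (s (fun n => e (S n))))).
  - unfold is_union. def.
  - intros e. split.
    + intros K. apply set_ext. intros x. now rewrite (K x), in_Un.
    + intros K x. rewrite K. apply in_Un.
Qed.

Lemma DF_bu (s t : (nat -> M) -> M) : DF s -> DF t -> DF (fun e : nat -> M => bu (s e) (t e)).
Proof. intros. apply DF_Un, DF_up; auto. Qed.

Lemma DF_sc (s : (nat -> M) -> M) : DF s -> DF (fun e : nat -> M => sc (s e)).
Proof. intros. apply DF_bu; auto. now apply DF_sg. Qed.

Lemma DF_Pw (s : (nat -> M) -> M) : DF s -> DF (fun e : nat -> M => Pw (s e)).
Proof.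
  intros. apply (@def_iff _ (fun e => is_powerset (e 0) (s (fun n => e (S n))))).
  - def.
  - intros e. apply is_powerset_Pw.
Qed.

(* Outside the domain of [g] the value of [ap g x] is [g]. *)
Definition ap_graph g x y :=
  (app g x y /\ forall y', app g x y' -> y' = y) \/
  (~ (exists y, app g x y /\ forall y', app g x y' -> y' = y) /\ y = g).
Definition ap g x : M := epsilon (inhabits g) (ap_graph g x).

Lemma ap_graph_ap g x y : ap_graph g x y <-> y = ap g x.
Proof.
  assert (S : ap_graph g x (ap g x)).
  { unfold ap. apply epsilon_spec.
    destruct (classic (exists y, app g x y /\ forall y', app g x y' -> y' = y)) as [[y' H]|H].
    - exists y'. now left.
    - exists g. now right. }
  split; [|now intros ->].
  intros H. destruct S as [[S1 S2]|[S1 S2]], H as [[H1 H2]|[H1 H2]].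
  - auto.
  - exfalso. eauto.
  - exfalso. eauto.
  - congruence.
Qed.

Lemma DF_ap (s t : (nat -> M) -> M) : DF s -> DF t -> DF (fun e : nat -> M => ap (s e) (t e)).
Proof.
  intros.
  apply (@def_iff _ (fun e => ap_graph (s (fun n => e (S n))) (t (fun n => e (S n))) (e 0))).
  - unfold ap_graph. def.
  - intros e. apply ap_graph_ap.
Qed.

Lemma ap_eq g x y : is_function g -> app g x y -> ap g x = y.
Proof.
  intros [_ F] H. symmetry. apply ap_graph_ap. left. split; auto.
  intros y' H'. eauto.
Qed.

Lemma app_ap a g x : fun_on a g -> x ∈ a -> app g x (ap g x).
Proof.
  intros [F D] Hx. apply D in Hx as [y Hy]. now rewrite (ap_eq F Hy).
Qed.

Lemma app_ap_iff a g x y : fun_on a g -> (app g x y <-> x ∈ a /\ y = ap g x).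
Proof.
  intros Hg. split.
  - intros H. split; [apply Hg; eauto|]. symmetry. apply ap_eq; auto. apply Hg.
  - intros [Hx ->]. now apply app_ap with a.
Qed.

Lemma empty_ex : exists o : M, is_empty o.
Proof. destruct (zfc_infinity Z) as (w & (o & Ho & _) & _). eauto. Qed.

Definition emp : M := proj1_sig (constructive_indefinite_description _ empty_ex).

Lemma in_emp x : ~ x ∈ emp.
Proof. unfold emp. destruct constructive_indefinite_description as [o Ho]. apply Ho. Qed.

Lemma not_empty a : ~ is_empty a <-> exists x, x ∈ a.
Proof.
  split; [|intros [x Hx] H; exact (H x Hx)].
  intros H. apply NNPP. intros K. apply H. intros x Hx. eauto.
Qed.

Lemma is_empty_emp a : is_empty a <-> a = emp.
Proof.
  split.
  - intros H. apply set_ext. intros x. split; intros K; [destruct (H x K)|destruct (in_emp K)].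
  - intros ->. exact in_emp.
Qed.

Lemma prod_ex a b : exists p, forall z, z ∈ p <-> exists x y, x ∈ a /\ y ∈ b /\ z = pr x y.
Proof.
  destruct (@sep (Pw (Pw (bu a b)))
    (fun z => exists x y, x ∈ a /\ y ∈ b /\ is_opair z x y)) as [p Hp]; [def|].
  exists p. intros z. rewrite Hp. split.
  - intros (_ & x & y & Hx & Hy & H). apply is_opair_pr in H. eauto.
  - intros (x & y & Hx & Hy & ->). split.
    + apply in_Pw. intros u Hu. apply in_Pw. intros v Hv. apply in_bu.
      unfold pr in Hu. apply in_up in Hu as [->| ->];
        [apply in_sg in Hv|apply in_up in Hv]; intuition congruence.
    + exists x, y. split; auto. split; auto. now apply is_opair_pr.
Qed.

Definition pd a b : M := proj1_sig (constructive_indefinite_description _ (prod_ex a b)).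

Lemma in_pd a b z : z ∈ pd a b <-> exists x y, x ∈ a /\ y ∈ b /\ z = pr x y.
Proof. unfold pd. destruct constructive_indefinite_description as [p Hp]. apply Hp. Qed.

Lemma pr_in_pd a b x y : pr x y ∈ pd a b <-> x ∈ a /\ y ∈ b.
Proof.
  rewrite in_pd. split.
  - intros (x' & y' & Hx & Hy & E). apply pr_inj in E as [-> ->]. auto.
  - intros [Hx Hy]. eauto 6.
Qed.

Lemma no_self x : ~ x ∈ x.
Proof.
  intros H. destruct (zfc_foundation Z (a := sg x)) as (y & Hy & K).
  - apply not_empty. exists x. now apply in_sg.
  - apply in_sg in Hy. subst y. apply (K x); auto. now apply in_sg.
Qed.

Lemma no_cycle2 x y : x ∈ y -> ~ y ∈ x.
Proof.
  intros H1 H2. destruct (zfc_foundation Z (a := up x y)) as (z & Hz & K).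
  - apply not_empty. exists x. apply in_up; auto.
  - apply in_up in Hz as [->| ->]; [apply (K y)|apply (K x)]; auto; apply in_up; auto.
Qed.

Lemma no_cycle3 x y z : x ∈ y -> y ∈ z -> ~ z ∈ x.
Proof.
  intros H1 H2 H3. destruct (zfc_foundation Z (a := bu (up x y) (sg z))) as (u & Hu & K).
  - apply not_empty. exists x. apply in_bu. left. apply in_up; auto.
  - assert (E : forall t, t ∈ bu (up x y) (sg z) <-> (t = x \/ t = y) \/ t = z)
      by (intros t; now rewrite in_bu, in_up, in_sg).
    apply E in Hu as [[->| ->]| ->]; [apply (K z)|apply (K x)|apply (K y)]; auto; apply E; auto.
Qed.

Lemma fun_intro a (Q : M -> M -> Prop) :
  Def2 Q -> (forall x, x ∈ a -> exists y, Q x y) ->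
  (forall x y y', x ∈ a -> Q x y -> Q x y' -> y = y') ->
  exists g, fun_on a g /\ forall x y, app g x y <-> x ∈ a /\ Q x y.
Proof.
  intros HQ T F.
  destruct (@repl a (fun x z => exists y, Q x y /\ is_opair z x y)) as [g Hg].
  - def.
  - intros x z z' Hx (y & Hy & E) (y' & Hy' & E').
    apply is_opair_pr in E, E'. rewrite (F x y y') in E by auto. congruence.
  - assert (A : forall x y, app g x y <-> x ∈ a /\ Q x y).
    { intros x y. rewrite app_pr, Hg. split.
      - intros (x' & Hx' & y' & Hy' & E). apply is_opair_pr in E.
        apply pr_inj in E as [-> ->]. auto.
      - intros [Hx Hy]. exists x. split; auto. exists y. split; auto. now apply is_opair_pr. }
    exists g. split; [split; [split|]|exact A].
    + intros z Hz. apply Hg in Hz as (x & _ & y & _ & E). eauto.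
    + intros x y y' H H'. apply A in H as [Hx H], H' as [_ H']. eauto.
    + intros x. split.
      * intros Hx. destruct (T x Hx) as [y Hy]. exists y. now apply A.
      * intros [y Hy]. now apply A in Hy.
Qed.

Lemma inj_intro a b (Q : M -> M -> Prop) :
  Def2 Q -> (forall x, x ∈ a -> exists y, y ∈ b /\ Q x y) ->
  (forall x y y', x ∈ a -> y ∈ b -> y' ∈ b -> Q x y -> Q x y' -> y = y') ->
  (forall x x' y, x ∈ a -> x' ∈ a -> y ∈ b -> Q x y -> Q x' y -> x = x') ->
  card_le a b.
Proof.
  intros HQ T F I.
  destruct (@fun_intro a (fun x y => y ∈ b /\ Q x y)) as (g & Hg & A).
  - def.
  - auto.
  - intros x y y' Hx [H1 H2] [H3 H4]. eauto.
  - exists g. split; [split; auto|].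
    + intros x y H. now apply A in H.
    + intros x x' y H H'. apply A in H as (? & ? & ?), H' as (? & ? & ?). eauto.
Qed.

Lemma injE g a b : injection g a b ->
  (forall x, x ∈ a -> exists y, y ∈ b /\ app g x y) /\
  (forall x y, app g x y -> x ∈ a /\ y ∈ b) /\
  (forall x y y', app g x y -> app g x y' -> y = y') /\
  (forall x x' y, app g x y -> app g x' y -> x = x').
Proof.
  intros (((Fn & D) & R) & I). repeat split; auto.
  - intros x Hx. apply D in Hx as [y Hy]. eauto.
  - apply D. eauto.
  - eauto.
  - apply Fn.
Qed.

Lemma card_le_sub a b : subset a b -> card_le a b.
Proof.
  intros H. apply (@inj_intro a b (fun x y => x = y)).
  - def.
  - intros x Hx. eauto.
  - congruence.
  - congruence.
Qed.

Lemma card_le_trans a b c : card_le a b -> card_le b c -> card_le a c.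
Proof.
  intros (g & Hg) (h & Hh).
  destruct (injE Hg) as (T & D & F & I), (injE Hh) as (T' & D' & F' & I').
  apply (@inj_intro a c (fun x y => exists z, app g x z /\ app h z y)).
  - def.
  - intros x Hx. destruct (T x Hx) as (y & Hy & E), (T' y Hy) as (z & Hz & E'). eauto.
  - intros x y y' _ _ _ (z & H1 & H2) (z' & H3 & H4). rewrite (F _ _ _ H1 H3) in H2. eauto.
  - intros x y y' _ _ _ (z & H1 & H2) (z' & H3 & H4). rewrite (I' _ _ _ H2 H4) in H1. eauto.
Qed.

Lemma equinumerous_card_le a b : equinumerous a b -> card_le a b.
Proof. intros (g & Hg & _). exists g. exact Hg. Qed.

Lemma bij_intro a b (Q : M -> M -> Prop) :
  Def2 Q -> (forall x, x ∈ a -> exists y, y ∈ b /\ Q x y) ->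
  (forall y, y ∈ b -> exists x, x ∈ a /\ Q x y) ->
  (forall x y y', x ∈ a -> y ∈ b -> y' ∈ b -> Q x y -> Q x y' -> y = y') ->
  (forall x x' y, x ∈ a -> x' ∈ a -> y ∈ b -> Q x y -> Q x' y -> x = x') ->
  equinumerous a b.
Proof.
  intros HQ T S F I.
  destruct (@fun_intro a (fun x y => y ∈ b /\ Q x y)) as (g & Hg & A).
  - def.
  - auto.
  - intros x y y' Hx [H1 H2] [H3 H4]. eauto.
  - exists g. split; [split; [split; auto|]|].
    + intros x y H. now apply A in H.
    + intros x x' y H H'. apply A in H as (? & ? & ?), H' as (? & ? & ?). eauto.
    + intros y Hy. destruct (S y Hy) as (x & Hx & H). exists x. apply A. auto.
Qed.

Lemma equinumerous_sym a b : equinumerous a b -> equinumerous b a.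
Proof.
  intros (g & Hg & S). destruct (injE Hg) as (T & D & F & I).
  apply (@bij_intro b a (fun y x => app g x y)).
  - def.
  - intros y Hy. destruct (S y Hy) as [x Hx]. exists x. split; auto. now apply D in Hx.
  - intros x Hx. destruct (T x Hx) as (y & ? & ?). eauto.
  - eauto.
  - eauto.
Qed.

Lemma equinumerous_trans a b c : equinumerous a b -> equinumerous b c -> equinumerous a c.
Proof.
  intros (g & Hg & S) (h & Hh & S').
  destruct (injE Hg) as (T & D & F & I), (injE Hh) as (T' & D' & F' & I').
  apply (@bij_intro a c (fun x y => exists z, app g x z /\ app h z y)).
  - def.
  - intros x Hx. destruct (T x Hx) as (y & Hy & E), (T' y Hy) as (z & Hz & E'). eauto.
  - intros z Hz. destruct (S' z Hz) as (y & Hy). destruct (S y) as (x & Hx).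
    { now apply D' in Hy. }
    exists x. split; [now apply D in Hx|]. eauto.
  - intros x y y' _ _ _ (z & H1 & H2) (z' & H3 & H4). rewrite (F _ _ _ H1 H3) in H2. eauto.
  - intros x y y' _ _ _ (z & H1 & H2) (z' & H3 & H4). rewrite (I' _ _ _ H2 H4) in H1. eauto.
Qed.

Lemma image_ex a b g : injection g a b ->
  exists c, subset c b /\ equinumerous a c.
Proof.
  intros Hg. destruct (injE Hg) as (T & D & F & I).
  destruct (@sep b (fun y => exists x, app g x y)) as [c Hc]; [def|].
  exists c. split; [intros y Hy; now apply Hc in Hy|].
  apply (@bij_intro a c (fun x y => app g x y)); eauto.
  - def.
  - intros x Hx. destruct (T x Hx) as (y & Hy & E). exists y. rewrite Hc. eauto.
  - intros y Hy. apply Hc in Hy as (Hy & x & Hx). exists x. split; auto. now apply D in Hx.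
Qed.

End Sets.

Ltac DF_ext ::=
  lazymatch goal with
  | |- DF (fun e => pr (@?a e) (@?b e)) => apply (@DF_pr _ _ a b)
  | |- DF (fun e => up (@?a e) (@?b e)) => apply (@DF_up _ _ a b)
  | |- DF (fun e => ap (@?a e) (@?b e)) => apply (@DF_ap _ a b)
  | |- DF (fun e => bu (@?a e) (@?b e)) => apply (@DF_bu _ _ a b)
  | |- DF (fun e => sg (@?a e)) => apply (@DF_sg _ _ a)
  | |- DF (fun e => sc (@?a e)) => apply (@DF_sc _ _ a)
  | |- DF (fun e => Un (@?a e)) => apply (@DF_Un _ _ a)
  | |- DF (fun e => Pw (@?a e)) => apply (@DF_Pw _ _ a)
  end.

Section Ordinals.
Context {M : memstruct} {Z : ZFC M}.
Implicit Types a b c d g p r s u v w x y z : M.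

(** Foundation excludes ∈-cycles of length at most three and provides minimal elements, so only
    transitivity and comparability remain of the clauses of [ordinal]. *)
Lemma ord_intro a :
  transitive_set a -> (forall x y, x ∈ a -> y ∈ a -> x ∈ y \/ x = y \/ y ∈ x) -> ordinal a.
Proof.
  intros T L. split; [exact T|split; [|split; [|split; [exact L|]]]].
  - intros x _. apply no_self.
  - intros x y z Hx Hy Hz H1 H2. destruct (L x z Hx Hz) as [H|[H|H]]; auto.
    + subst. destruct (no_cycle2 H1 H2).
    + destruct (no_cycle3 H1 H2 H).
  - intros b _ H. apply (zfc_foundation Z H).
Qed.

Lemma ord_lin a x y : ordinal a -> x ∈ a -> y ∈ a -> x ∈ y \/ x = y \/ y ∈ x.
Proof. intros (_ & _ & _ & L & _). auto. Qed.

Lemma ord_elem a x : ordinal a -> x ∈ a -> ordinal x.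
Proof.
  intros (T & _ & Tr & L & _) Hx. apply ord_intro.
  - intros y Hy z Hz. apply (Tr z y x); auto.
    + apply (T y); auto. apply (T x); auto.
    + apply (T x); auto.
  - intros y z Hy Hz. apply L; apply (T x); auto.
Qed.

Lemma ord_trans a x y : ordinal a -> x ∈ y -> y ∈ a -> x ∈ a.
Proof. intros (T & _) H K. exact (T y K x H). Qed.

Lemma ord_sub_mem a b : ordinal a -> ordinal b -> subset a b -> ord_le a b.
Proof.
  intros Ha Hb H. destruct (classic (exists x, x ∈ b /\ ~ x ∈ a)) as [[x0 Hx0]|N].
  - left. destruct (@sep _ Z b (fun x => ~ x ∈ a)) as [c Hc]; [def|].
    destruct (zfc_foundation Z (a := c)) as (x & Hx & K).
    { apply not_empty. exists x0. now apply Hc. }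
    apply Hc in Hx as [Hx Nx].
    enough (E : x = a) by now rewrite <- E. apply set_ext. intros y. split; intros Hy.
    + apply NNPP. intros Ny. apply (K y); auto. apply Hc. split; auto. now apply (@ord_trans b y x).
    + destruct (ord_lin Hb Hx (H y Hy)) as [E|[E|E]]; auto.
      * destruct Nx. now apply (@ord_trans a x y).
      * subst. destruct (Nx Hy).
  - right. apply subset_antisym; auto. intros x Hx. apply NNPP. intros Nx. eauto.
Qed.

(** The intersection of [a] and [b] is an ordinal and at most each of them; if it were a proper part
    of both, it would be its own element. *)
Lemma ord_tri a b : ordinal a -> ordinal b -> a ∈ b \/ a = b \/ b ∈ a.
Proof.
  intros Ha Hb. destruct (@sep _ Z a (fun x => x ∈ b)) as [c Hc]; [def|].
  assert (Oc : ordinal c).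
  { apply ord_intro.
    - intros x Hx y Hy. apply Hc in Hx as [H1 H2]. apply Hc.
      split; [now apply (@ord_trans a y x)|now apply (@ord_trans b y x)].
    - intros x y Hx Hy. apply Hc in Hx as [Hx _], Hy as [Hy _]. now apply (@ord_lin a). }
  assert (Ca : ord_le c a) by (apply ord_sub_mem; auto; intros x Hx; now apply Hc in Hx).
  assert (Cb : ord_le c b) by (apply ord_sub_mem; auto; intros x Hx; now apply Hc in Hx).
  destruct Ca as [Ca| ->], Cb as [Cb| ->]; auto.
  destruct (@no_self _ Z c). apply Hc. auto.
Qed.

Lemma ord_le_sub a b : ordinal b -> ord_le a b -> subset a b.
Proof. intros Hb [H| ->]; [now apply Hb|intros x; auto]. Qed.

Lemma ord_le_or a b : ordinal a -> ordinal b -> ord_le a b \/ b ∈ a.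
Proof. intros Ha Hb. destruct (ord_tri Ha Hb) as [H|[H|H]]; unfold ord_le; auto. Qed.

Lemma ord_not_mem a b : ordinal a -> ordinal b -> ~ a ∈ b -> ord_le b a.
Proof. intros Ha Hb H. destruct (ord_tri Ha Hb) as [K|[K|K]]; unfold ord_le; auto. tauto. Qed.

Lemma ord_le_trans a b c : ordinal c -> ord_le a b -> ord_le b c -> ord_le a c.
Proof. intros Hc [H| ->] [K| ->]; unfold ord_le; auto. left. now apply (@ord_trans c a b). Qed.

Lemma ord_le_mem_trans a b c : ordinal c -> ord_le a b -> b ∈ c -> a ∈ c.
Proof. intros Hc [H| ->] K; auto. now apply (@ord_trans c a b). Qed.

Lemma ord_mem_le_trans a b c : ordinal c -> a ∈ b -> ord_le b c -> a ∈ c.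
Proof. intros Hc H [K| ->]; auto. now apply (@ord_trans c a b). Qed.

Lemma ord_max g a b : ordinal g -> a ∈ g -> b ∈ g -> exists c, c ∈ g /\ ord_le a c /\ ord_le b c.
Proof.
  intros Og Ha Hb. destruct (ord_lin Og Ha Hb) as [H|[H|H]]; unfold ord_le.
  - exists b; auto.
  - exists b; auto.
  - exists a; auto.
Qed.

Lemma ord_emp : ordinal (emp (M := M)).
Proof. apply ord_intro; [intros x Hx|intros x y Hx]; destruct (in_emp Hx). Qed.

Lemma ord_sc a : ordinal a -> ordinal (sc a).
Proof.
  intros Ha. apply ord_intro.
  - intros x Hx y Hy. apply in_sc. left. apply in_sc in Hx as [Hx| ->]; auto.
    now apply (@ord_trans a y x).
  - intros x y Hx Hy. apply in_sc in Hx as [Hx| ->], Hy as [Hy| ->]; auto.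
    now apply (@ord_lin a).
Qed.

Lemma ord_le_sc a b : a ∈ sc b <-> ord_le a b.
Proof. apply in_sc. Qed.

Lemma sc_le a b : ordinal b -> a ∈ b -> ord_le (sc a) b.
Proof.
  intros Hb H. apply ord_sub_mem; auto.
  - apply ord_sc. now apply (@ord_elem b).
  - intros x Hx. apply in_sc in Hx as [Hx| ->]; auto. now apply (@ord_trans b x a).
Qed.

Lemma ord_set a : transitive_set a -> (forall x, x ∈ a -> ordinal x) -> ordinal a.
Proof. intros T H. apply ord_intro; auto. intros x y Hx Hy. apply ord_tri; auto. Qed.

Lemma ord_Un a : (forall x, x ∈ a -> ordinal x) -> ordinal (Un a).
Proof.
  intros H. apply ord_set.
  - intros x Hx y Hy. apply in_Un in Hx as (z & Hz & Hx). apply in_Un. exists z.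
    split; auto. apply (@ord_trans z y x); auto.
  - intros x Hx. apply in_Un in Hx as (z & Hz & Hx). apply (@ord_elem z); auto.
Qed.

Lemma ord_bound a : (forall x, x ∈ a -> ordinal x) ->
  exists b, ordinal b /\ forall x, x ∈ a -> x ∈ b.
Proof.
  intros H. exists (sc (Un a)). split; [apply ord_sc; now apply ord_Un|].
  intros x Hx. apply ord_le_sc. apply ord_sub_mem; auto.
  - now apply ord_Un.
  - intros y Hy. apply in_Un. eauto.
Qed.

Lemma least_in a (Q : M -> Prop) : Def1 Q -> (exists x, x ∈ a /\ Q x) ->
  exists x, x ∈ a /\ Q x /\ forall y, y ∈ a -> y ∈ x -> ~ Q y.
Proof.
  intros HQ (x & Hx & H). destruct (@sep _ Z a Q HQ) as [b Hb].
  destruct (zfc_foundation Z (a := b)) as (m & Hm & K).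
  { apply not_empty. exists x. now apply Hb. }
  apply Hb in Hm as [H1 H2]. exists m. split; auto. split; auto.
  intros y Hy Hym Qy. apply (K y); auto. now apply Hb.
Qed.

Lemma least_ord (Q : M -> Prop) a : Def1 Q -> ordinal a -> Q a ->
  exists b, ordinal b /\ Q b /\ ord_le b a /\ forall y, y ∈ b -> ~ Q y.
Proof.
  intros HQ Ha H. destruct (@least_in (sc a) Q HQ) as (b & Hb & Qb & K).
  { exists a. split; auto. apply in_sc. auto. }
  assert (Ob : ordinal b) by (apply (@ord_elem (sc a)); auto; now apply ord_sc).
  exists b. split; auto. split; auto. split; [now apply ord_le_sc|].
  intros y Hy. apply K; auto. apply (@ord_trans (sc a) y b); auto. now apply ord_sc.
Qed.

Lemma limit_sc a x : limit_ordinal a -> x ∈ a -> sc x ∈ a.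
Proof.
  intros (Oa & _ & L) Hx. destruct (L x Hx) as (y & Hy & K).
  apply (@ord_le_mem_trans _ y); auto. apply sc_le; auto. now apply (@ord_elem a).
Qed.

Lemma limit_emp a : limit_ordinal a -> emp (M := M) ∈ a.
Proof.
  intros (Oa & N & _). apply not_empty in N as [x Hx].
  destruct (ord_tri (ord_elem Oa Hx) ord_emp) as [H|[H|H]].
  - destruct (in_emp H).
  - now subst.
  - now apply (@ord_trans a _ x).
Qed.

Lemma burali_forti a : exists x, ordinal x /\ ~ x ∈ a.
Proof.
  apply NNPP. intros N. destruct (@sep _ Z a ordinal) as [b Hb]; [def|].
  assert (E : forall x, x ∈ b <-> ordinal x).
  { intros x. rewrite Hb. split; [tauto|]. intros H. split; auto. apply NNPP. eauto. }
  apply (@no_self _ Z b). apply E. apply ord_set.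
  - intros x Hx y Hy. apply E. apply E in Hx. now apply (@ord_elem x).
  - intros x. apply E.
Qed.

End Ordinals.

(** * Well-founded recursion and its consequences *)

Section Recursion.
Context {M : memstruct} {Z : ZFC M}.
Implicit Types a b c d g h p s u v w x y z : M.
Context (R : M -> M -> Prop) (HR : Def2 R).
Context (wfR : forall C, (exists x, x ∈ C) -> exists x, x ∈ C /\ forall y, y ∈ C -> ~ R y x).
Context (E : M -> M -> M -> Prop) (HE : Def3 E).
Context (Efun : forall x s y y', E x s y -> E x s y' -> y = y').

Definition rec_restr h x s := is_function s /\ forall y u, app s y u <-> app h y u /\ R y x.

Definition attempt h :=
  is_function h /\ forall x v, app h x v ->
    (forall y, R y x -> exists u, app h y u) /\ exists s, rec_restr h x s /\ E x s v.

(** A partial function, because the step [E] may be undefined; in the enumeration of a set along the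
    ordinals it is undefined once the set is exhausted. *)
Definition rec_val x v := exists h, attempt h /\ app h x v.

Lemma def_rec_val : Def2 rec_val.
Proof. unfold rec_val, attempt, rec_restr. def. Qed.

Lemma function_ext s s' : is_function s -> is_function s' ->
  (forall y u, app s y u <-> app s' y u) -> s = s'.
Proof.
  intros [F _] [F' _] H. apply set_ext. intros z. split; intros Hz.
  - destruct (F z Hz) as (x & y & E0). apply is_opair_pr in E0. subst.
    apply app_pr, H, app_pr, Hz.
  - destruct (F' z Hz) as (x & y & E0). apply is_opair_pr in E0. subst.
    apply app_pr, H, app_pr, Hz.
Qed.

Lemma dom_ex g : exists d, is_dom d g.
Proof.
  destruct (@sep _ Z (Un (Un g)) (fun x => exists y, app g x y)) as [d Hd]; [def|].
  exists d. intros x. rewrite Hd. split; [tauto|]. intros [y Hy]. split; eauto.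
  apply app_pr in Hy. apply in_Un. exists (sg x). split; [|now apply in_sg].
  apply in_Un. exists (pr x y). split; auto. unfold pr. apply in_up; auto.
Qed.

Lemma ran_ex g : exists r, forall y, y ∈ r <-> exists x, app g x y.
Proof.
  destruct (@sep _ Z (Un (Un g)) (fun y => exists x, app g x y)) as [d Hd]; [def|].
  exists d. intros y. rewrite Hd. split; [tauto|]. intros [x Hy]. split; eauto.
  apply app_pr in Hy. apply in_Un. exists (up x y). split; [|apply in_up; auto].
  apply in_Un. exists (pr x y). split; auto. unfold pr. apply in_up; auto.
Qed.

(** At an [R]-minimal point of disagreement the two restrictions to predecessors coincide, and [E]
    is functional. *)
Lemma attempts_agree h h' x v v' :
  attempt h -> attempt h' -> app h x v -> app h' x v' -> v = v'.
Proof.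
  intros [Fh Ah] [Fh' Ah'] Hv Hv'. apply NNPP. intros Ne.
  destruct (dom_ex h) as [d Hd].
  destruct (@sep _ Z d (fun x => exists v v', app h x v /\ app h' x v' /\ v <> v')) as [C HC]; [def|].
  destruct (wfR (C := C)) as (m & Hm & Min).
  { exists x. apply HC. split; [apply Hd; eauto|eauto 6]. }
  apply HC in Hm as (_ & w & w' & Hw & Hw' & Nw).
  destruct (Ah _ _ Hw) as (P & s & [Fs Hs] & Es), (Ah' _ _ Hw') as (P' & s' & [Fs' Hs'] & Es').
  assert (A : forall y u u', R y m -> app h y u -> app h' y u' -> u = u').
  { intros y u u' Ry Hu Hu'. apply NNPP. intros Nu. apply (Min y); auto.
    apply HC. split; [apply Hd; eauto|eauto 6]. }
  apply Nw. enough (Q : s = s') by (subst s'; eauto).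
  apply function_ext; auto. intros y u. rewrite Hs, Hs'. split; intros [Hu Ry]; split; auto.
  - destruct (P' y Ry) as [u' Hu']. now rewrite (A y u u').
  - destruct (P y Ry) as [u' Hu']. now rewrite <- (A y u' u).
Qed.

Lemma rec_val_fun x v v' : rec_val x v -> rec_val x v' -> v = v'.
Proof. intros (h & A & H) (h' & A' & H'). exact (attempts_agree A A' H H'). Qed.

Lemma rec_val_eq x v : rec_val x v ->
  exists s, is_function s /\ (forall y u, app s y u <-> R y x /\ rec_val y u) /\ E x s v /\
            forall y, R y x -> exists u, rec_val y u.
Proof.
  intros (h & A & H). destruct (proj2 A _ _ H) as (P & s & [Fs Hs] & Es).
  exists s. split; auto. split; [|split; auto].
  - intros y u. rewrite Hs. split.
    + intros [Hu Ry]. split; auto. exists h; auto.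
    + intros [Ry Hu]. split; auto. destruct (P y Ry) as [u' Hu'].
      rewrite (@rec_val_fun y u u'); auto. exists h; auto.
  - intros y Ry. destruct (P y Ry) as [u Hu]. exists u, h. auto.
Qed.

(* The union of all attempts inside [D] is an attempt, so it is stuck at an
   [R]-minimal point only if [E] is undefined there. *)
Lemma rec_total D :
  (forall x y, x ∈ D -> R y x -> y ∈ D) ->
  (forall x s, x ∈ D -> is_function s ->
     (forall y u, app s y u <-> R y x /\ rec_val y u) ->
     (forall y, R y x -> exists u, rec_val y u) -> exists v, E x s v) ->
  forall x, x ∈ D -> exists v, rec_val x v.
Proof.
  intros cl prog. pose proof def_rec_val as Drv.
  destruct (@repl _ Z D (fun x z => exists v, rec_val x v /\ is_opair z x v)) as [H HH].
  { def. }
  { intros x z z' _ (v & Hv & Ez) (v' & Hv' & Ez'). apply is_opair_pr in Ez, Ez'.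
    rewrite (rec_val_fun Hv Hv') in Ez. congruence. }
  assert (AH : forall x v, app H x v <-> x ∈ D /\ rec_val x v).
  { intros x v. rewrite app_pr, HH. split.
    - intros (x' & Hx' & v' & Hv' & Ez). apply is_opair_pr in Ez.
      apply pr_inj in Ez as [-> ->]. auto.
    - intros [Hx Hv]. exists x. split; auto. exists v. split; auto. now apply is_opair_pr. }
  assert (RH : forall z, z ∈ H -> exists x y, is_opair z x y).
  { intros z Hz. apply HH in Hz as (x & _ & v & _ & Ez). eauto. }
  apply NNPP. intros N. apply not_all_ex_not in N as [x0 N0].
  destruct (@sep _ Z D (fun x => ~ exists v, rec_val x v)) as [C HC]; [def|].
  destruct (wfR (C := C)) as (x & Hx & Min).
  { exists x0. apply HC. tauto. }
  apply HC in Hx as [Hx Nx].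
  assert (Px : forall y, R y x -> exists u, rec_val y u).
  { intros y Ry. apply NNPP. intros Ny. apply (Min y); auto. apply HC. split; eauto. }
  destruct (@sep _ Z H (fun z => exists y u, is_opair z y u /\ R y x)) as [s Hs]; [def|].
  assert (As : forall y u, app s y u <-> R y x /\ rec_val y u).
  { intros y u. rewrite app_pr, Hs, <- app_pr, AH. split.
    - intros ([_ Hv] & y' & u' & E1 & Ry). apply is_opair_pr, pr_inj in E1 as [-> ->]. auto.
    - intros [Ry Hv]. split; [split; eauto|]. exists y, u. split; auto. now apply is_opair_pr. }
  assert (Fs : is_function s).
  { split.
    - intros z Hz. apply Hs in Hz as (_ & y & u & Ez & _). eauto.
    - intros y u u' H1 H2. apply As in H1 as [_ H1], H2 as [_ H2]. eapply rec_val_fun; eauto. }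
  destruct (prog x s Hx Fs As Px) as [v Ev].
  assert (Rx : ~ R x x).
  { destruct (wfR (C := sg x)) as (m & Hm & Mm); [exists x; now apply in_sg|].
    apply in_sg in Hm. subst m. apply Mm. now apply in_sg. }
  set (H' := bu H (sg (pr x v))).
  assert (AH' : forall y u, app H' y u <-> app H y u \/ (y = x /\ u = v)).
  { intros y u. unfold H'. rewrite !app_pr, in_bu, in_sg. split; intros [K|K]; auto.
    - apply pr_inj in K. auto.
    - destruct K; subst; auto. }
  apply Nx. exists v, H'. split; [|apply AH'; auto].
  split; [split|].
  - intros z Hz. apply in_bu in Hz as [Hz|Hz]; auto.
    apply in_sg in Hz. exists x, v. now apply is_opair_pr.
  - intros y u u' H1 H2. apply AH' in H1 as [H1|[-> ->]], H2 as [H2|[E2 ->]]; auto.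
    + apply AH in H1 as [_ H1], H2 as [_ H2]. eapply rec_val_fun; eauto.
    + subst y. apply AH in H1 as [_ H1]. destruct Nx. eauto.
    + apply AH in H2 as [_ H2]. destruct Nx. eauto.
  - intros y u Hu. apply AH' in Hu as [Hu|[-> ->]].
    + apply AH in Hu as [Dy Vy]. destruct (rec_val_eq Vy) as (s' & Fs' & As' & Es' & Ps').
      split.
      * intros w Rw. destruct (Ps' w Rw) as [t Ht]. exists t. apply AH'. left. apply AH. eauto.
      * exists s'. split; auto. split; auto. intros w t. rewrite As', AH', AH. split.
        -- intros [Rw Hw]. split; auto. left. eauto.
        -- intros [[[_ Hw]|[-> ->]] Rw]; auto. destruct (Ps' x Rw) as [t Ht]. destruct Nx. eauto.
    + split.
      * intros w Rw. destruct (Px w Rw) as [t Ht]. exists t. apply AH'. left. apply AH. eauto.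
      * exists s. split; auto. split; auto. intros w t. rewrite As, AH', AH. split.
        -- intros [Rw Hw]. split; auto. left. eauto.
        -- intros [[[_ Hw]|[-> ->]] Rw]; auto. tauto.
Qed.

End Recursion.

(** * Collapse, transitive closures, the cumulative hierarchy, collection and choice *)

Section Mostowski.
Context {M : memstruct} {Z : ZFC M}.
Implicit Types a b c d g h p s u v w x y z : M.

(** Recursion along [R] with predecessors cut down to [D], where [wf] applies. The collapse may
    identify points, as it must for functions that are equal almost everywhere. *)
Lemma mostowski D (R : M -> M -> Prop) : Def2 R ->
  (forall C, subset C D -> (exists x, x ∈ C) -> exists x, x ∈ C /\ forall y, y ∈ C -> ~ R y x) ->
  exists g, fun_on D g /\
    forall x z, x ∈ D -> (z ∈ ap g x <-> exists y, y ∈ D /\ R y x /\ z = ap g y).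
Proof.
  intros HR wf.
  set (R' := fun y x => y ∈ D /\ R y x).
  set (E := fun x s v : M => forall z, z ∈ v <-> exists y, app s y z).
  assert (HR' : Def2 R') by (unfold R'; def).
  assert (HE : Def3 E) by (unfold E; def).
  assert (Efun : forall x s y y', E x s y -> E x s y' -> y = y').
  { intros x s y y' H H'. apply set_ext. intros z. now rewrite (H z), (H' z). }
  assert (wf' : forall C, (exists x, x ∈ C) -> exists x, x ∈ C /\ forall y, y ∈ C -> ~ R' y x).
  { intros C [x Hx]. destruct (classic (exists y, y ∈ C /\ y ∈ D)) as [[y [Hy Dy]]|N].
    - destruct (@sep _ Z C (fun x => x ∈ D)) as [C' HC]; [def|].
      destruct (wf C') as (m & Hm & K).
      + intros t Ht. now apply HC in Ht.
      + exists y. now apply HC.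
      + apply HC in Hm as [Hm _]. exists m. split; auto.
        intros t Ht [Dt Rt]. apply (K t); auto. now apply HC.
    - exists x. split; auto. intros y Hy [Dy _]. eauto. }
  assert (T : forall x, x ∈ D -> exists v, rec_val R' E x v).
  { apply rec_total; auto.
    - intros x y _ [H _]. exact H.
    - intros x s _ _ _ _. apply ran_ex. }
  pose proof (@def_rec_val _ _ HR' E HE) as Drv.
  destruct (@fun_intro _ Z D (rec_val R' E)) as (g & Hg & Ag); auto.
  { intros x y y' _. now apply rec_val_fun. }
  exists g. split; auto. intros x z Hx.
  assert (V : forall y, y ∈ D -> rec_val R' E y (ap g y)).
  { intros y Hy. apply Ag. now apply app_ap with D. }
  destruct (rec_val_eq wf' Efun (V x Hx)) as (s & _ & As & Es & _).
  rewrite (Es z). split.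
  - intros [y Hy]. apply As in Hy as [[Dy Ry] Hy]. exists y. repeat split; auto.
    exact (rec_val_fun wf' Efun Hy (V y Dy)).
  - intros (y & Dy & Ry & ->). exists y. apply As. split; [split; auto|auto].
Qed.

(** The collapse g of [a] under ∈ never raises an ordinal: at the least m with m ∈ g(m) there is y ∈
    m with m = g(y), and g(y) is at most y, so y ∈ m fails. Hence the range is at most [c]. *)
Lemma order_type a c : ordinal c -> subset a c ->
  exists b, ordinal b /\ ord_le b c /\ equinumerous a b.
Proof.
  intros Oc Hac.
  destruct (@mostowski a (fun y x => y ∈ x)) as (g & Hg & Eg).
  { def. }
  { intros C _ HC. apply (zfc_foundation Z). now apply not_empty. }
  assert (Oa : forall x, x ∈ a -> ordinal x) by (intros x Hx; apply (@ord_elem _ Z c); auto).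
  destruct (ran_ex g) as [b Hb].
  assert (Hb' : forall z, z ∈ b <-> exists x, x ∈ a /\ z = ap g x).
  { intros z. rewrite Hb. split; intros [x Hx]; exists x; now apply (app_ap_iff _ _ Hg). }
  assert (Mon : forall x y, x ∈ a -> y ∈ a -> x ∈ y -> ap g x ∈ ap g y).
  { intros x y Hx Hy H. apply Eg; eauto. }
  assert (Ob : ordinal b).
  { apply ord_intro.
    - intros z Hz t Ht. apply Hb' in Hz as (x & Hx & ->). apply Eg in Ht as (y & Hy & _ & ->); auto.
      apply Hb'. eauto.
    - intros z t Hz Ht. apply Hb' in Hz as (x & Hx & ->), Ht as (y & Hy & ->).
      destruct (ord_tri (Oa x Hx) (Oa y Hy)) as [H|[H|H]]; auto. subst; auto. }
  assert (Le : forall x, x ∈ a -> ord_le (ap g x) x).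
  { apply NNPP. intros N. apply not_all_ex_not in N as [x N].
    destruct (@least_in _ Z a (fun x => ~ ord_le (ap g x) x)) as (m & Hm & Nm & K).
    { def. }
    { exists x. tauto. }
    apply Nm. apply ord_not_mem; auto.
    { apply (@ord_elem _ Z b); auto. apply Hb'. eauto. }
    intros H. apply Eg in H as (y & Hy & Hym & E); auto.
    assert (L : ord_le (ap g y) y) by (apply NNPP; exact (K y Hy Hym)).
    rewrite <- E in L. destruct L as [L|L].
    - destruct (no_cycle2 L Hym).
    - rewrite L in Hym. destruct (no_self Hym). }
  exists b. split; auto. split.
  - apply ord_sub_mem; auto. intros z Hz. apply Hb' in Hz as (x & Hx & ->).
    apply (@ord_le_mem_trans _ (ap g x) x c); auto.
  - exists g. split; [split; [split; auto|]|].
    + intros x y H. apply Hb. eauto.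
    + intros x x' y H H'. apply (app_ap_iff _ _ Hg) in H as [Hx ->], H' as [Hx' E].
      destruct (ord_tri (Oa x Hx) (Oa x' Hx')) as [H|[H|H]]; auto.
      * apply Mon in H; auto. rewrite E in H. destruct (no_self H).
      * apply Mon in H; auto. rewrite E in H. destruct (no_self H).
    + intros y Hy. now apply Hb.
Qed.

(** Recursion along the inductive set [w] of Infinity, with ∈ restricted to [w]. The value at n
    consists of [a] and of the elements of elements of earlier values, so the union of all values is
    transitive. *)
Lemma tc_ex a : exists t, transitive_set t /\ a ∈ t.
Proof.
  destruct (zfc_infinity Z) as (w & (o & _ & Ho) & Hs).
  set (R := fun y x : M => y ∈ w /\ y ∈ x).
  set (E := fun x s v : M => forall z, z ∈ v <-> z = a \/ exists m p q, app s m p /\ q ∈ p /\ z ∈ q).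
  assert (HR : Def2 R) by (unfold R; def).
  assert (HE : Def3 E) by (unfold E; def).
  assert (Efun : forall x s y y', E x s y -> E x s y' -> y = y').
  { intros x s y y' H H'. apply set_ext. intros z. now rewrite (H z), (H' z). }
  assert (wf : forall C, (exists x, x ∈ C) -> exists x, x ∈ C /\ forall y, y ∈ C -> ~ R y x).
  { intros C HC. destruct (zfc_foundation Z (a := C)) as (x & Hx & K); [now apply not_empty|].
    exists x. split; auto. intros y Hy [_ H]. exact (K y Hy H). }
  assert (T : forall x, x ∈ w -> exists v, rec_val R E x v).
  { apply rec_total; auto.
    - intros x y _ [H _]. exact H.
    - intros x s _ _ _ _. destruct (ran_ex s) as [r Hr]. exists (bu (sg a) (Un (Un r))).
      intros z. rewrite in_bu, in_sg, in_Un. apply or_iff_compat_l. split.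
      + intros (q & Hq & Hz). apply in_Un in Hq as (p & Hp & Hq). apply Hr in Hp as [m Hm]. eauto 6.
      + intros (m & p & q & H1 & H2 & H3). exists q. split; auto. apply in_Un. exists p.
        split; auto. apply Hr. eauto. }
  pose proof (@def_rec_val _ _ HR E HE) as Drv.
  destruct (@repl _ Z w (rec_val R E)) as [r Hr]; auto.
  { intros x y y' _. now apply rec_val_fun. }
  exists (Un r). split.
  - intros x Hx z Hz. apply in_Un in Hx as (v & Hv & Hx). apply Hr in Hv as (n & Hn & Hv).
    destruct (Hs n Hn) as (n' & Sn & Hn'). destruct (T n' Hn') as [v' Hv'].
    apply in_Un. exists v'. split; [apply Hr; eauto|].
    destruct (rec_val_eq wf Efun Hv') as (s & _ & As & Es & _).
    apply Es. right. exists n, v, x. split; auto. apply As. split; auto. split; auto.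
    apply Sn. auto.
  - destruct (T o Ho) as [v Hv]. apply in_Un. exists v. split; [apply Hr; eauto|].
    destruct (rec_val_eq wf Efun Hv) as (s & _ & As & Es & _). apply Es. auto.
Qed.

Lemma eps_ind (Q : M -> Prop) : Def1 Q ->
  (forall x, (forall y, y ∈ x -> Q y) -> Q x) -> forall x, Q x.
Proof.
  intros HQ H x. apply NNPP. intros N. destruct (tc_ex x) as (t & T & Hx).
  destruct (@least_in _ Z t (fun x => ~ Q x)) as (m & Hm & Nm & K); [def|eauto|].
  apply Nm, H. intros y Hy. apply NNPP. apply K; auto. exact (T m Hm y Hy).
Qed.

(** A name r used in t lies three ∈-steps down, since r ∈ {r} ∈ (r, p) ∈ t; so the ∈-induction
    carries the claim for a set, its elements and their elements. *)
Lemma name_ind (Q : M -> Prop) : Def1 Q ->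
  (forall t, (forall r p, app t r p -> Q r) -> Q t) -> forall t, Q t.
Proof.
  intros HQ H.
  assert (K : forall t, Q t /\ (forall u, u ∈ t -> Q u) /\ (forall u v, u ∈ t -> v ∈ u -> Q v)).
  { apply (@eps_ind (fun t => Q t /\ (forall u, u ∈ t -> Q u) /\
                              (forall u v, u ∈ t -> v ∈ u -> Q v))); [def|].
    intros t IH. split; [|split].
    - apply H. intros r p Hr. apply app_pr in Hr. destruct (IH _ Hr) as (_ & _ & IH').
      apply (IH' (sg r)); [unfold pr; apply in_up; auto|now apply in_sg].
    - intros u Hu. exact (proj1 (IH u Hu)).
    - intros u v Hu Hv. destruct (IH u Hu) as (_ & IH' & _). auto. }
  intros t. apply K.
Qed.

Lemma wf_eps : forall C : M, (exists x, x ∈ C) -> exists x, x ∈ C /\ forall y, y ∈ C -> ~ y ∈ x.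
Proof. intros C HC. apply (zfc_foundation Z). now apply not_empty. Qed.

Lemma wf_name : forall C : M, (exists x, x ∈ C) ->
  exists x, x ∈ C /\ forall y, y ∈ C -> ~ exists p, app x y p.
Proof.
  intros C [x Hx]. apply NNPP. intros N. revert x Hx.
  apply (@name_ind (fun x => ~ x ∈ C)); [def|].
  intros t IH Ht. apply N. exists t. split; auto. intros y Hy (p & Hp). exact (IH y p Hp Hy).
Qed.

(* [stage x v]: v is the union of the powersets of the stages of the elements
   of x; the stage of an ordinal [a] is the level [V_a]. *)
Definition stage_step x s v : Prop :=
  forall z, z ∈ v <-> exists y m, app s y m /\ subset z m.
Definition stage x v := rec_val (fun y x => y ∈ x) stage_step x v.

Lemma def_eps : Def2 (fun y x : M => y ∈ x).
Proof. def. Qed.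

Lemma def_stage_step : Def3 stage_step.
Proof. unfold stage_step. def. Qed.

Lemma stage_step_fun x s y y' : stage_step x s y -> stage_step x s y' -> y = y'.
Proof. intros H H'. apply set_ext. intros z. now rewrite (H z), (H' z). Qed.

Lemma def_stage : Def2 stage.
Proof. apply def_rec_val; [exact def_eps|exact def_stage_step]. Qed.

Lemma stage_ex x : exists v, stage x v.
Proof.
  destruct (tc_ex x) as (t & T & Hx). revert x Hx.
  apply rec_total.
  - exact def_eps.
  - exact wf_eps.
  - exact def_stage_step.
  - exact stage_step_fun.
  - intros x y Hx Hy. exact (T x Hx y Hy).
  - intros x s _ _ _ _. destruct (ran_ex s) as [r Hr].
    destruct (@repl _ Z r (fun m v => v = Pw m)) as [q Hq]; [def|congruence|].
    exists (Un q). intros z. rewrite in_Un. split.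
    + intros (v & Hv & Hz). apply Hq in Hv as (m & Hm & ->). apply Hr in Hm as [y Hy].
      apply in_Pw in Hz. eauto.
    + intros (y & m & Hy & Hz). exists (Pw m). rewrite in_Pw. split; auto.
      apply Hq. exists m. split; auto. apply Hr. eauto.
Qed.

Lemma in_stage x v z : stage x v ->
  (z ∈ v <-> exists y m, y ∈ x /\ stage y m /\ subset z m).
Proof.
  intros H.
  destruct (rec_val_eq wf_eps stage_step_fun H) as (s & _ & As & Es & _).
  rewrite (Es z). split.
  - intros (y & m & Hy & Hz). apply As in Hy as [Hy Hm]. eauto.
  - intros (y & m & Hy & Hm & Hz). exists y, m. split; auto. apply As. auto.
Qed.

Lemma stage_mono x y v w : subset x y -> stage x v -> stage y w -> subset v w.
Proof.
  intros H Hv Hw z Hz. apply (in_stage _ Hv) in Hz as (t & m & Ht & Hm & Hz).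
  apply (in_stage _ Hw). eauto 6.
Qed.

(** The witnesses for one x may form a proper class, but the least ones are given by a functional
    relation, to which replacement applies. *)
Lemma least_bound a (P : M -> M -> Prop) : Def2 P -> (forall x r, P x r -> ordinal r) ->
  exists b, ordinal b /\ forall x r, x ∈ a -> P x r -> exists m, m ∈ b /\ P x m.
Proof.
  intros DP OP.
  destruct (@repl _ Z a (fun x r => P x r /\ forall b, b ∈ r -> ~ P x b)) as [c Hc]; [def| |].
  { intros y r r' _ [H1 H2] [H3 H4]. destruct (ord_tri (OP _ _ H1) (OP _ _ H3)) as [K|[K|K]]; auto.
    - destruct (H4 r); auto.
    - destruct (H2 r'); auto. }
  destruct (@ord_bound _ Z c) as (b & Ob & Hb).
  { intros r Hr. apply Hc in Hr as (y & _ & Pr & _). eauto. }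
  exists b. split; auto. intros x r Hx Pr.
  destruct (@least_ord _ Z (P x) r) as (m & Om & Pm & _ & K); [def|eauto|auto|].
  exists m. split; auto. apply Hb, Hc. eauto.
Qed.

Lemma stage_cover x : exists a v, ordinal a /\ stage a v /\ x ∈ v.
Proof.
  pose proof def_stage as Ds. revert x.
  apply (@eps_ind (fun x => exists a v, ordinal a /\ stage a v /\ x ∈ v)); [def|].
  intros x IH.
  destruct (@least_bound x (fun y a => ordinal a /\ exists v, stage a v /\ y ∈ v)) as (b & Ob & Hb);
    [def|tauto|].
  destruct (stage_ex b) as [v Hv], (stage_ex (sc b)) as [v' Hv'].
  exists (sc b), v'. split; [now apply ord_sc|]. split; auto.
  apply (in_stage _ Hv'). exists b, v. split; [apply in_sc; auto|]. split; auto.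
  intros y Hy. destruct (IH y Hy) as (a & u & Oa & Hu & Hyu).
  destruct (Hb y a Hy) as (m & Hm & _ & v0 & Hv0 & Hy0); [eauto|].
  apply (@stage_mono m b v0 v); auto. now apply Ob.
Qed.

(** Scott's trick: the least level of the hierarchy meeting the class of witnesses for x is bounded
    as x runs through [a]. *)
Lemma collection a (Q : M -> M -> Prop) : Def2 Q ->
  exists b, forall x, x ∈ a -> (exists y, Q x y) -> exists y, y ∈ b /\ Q x y.
Proof.
  intros HQ. pose proof def_stage as Ds.
  destruct (@least_bound a (fun x r => ordinal r /\ exists v y, stage r v /\ y ∈ v /\ Q x y))
    as (b & Ob & Hb); [def|tauto|].
  destruct (stage_ex b) as [v Hv]. exists v. intros x Hx (y & Hy).
  destruct (stage_cover y) as (r & u & Or & Hu & Hyu).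
  destruct (Hb x r Hx) as (m & Hm & _ & v0 & y0 & Hv0 & Hy0 & HQ0); [eauto 6|].
  exists y0. split; auto. apply (@stage_mono m b v0 v); auto. now apply Ob.
Qed.

(** Collection first confines the witnesses to a set [b]; the axiom of choice is then applied to the
    family of sets of witnesses inside [b]. *)
Lemma choice_fun a (Q : M -> M -> Prop) : Def2 Q -> (forall x, x ∈ a -> exists y, Q x y) ->
  exists g, fun_on a g /\ forall x, x ∈ a -> Q x (ap g x).
Proof.
  intros HQ T. destruct (@collection a Q HQ) as [b Hb].
  set (P := fun x s => forall y, y ∈ s <-> y ∈ b /\ Q x y).
  assert (DP : Def2 P) by (unfold P; def).
  assert (Pf : forall x s s', P x s -> P x s' -> s = s').
  { intros x s s' H H'. apply set_ext. intros y. now rewrite (H y), (H' y). }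
  destruct (@repl _ Z a P) as [c Hc]; eauto.
  destruct (zfc_choice Z (a := c)) as (h & Fh & Ch).
  { intros s Hs. apply Hc in Hs as (x & Hx & Px). apply not_empty.
    destruct (Hb x Hx (T x Hx)) as (y & Hy & Qy). exists y. apply Px. auto. }
  destruct (@fun_intro _ Z a (fun x y => exists s, P x s /\ app h s y)) as (g & Hg & Ag).
  - def.
  - intros x Hx. destruct (@sep _ Z b (Q x)) as [s Hs]; [def|].
    assert (Hsc : s ∈ c) by (apply Hc; eauto).
    exists (ap h s), s. split; auto. now apply app_ap with c.
  - intros x y y' _ (s & H1 & H2) (s' & H3 & H4). rewrite (Pf x s s') in H2 by auto.
    now apply (proj2 (proj1 Fh) s').
  - exists g. split; auto. intros x Hx.
    destruct (proj1 (Ag x (ap g x)) (app_ap Hg Hx)) as (_ & s & Ps & Hs).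
    apply Ch in Hs. now apply Ps in Hs.
Qed.

Lemma choice_fun_into a b (Q : M -> M -> Prop) : Def2 Q ->
  (forall x, x ∈ a -> exists y, y ∈ b /\ Q x y) ->
  exists g, fun_on a g /\ forall x, x ∈ a -> ap g x ∈ b /\ Q x (ap g x).
Proof. intros HQ. apply (@choice_fun a (fun x y => y ∈ b /\ Q x y)). def. Qed.

Lemma choice_partial a (Q : M -> M -> Prop) : Def2 Q ->
  exists g, fun_on a g /\ forall x, x ∈ a -> (exists y, Q x y) -> Q x (ap g x).
Proof.
  intros HQ. apply (@choice_fun a (fun x y => (exists z, Q x z) -> Q x y)); [def|].
  intros x _. destruct (classic (exists y, Q x y)) as [[y Hy]|N]; [eauto|]. exists x. tauto.
Qed.

Lemma fun_set_ex a b : exists D, forall v,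
  v ∈ D <-> fun_on a v /\ forall x, x ∈ a -> ap v x ∈ b.
Proof.
  destruct (@sep _ Z (Pw (pd a b)) (fun v => fun_on a v)) as [D HD]; [def|].
  exists D. intros v. rewrite HD, in_Pw. split.
  - intros (S & Fv). split; auto. intros x Hx.
    assert (K := S _ (proj1 (app_pr _ _ _) (app_ap Fv Hx))). now apply pr_in_pd in K.
  - intros (Fv & Rv). split; auto. intros z Hz.
    destruct (proj1 (proj1 Fv) z Hz) as (x & y & E). apply is_opair_pr in E. subst z.
    apply app_pr in Hz. apply (app_ap_iff _ _ Fv) in Hz as [Hx ->]. apply pr_in_pd. auto.
Qed.

(** Enumerate [a] along the ordinals by a choice function on its subsets. If [a] is exhausted at
    some ordinal, it injects there; otherwise the inverse of the enumeration maps a part of [a] onto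
    all ordinals. *)
Lemma well_ordering a : exists b, ordinal b /\ card_le a b.
Proof.
  apply NNPP. intros N.
  set (S := Pw a).
  destruct (@choice_partial S (fun s y => y ∈ s)) as (ch & Fch & Hch); [def|].
  set (E := fun x s v : M =>
    exists q, (forall z, z ∈ q <-> z ∈ a /\ ~ exists y, app s y z) /\ v ∈ q /\ v = ap ch q).
  assert (HE : Def3 E) by (unfold E; def).
  assert (Efun : forall x s y y', E x s y -> E x s y' -> y = y').
  { intros x s y y' (q & H1 & _ & ->) (q' & H2 & _ & ->). f_equal. apply set_ext.
    intros z. now rewrite (H1 z), (H2 z). }
  pose proof def_eps as HR. pose proof wf_eps as wf.
  set (rv := rec_val (fun y x : M => y ∈ x) E).
  assert (Drv : Def2 rv) by (apply def_rec_val; auto).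
  assert (Inj : forall x y v, ordinal x -> ordinal y -> rv x v -> rv y v -> x = y).
  { assert (K : forall x y v, x ∈ y -> rv x v -> rv y v -> False).
    { intros x y v H Hx Hy. destruct (rec_val_eq wf Efun Hy) as (s & _ & As & Es & _).
      destruct Es as (q & Hq & Hv & _). apply Hq in Hv as [_ Nv]. apply Nv. exists x. now apply As. }
    intros x y v Ox Oy Hx Hy. destruct (ord_tri Ox Oy) as [H|[H|H]]; auto; exfalso; eauto. }
  assert (T : forall b, ordinal b -> forall x, x ∈ b -> exists v, rv x v).
  { intros b Ob. apply rec_total; auto.
    - intros x y Hx Hy. exact (ord_trans Ob Hy Hx).
    - intros x s Hx Fs As Ps.
      destruct (@sep _ Z a (fun z => ~ exists y, app s y z)) as [q Hq]; [def|].
      destruct (classic (exists y, y ∈ q)) as [NE|NE].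
      + exists (ap ch q), q. split; auto. split; auto. apply Hch; auto.
        unfold S. apply in_Pw. intros z Hz. now apply Hq in Hz.
      + destruct N. exists x. assert (Ox : ordinal x) by (apply (@ord_elem _ Z b); auto).
        split; auto.
        assert (As' : forall y u, app s y u <-> y ∈ x /\ rv y u) by exact As.
        apply (@inj_intro _ Z a x (fun z y => rv y z)).
        * def.
        * intros z Hz. apply NNPP. intros Nz. apply NE. exists z. apply Hq. split; auto.
          intros [y Hy]. apply As' in Hy. eauto.
        * intros z y y' _ Hy Hy' H H'. apply (@Inj y y' z); auto; now apply (@ord_elem _ Z x).
        * intros z z' y _ _ _ H H'. eapply rec_val_fun; eauto. }
  destruct (@repl _ Z a (fun v x => ordinal x /\ rv x v)) as [c Hc]; [def| |].
  { intros v x y _ [H1 H2] [H3 H4]. eauto. }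
  destruct (burali_forti c) as (x & Ox & Nx). apply Nx. apply Hc.
  destruct (T (sc x) (ord_sc Ox) x) as [v Hv]; [apply in_sc; auto|].
  exists v. split; auto. destruct (rec_val_eq wf Efun Hv) as (s & _ & _ & Es & _).
  destruct Es as (q & Hq & Hv' & _). now apply Hq in Hv'.
Qed.

End Mostowski.

(** * Complete ultrafilters *)

(** The properties of omega needed for recursions of that length, in a form that passes easily to
    the generic extension. *)
Definition omega_like {M : memstruct} {Z : ZFC M} (w : M) :=
  ordinal w /\ emp ∈ w /\ (forall n, n ∈ w -> sc n ∈ w) /\
  forall n, n ∈ w -> n = emp \/ exists m, m ∈ w /\ n = sc m.

(* A [k]-complete ultrafilter in terms of its quantifier "for almost all x". *)
Record umeas {M : memstruct} {Z : ZFC M} (k X U : M) : Prop := {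
  um_omega : exists w, omega_like w /\ w ∈ k;
  um_mono : forall Q Q' : M -> Prop, Def1 Q' -> almost_all X U Q ->
    (forall x, x ∈ X -> Q x -> Q' x) -> almost_all X U Q';
  um_ex : forall Q, almost_all X U Q -> exists x, x ∈ X /\ Q x;
  um_ultra : forall Q, Def1 Q -> almost_all X U Q \/ almost_all X U (fun x => ~ Q x);
  um_compl : forall (Q : M -> M -> Prop) a, Def2 Q -> a ∈ k ->
    (forall y, y ∈ a -> almost_all X U (Q y)) ->
    almost_all X U (fun x => forall y, y ∈ a -> Q y x)
}.

Section Measures.
Context {M : memstruct} {Z : ZFC M}.
Implicit Types a b c d g h p s u v w x y z : M.

Lemma sc_inj a b : sc a = sc b -> a = b.
Proof.
  intros H. assert (Ha : a ∈ sc b) by (rewrite <- H; apply in_sc; auto).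
  assert (Hb : b ∈ sc a) by (rewrite H; apply in_sc; auto).
  apply in_sc in Ha as [Ha|Ha], Hb as [Hb|Hb]; auto. destruct (no_cycle2 Ha Hb).
Qed.

Lemma is_omega_like w : is_omega w -> omega_like w.
Proof.
  intros [L N]. split; [apply L|]. split; [now apply limit_emp|].
  split; [intros n; now apply limit_sc|].
  intros n Hn. destruct (classic (is_empty n)) as [E|E]; [left; now apply is_empty_emp|right].
  assert (On : ordinal n) by (apply (@ord_elem _ Z w); auto; apply L).
  apply NNPP. intros K. apply (N n Hn). split; auto. split; auto.
  intros x Hx. apply NNPP. intros K'. apply K. exists x. split.
  - apply (@ord_trans _ w x n); auto. apply L.
  - apply set_ext. intros y. rewrite in_sc. split.
    + intros Hy. destruct (ord_lin On Hx Hy) as [H|[H|H]]; auto. destruct K'. eauto.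
    + intros [H| ->]; auto. now apply (@ord_trans _ n y x).
Qed.

Lemma no_card_le_mem k a : cardinal k -> a ∈ k -> ~ card_le k a.
Proof.
  intros [Ok Nk] Ha (g & Hg). destruct (image_ex Hg) as (c & Hc & E).
  assert (Oa : ordinal a) by now apply (@ord_elem _ Z k).
  destruct (order_type Oa Hc) as (b & Ob & Hb & E').
  apply (Nk b).
  - apply (@ord_le_mem_trans _ b a k); auto.
  - apply equinumerous_sym. now apply (@equinumerous_trans _ Z k c b).
Qed.

Section FromUltrafilter.
Context (k X U : M).

Lemma almost_all_mem a : subset a X -> (almost_all X U (fun x => x ∈ a) <-> a ∈ U).
Proof.
  intros Ha. split.
  - intros (s & Hs & K). enough (E : s = a) by now rewrite <- E.
    apply set_ext. intros x. rewrite (K x). intuition.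
  - intros H. exists a. split; auto. intros x. intuition.
Qed.

Lemma complete_ultrafilter_umeas : (exists w, omega_like w /\ w ∈ k) -> ordinal k -> (forall a, a ∈ k -> ~ card_le k a) ->
  complete_ultrafilter k X U -> umeas k X U.
Proof.
  intros Om Ok Nk (Sub & NE & Up & Cm & Ul). constructor; [exact Om|..].
  - intros Q Q' HQ' (s & Hs & K) H. destruct (@sep _ Z X Q' HQ') as [t Ht].
    exists t. split; auto. apply (Up s); auto.
    + intros x Hx. apply K in Hx as [Hx Qx]. apply Ht. auto.
    + intros x Hx. now apply Ht in Hx.
  - intros Q (s & Hs & K). apply NNPP. intros N. apply (NE s); auto.
    intros x Hx. apply K in Hx. eauto.
  - intros Q HQ. destruct (@sep _ Z X Q HQ) as [t Ht].
    destruct (@sep _ Z X (fun x => ~ Q x)) as [t' Ht']; [def|].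
    destruct (Ul t t') as [H|H].
    + intros x Hx. now apply Ht in Hx.
    + intros x. rewrite Ht', Ht. intuition.
    + left. exists t. auto.
    + right. exists t'. auto.
  - intros Q a HQ Ha H.
    assert (Oa : ordinal a) by now apply (@ord_elem _ Z k).
    set (P := fun s y => forall x, x ∈ s <-> x ∈ X /\ Q y x).
    assert (HP : Def2 P) by (unfold P; def).
    destruct (@sep _ Z U (fun s => exists y, y ∈ a /\ P s y)) as [A HA]; [def|].
    (* Different indices may give the same set, so each set is sent to its least index. *)
    assert (LA : card_le A a).
    { apply (@inj_intro _ Z A a (fun s y => P s y /\ forall z, z ∈ y -> ~ P s z)).
      - def.
      - intros s Hs. apply HA in Hs as (_ & y & Hy & Py).
        destruct (@least_in _ Z a (P s)) as (m & Hm & Pm & K); [def|eauto|].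
        exists m. split; auto. split; auto. intros z Hz. apply K; auto.
        now apply (@ord_trans _ a z m).
      - intros s y y' _ Hy Hy' [H1 H2] [H3 H4].
        destruct (ord_lin Oa Hy Hy') as [K|[K|K]]; auto.
        + destruct (H4 y K H1).
        + destruct (H2 y' K H3).
      - intros s s' y _ _ _ [H1 _] [H2 _]. apply set_ext. intros x. now rewrite (H1 x), (H2 x). }
    destruct (@sep _ Z X (fun x => forall y, y ∈ a -> Q y x)) as [b Hb]; [def|].
    exists b. split; auto. apply (Cm A b).
    + intros s Hs. now apply HA in Hs.
    + split.
      * apply (card_le_trans LA). apply card_le_sub. now apply Ok.
      * intros K. exact (Nk a Ha (card_le_trans K LA)).
    + intros x. rewrite Hb. split.
      * intros [Hx K]. split; auto. intros s Hs. apply HA in Hs as (Us & y & Hy & Py).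
        apply Py. auto.
      * intros [Hx K]. split; auto. intros y Hy. destruct (H y Hy) as (s & Hs & K').
        assert (Hxs : x ∈ s) by (apply K; apply HA; split; auto; exists y; auto).
        now apply K' in Hxs.
Qed.

Context (HU : umeas k X U).

Lemma um_true (Q : M -> Prop) : Def1 Q -> (forall x, x ∈ X -> Q x) -> almost_all X U Q.
Proof.
  intros HQ H. destruct (um_ultra HU HQ) as [K|K]; auto.
  destruct (um_ex HU K) as (x & Hx & N). destruct (N (H x Hx)).
Qed.

Lemma um_not (Q : M -> Prop) : Def1 Q -> ~ almost_all X U Q -> almost_all X U (fun x => ~ Q x).
Proof. intros HQ H. destruct (um_ultra HU HQ) as [K|K]; tauto. Qed.

(** The two predicates are made into a family indexed by omega, with [Q] at 0 and [Q'] at all other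
    indices, so that completeness covers binary intersections. *)
Lemma um_and (Q Q' : M -> Prop) : Def1 Q -> Def1 Q' ->
  almost_all X U Q -> almost_all X U Q' -> almost_all X U (fun x => Q x /\ Q' x).
Proof.
  intros HQ HQ' H H'. destruct (um_omega HU) as (w & (Ow & He & Hs & _) & Hwk).
  apply (um_mono HU (Q := fun x => forall y, y ∈ w -> (y = emp -> Q x) /\ (y <> emp -> Q' x))).
  - def.
  - apply (um_compl HU (Q := fun y x => (y = emp -> Q x) /\ (y <> emp -> Q' x))); auto.
    + def.
    + intros y Hy. destruct (classic (y = emp)) as [E|E].
      * apply (um_mono HU (Q := Q)); [def|auto|tauto].
      * apply (um_mono HU (Q := Q')); [def|auto|tauto].
  - intros x Hx K. split.
    + apply (K emp); auto.
    + apply (K (sc emp)); auto. intros E. apply (@in_emp _ Z emp). rewrite <- E at 2.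
      apply in_sc. auto.
Qed.

Lemma um_and_mono (Q Q' P : M -> Prop) : Def1 Q -> Def1 Q' -> Def1 P ->
  almost_all X U Q -> almost_all X U Q' -> (forall x, x ∈ X -> Q x -> Q' x -> P x) ->
  almost_all X U P.
Proof.
  intros HQ HQ' HP H H' K. apply (um_mono HU (Q := fun x => Q x /\ Q' x)); auto.
  - now apply um_and.
  - intros x Hx [H1 H2]. auto.
Qed.

Lemma um_contra (Q : M -> Prop) :
  Def1 Q -> almost_all X U Q -> almost_all X U (fun x => ~ Q x) -> False.
Proof.
  intros HQ H H'. destruct (um_ex HU (um_and HQ (def_not HQ) H H')) as (x & _ & K1 & K2). auto.
Qed.

(** Otherwise a choice function on [C] yields functions u_n of which each next one is below its
    predecessor almost everywhere. By completeness for omega a single x serves all n, and the values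
    u_n(x) violate Foundation. *)
Lemma ult_wf C : (forall u, u ∈ C -> fun_on X u) -> (exists u, u ∈ C) ->
  exists u, u ∈ C /\ forall v, v ∈ C -> ~ ult_mem X U v u.
Proof.
  intros FC [u0 Hu0]. apply NNPP. intros N.
  destruct (um_omega HU) as (w & (Ow & He & Hs & Hc) & Hwk).
  destruct (@choice_fun_into _ Z C C (fun u v => ult_mem X U v u)) as (nx & Fnx & Hnx); [def| |].
  { intros u Hu. apply NNPP. intros K. apply N. exists u. split; auto. intros v Hv Hm. eauto. }
  set (E := fun n s y : M => (n = emp /\ y = u0) \/ exists m z, n = sc m /\ app s m z /\
    is_function s /\ y = ap nx z).
  assert (HE : Def3 E) by (unfold E; def).
  assert (NS : forall m, emp <> sc m).
  { intros m K. apply (@in_emp _ Z m). rewrite K. apply in_sc. auto. }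
  assert (Efun : forall x s y y', E x s y -> E x s y' -> y = y').
  { intros x s y y' [[-> ->]|(m & z & -> & H1 & Fs & ->)] [[E1 ->]|(m' & z' & E1 & H2 & _ & ->)]; auto.
    - destruct (NS _ E1).
    - symmetry in E1. destruct (NS _ E1).
    - apply sc_inj in E1. subst m'. now rewrite (proj2 Fs m z z'). }
  pose proof (@wf_eps _ Z) as wf. pose proof (@def_eps M) as HR.
  set (rv := rec_val (fun y x : M => y ∈ x) E).
  assert (Drv : Def2 rv) by (apply def_rec_val; auto).
  assert (Rf : forall x v v', rv x v -> rv x v' -> v = v').
  { intros x v v'. now apply rec_val_fun. }
  assert (T : forall n, n ∈ w -> exists v, rv n v).
  { apply rec_total; auto.
    - intros x y Hx Hy. now apply (@ord_trans _ w y x).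
    - intros n s Hn Fs As Ps. destruct (Hc n Hn) as [->|(m & Hm & ->)].
      + exists u0. left. auto.
      + destruct (Ps m) as [z Hz]; [apply in_sc; auto|]. exists (ap nx z). right.
        exists m, z. split; auto. split; auto. apply As. split; auto. apply in_sc; auto. }
  assert (Rs : forall m u, sc m ∈ w -> rv m u -> rv (sc m) (ap nx u)).
  { intros m u Hm Hu. destruct (T (sc m) Hm) as [v Hv].
    destruct (rec_val_eq wf Efun Hv) as (s & Fs & As & Es & _).
    destruct Es as [[E1 _]|(m' & z & E1 & Hz & _ & ->)].
    - symmetry in E1. destruct (NS _ E1).
    - apply sc_inj in E1. subst m'. apply As in Hz as [_ Hz]. now rewrite (Rf m u z). }
  assert (RC : forall n, n ∈ w -> forall u, rv n u -> u ∈ C).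
  { apply NNPP. intros K. apply not_all_ex_not in K as [n K].
    destruct (@least_in _ Z w (fun n => ~ forall u, rv n u -> u ∈ C)) as (m & Hm & Nm & L); [def| |].
    { exists n. tauto. }
    apply Nm. intros u Hu.
    destruct (rec_val_eq wf Efun Hu) as (s & Fs & As & Es & _).
    destruct Es as [[E1 ->]|(m' & z & -> & Hz & _ & ->)]; auto.
    apply As in Hz as [Hm' Hz]. apply Hnx. apply NNPP. intros Nz.
    apply (L m'); auto.
    apply (@ord_trans _ w m' (sc m')); auto. }
  assert (AA : almost_all X U (fun x => forall n, n ∈ w ->
    exists u v, rv n u /\ rv (sc n) v /\ ap v x ∈ ap u x)).
  { apply (um_compl HU (Q := fun n x => exists u v, rv n u /\ rv (sc n) v /\ ap v x ∈ ap u x)); auto.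
    - def.
    - intros n Hn. destruct (T n Hn) as [u Hu]. assert (Cu := RC n Hn u Hu).
      destruct (Hnx u Cu) as [Cv Hm].
      apply (um_mono HU (Q := fun x => exists y y', app (ap nx u) x y /\ app u x y' /\ y ∈ y')).
      + def.
      + exact Hm.
      + intros x Hx (y & y' & H1 & H2 & H3). exists u, (ap nx u). split; auto.
        split; [now apply Rs; auto|].
        rewrite (ap_eq (proj1 (FC _ Cv)) H1), (ap_eq (proj1 (FC _ Cu)) H2). exact H3. }
  destruct (um_ex HU AA) as (x & Hx & Kx).
  destruct (@repl _ Z w (fun n y => exists u, rv n u /\ y = ap u x)) as [D HD]; [def| |].
  { intros n y y' _ (u & Hu & ->) (u' & Hu' & ->). now rewrite (Rf n u u'). }
  destruct (wf D) as (y & Hy & Min).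
  { destruct (T emp He) as [u Hu]. exists (ap u x). apply HD. eauto. }
  apply HD in Hy as (n & Hn & u & Hu & ->).
  destruct (Kx n Hn) as (u' & v & Hu' & Hv & Hvu). rewrite (Rf n u' u) in Hvu by auto.
  apply (Min (ap v x)); auto. apply HD. exists (sc n). split; auto. eauto.
Qed.

End FromUltrafilter.

Lemma umeas_complete_ultrafilter k X U : ordinal k -> umeas k X U ->
  (forall a, a ∈ U -> subset a X) -> complete_ultrafilter k X U.
Proof.
  intros Ok HU Sub. split; [exact Sub|]. split; [|split; [|split]].
  - intros a Ea Ua. apply (almost_all_mem U (Sub a Ua)) in Ua.
    destruct (um_ex HU Ua) as (x & _ & Hx). exact (Ea x Hx).
  - intros a b Ua Hab Hb. apply (almost_all_mem U Hb).
    apply (um_mono HU (Q := fun x => x ∈ a)); [def| |auto].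
    apply almost_all_mem; auto.
  - intros A b HA [[g Hg] N] Eb.
    assert (Hb : subset b X) by (intros x Hx; now apply Eb in Hx).
    apply (almost_all_mem U Hb).
    destruct (image_ex Hg) as (c & Hc & E).
    destruct (order_type Ok Hc) as (r & Or & Hr & E').
    pose proof (equinumerous_trans E E') as E2.
    assert (Rk : r ∈ k).
    { destruct Hr as [Hr| ->]; auto. destruct N.
      apply equinumerous_card_le. now apply equinumerous_sym. }
    destruct E2 as (h & Hh & _). destruct (injE Hh) as (T & D & F & I).
    apply (um_mono HU (Q := fun x => forall y, y ∈ r -> forall a, app h a y -> x ∈ a)); [def| |].
    + apply (um_compl HU (Q := fun y x => forall a, app h a y -> x ∈ a)); [def|auto|].
      intros y Hy. destruct (classic (exists a, app h a y)) as [[a Ha]|Na].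
      * assert (Ua : a ∈ U) by (apply HA; now apply D in Ha).
        apply (um_mono HU (Q := fun x => x ∈ a)); [def| |].
        -- apply almost_all_mem; auto.
        -- intros x _ Hx a' Ha'. now rewrite (I a' a y).
      * apply um_true with k; [auto|def|]. intros x _ a Ha. destruct Na. eauto.
    + intros x Hx K. apply Eb. split; auto. intros a Ha.
      destruct (T a Ha) as (y & Hy & Hay). eauto.
  - intros a b Ha Eb.
    destruct (um_ultra HU (Q := fun x => x ∈ a)) as [H|H]; [def| |].
    + left. now apply almost_all_mem in H.
    + right. assert (Hb : subset b X) by (intros x Hx; now apply Eb in Hx).
      apply (almost_all_mem U Hb). apply (um_mono HU (Q := fun x => ~ x ∈ a)); [def|auto|].
      intros x Hx Nx. apply Eb. auto.
Qed.

End Measures.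

(** * Fine measures and the critical point *)

Section FineMeasure.
Context {M : memstruct} {Z : ZFC M}.
Implicit Types a b c d g h p s u v x y z : M.
Context (k th I U w : M).
Context (Ck : cardinal k) (Hw : omega_like w) (Hwk : w ∈ k).
Context (Oth : ordinal th) (Hkth : ord_le k th) (HU : fine_measure k th I U).

Local Notation All := (almost_all I U).

Lemma fm_ord : ordinal k.
Proof. apply Ck. Qed.

Lemma fm_umeas : umeas k I U.
Proof.
  apply complete_ultrafilter_umeas.
  - exists w. auto.
  - apply fm_ord.
  - intros a. now apply no_card_le_mem.
  - apply HU.
Qed.

Lemma fm_fine a : a ∈ th -> All (fun x => a ∈ x).
Proof.
  intros Ha. destruct (@sep _ Z I (fun x => a ∈ x)) as [b Hb]; [def|].
  exists b. split; auto. apply (proj2 (proj2 HU) a b); auto.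
Qed.

Lemma fm_fine_k a : a ∈ k -> All (fun x => a ∈ x).
Proof. intros Ha. apply fm_fine. now apply (@ord_mem_le_trans _ a k th). Qed.

Lemma fm_not_le x : x ∈ I -> ~ card_le k x.
Proof. intros Hx. apply (proj1 HU x) in Hx as (_ & _ & H). exact H. Qed.

(** The contradiction in which the arguments on [k] end: too much completeness, together with
    fineness, would put all of [k] into one x of size less than [k]. *)
Lemma fm_not_cover : ~ All (fun x => forall a, a ∈ k -> a ∈ x).
Proof.
  intros H. destruct (um_ex fm_umeas H) as (x & Hx & K).
  apply (fm_not_le Hx). now apply card_le_sub.
Qed.

Lemma fm_below a : a ∈ k -> All (fun x => forall b, ord_le b a -> b ∈ x).
Proof.
  intros Ha. apply (um_and_mono fm_umeas (Q := fun x => forall b, b ∈ a -> b ∈ x) (Q' := fun x => a ∈ x)).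
  - def.
  - def.
  - def.
  - apply (um_compl fm_umeas (Q := fun b x => b ∈ x)); auto; [def|].
    intros b Hb. apply fm_fine_k. apply (@ord_trans _ k b a); auto. apply fm_ord.
  - now apply fm_fine_k.
  - intros x _ H1 H2 b [Hb| ->]; auto.
Qed.

Lemma fm_limit : limit_ordinal k.
Proof.
  split; [apply fm_ord|]. split; [apply not_empty; eauto|].
  intros m Hm. apply NNPP. intros N. apply fm_not_cover.
  apply (um_mono fm_umeas (Q := fun x => forall b, ord_le b m -> b ∈ x)); [def|now apply fm_below|].
  intros x _ H a Ha. apply H. apply ord_not_mem.
  - now apply (@ord_elem _ Z k _ fm_ord).
  - now apply (@ord_elem _ Z k _ fm_ord).
  - intros K. eauto.
Qed.

(* Otherwise [k]-completeness would improve to [k^+]-completeness. *)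
Lemma fm_regular a (Q : M -> M -> Prop) : Def2 Q -> a ∈ k ->
  (forall x y, x ∈ a -> Q x y -> y ∈ k) ->
  (forall x y y', x ∈ a -> Q x y -> Q x y' -> y = y') ->
  exists b, b ∈ k /\ forall x y, x ∈ a -> Q x y -> y ∈ b.
Proof.
  intros HQ Ha Kq Fq. apply NNPP. intros N. apply fm_not_cover.
  apply (um_mono fm_umeas
    (Q := fun x => forall t, t ∈ a -> forall y, Q t y -> forall b, ord_le b y -> b ∈ x)).
  - def.
  - apply (um_compl fm_umeas (Q := fun t x => forall y, Q t y -> forall b, ord_le b y -> b ∈ x));
      [def|auto|].
    intros t Ht. destruct (classic (exists y, Q t y)) as [[y Hy]|Ny].
    + apply (um_mono fm_umeas (Q := fun x => forall b, ord_le b y -> b ∈ x)); [def| |].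
      * apply fm_below. eauto.
      * intros x _ H y' Hy'. rewrite (Fq t y' y); auto.
    + apply (um_true fm_umeas); [def|]. intros x _ y Hy. destruct Ny. eauto.
  - intros x _ H b Hb. apply NNPP. intros Nb. apply N. exists b. split; auto.
    intros t y Ht Hy. apply NNPP. intros Ny. apply Nb. apply (H t Ht y Hy).
    apply ord_not_mem; auto; apply (@ord_elem _ Z k _ fm_ord); eauto.
Qed.

(* This amounts to [|A| < k]; the closure properties of [comp] replace cardinal arithmetic. *)
Definition comp A := forall Q : M -> M -> Prop, Def2 Q ->
  (forall y, y ∈ A -> All (Q y)) -> All (fun x => forall y, y ∈ A -> Q y x).

Definition small A := exists b, b ∈ k /\ card_le A b.

(** Through an injection of [k], completeness for families indexed by [A] would let almost every x
    contain all of [k]. *)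
Lemma comp_not_le A : comp A -> ~ card_le k A.
Proof.
  intros HA (g & Hg). destruct (injE Hg) as (T & D & F & J). apply fm_not_cover.
  apply (um_mono fm_umeas (Q := fun x => forall y, y ∈ A -> forall t, app g t y -> t ∈ x)).
  - def.
  - apply (HA (fun y x => forall t, app g t y -> t ∈ x)); [def|].
    intros y Hy. destruct (classic (exists t, app g t y)) as [[t Ht]|Nt].
    + apply (um_mono fm_umeas (Q := fun x => t ∈ x)); [def| |].
      * apply fm_fine_k. now apply D in Ht.
      * intros x _ Hx t' Ht'. now rewrite (J t' t y).
    + apply (um_true fm_umeas); [def|]. intros x _ t Ht. destruct Nt. eauto.
  - intros x _ H t Ht. destruct (T t Ht) as (y & Hy & Hty). eauto.
Qed.

Lemma not_le_small A : ~ card_le k A -> small A.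
Proof.
  intros H. destruct (well_ordering A) as (b & Ob & g & Hg).
  destruct (image_ex Hg) as (c & Hc & E).
  destruct (order_type Ob Hc) as (r & Or & _ & E').
  pose proof (equinumerous_trans E E') as E2.
  exists r. split; [|now apply equinumerous_card_le].
  destruct (ord_le_or fm_ord Or) as [K|K]; auto. destruct H.
  apply (@card_le_trans _ Z k r A).
  - apply card_le_sub. now apply ord_le_sub.
  - apply equinumerous_card_le. now apply equinumerous_sym.
Qed.

Lemma small_comp A : small A -> comp A.
Proof.
  intros (b & Hb & g & Hg) Q HQ H. destruct (injE Hg) as (T & D & F & J).
  apply (um_mono fm_umeas (Q := fun x => forall t, t ∈ b -> forall y, app g y t -> Q y x)).
  - def.
  - apply (um_compl fm_umeas (Q := fun t x => forall y, app g y t -> Q y x)); [def|auto|].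
    intros t Ht. destruct (classic (exists y, app g y t)) as [[y Hy]|Ny].
    + apply (um_mono fm_umeas (Q := Q y)); [def| |].
      * apply H. now apply D in Hy.
      * intros x _ Hx y' Hy'. now rewrite (J y' y t).
    + apply (um_true fm_umeas); [def|]. intros x _ y Hy. destruct Ny. eauto.
  - intros x _ K y Hy. destruct (T y Hy) as (t & Ht & Hyt). eauto.
Qed.

Lemma comp_small A : comp A -> small A.
Proof. intros H. now apply not_le_small, comp_not_le. Qed.

Lemma comp_mem a : a ∈ k -> comp a.
Proof. intros Ha Q HQ. now apply (um_compl fm_umeas). Qed.

Lemma comp_idx x : x ∈ I -> comp x.
Proof. intros Hx. apply small_comp, not_le_small. now apply fm_not_le. Qed.

Lemma comp_image A B (Q : M -> M -> Prop) : Def2 Q -> comp A ->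
  (forall y, y ∈ B -> exists x, x ∈ A /\ Q x y) ->
  (forall x y y', x ∈ A -> Q x y -> Q x y' -> y = y') -> comp B.
Proof.
  intros HQ HA S F P HP H.
  apply (um_mono fm_umeas (Q := fun x => forall t, t ∈ A -> forall y, y ∈ B -> Q t y -> P y x)); [def| |].
  - apply (HA (fun t x => forall y, y ∈ B -> Q t y -> P y x)); [def|].
    intros t Ht. destruct (classic (exists y, y ∈ B /\ Q t y)) as [[y [Hy Qy]]|Ny].
    + apply (um_mono fm_umeas (Q := P y)); [def|auto|].
      intros x _ Hx y' Hy' Qy'. now rewrite (F t y' y).
    + apply (um_true fm_umeas); [def|]. intros x _ y Hy Qy. destruct Ny. eauto.
  - intros x _ K y Hy. destruct (S y Hy) as (t & Ht & Qt). eauto.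
Qed.

Lemma comp_sub A B : comp A -> subset B A -> comp B.
Proof.
  intros HA H. apply (@comp_image A B (fun x y => x = y)); auto; [def| |congruence].
  intros y Hy. eauto.
Qed.

Lemma comp_bu A B : comp A -> comp B -> comp (bu A B).
Proof.
  intros HA HB Q HQ H.
  apply (um_and_mono fm_umeas (Q := fun x => forall y, y ∈ A -> Q y x) (Q' := fun x => forall y, y ∈ B -> Q y x)).
  - def.
  - def.
  - def.
  - apply HA; auto. intros y Hy. apply H. apply in_bu; auto.
  - apply HB; auto. intros y Hy. apply H. apply in_bu; auto.
  - intros x _ H1 H2 y Hy. apply in_bu in Hy as [Hy|Hy]; auto.
Qed.

Lemma comp_pd A B : comp A -> comp B -> comp (pd A B).
Proof.
  intros HA HB Q HQ H.
  apply (um_mono fm_umeas (Q := fun x => forall a, a ∈ A -> forall b, b ∈ B -> Q (pr a b) x)); [def| |].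
  - apply (HA (fun a x => forall b, b ∈ B -> Q (pr a b) x)); [def|]. intros a Ha.
    apply (HB (fun b x => Q (pr a b) x)); [def|]. intros b Hb. apply H. now apply pr_in_pd.
  - intros x _ K y Hy. apply in_pd in Hy as (a & b & Ha & Hb & ->). auto.
Qed.

(* For a choice of counterexamples [S(x) ⊆ A], the measure decides each [t ∈ S(x)],
   so [S] is constant almost everywhere. *)
Lemma comp_Pw A : comp A -> comp (Pw A).
Proof.
  intros HA Q HQ H. apply NNPP. intros N.
  apply um_not with (k := k) in N; [|apply fm_umeas|def].
  destruct (@choice_partial _ Z I (fun x s => s ∈ Pw A /\ ~ Q s x)) as (S & FS & HS); [def|].
  destruct (@sep _ Z A (fun t => All (fun x => t ∈ ap S x))) as [S0 HS0]; [def|].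
  assert (H0 : S0 ∈ Pw A) by (apply in_Pw; intros t Ht; now apply HS0 in Ht).
  assert (E : All (fun x => forall t, t ∈ A -> (t ∈ ap S x <-> t ∈ S0))).
  { apply (HA (fun t x => t ∈ ap S x <-> t ∈ S0)); [def|]. intros t Ht.
    destruct (um_ultra fm_umeas (Q := fun x => t ∈ ap S x)) as [K|K]; [def| |].
    - apply (um_mono fm_umeas (Q := fun x => t ∈ ap S x)); [def|auto|].
      intros x _ Hx. rewrite HS0. tauto.
    - apply (um_mono fm_umeas (Q := fun x => ~ t ∈ ap S x)); [def|auto|].
      intros x _ Hx. rewrite HS0. split; [tauto|]. intros [_ K'].
      exfalso. apply (um_contra fm_umeas (Q := fun x => t ∈ ap S x)); auto. def. }
  apply (um_contra fm_umeas (Q := Q S0)); [def|auto|].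
  apply (um_and_mono fm_umeas (Q := fun x => forall t, t ∈ A -> (t ∈ ap S x <-> t ∈ S0))
           (Q' := fun x => ~ forall y, y ∈ Pw A -> Q y x)); [def|def|def|auto|auto|].
  intros x Hx E1 N1.
  destruct (HS x Hx) as [P1 P2].
  { apply not_all_ex_not in N1 as [y N1]. exists y. tauto. }
  enough (E2 : ap S x = S0) by now rewrite <- E2.
  apply set_ext. intros t. split; intros Ht.
  - apply E1; auto. apply in_Pw in P1. auto.
  - apply E1; auto. apply in_Pw in H0. auto.
Qed.

(* [c] represents [k] in the ultrapower by [U]. *)
Lemma fm_critical : exists c, fun_on I c /\ (forall x, x ∈ I -> ap c x ∈ k) /\
  (forall a, a ∈ k -> All (fun x => a ∈ ap c x)) /\
  forall Q : M -> M -> Prop, Def2 Q -> All (fun x => exists b, b ∈ ap c x /\ Q x b) ->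
    exists b, b ∈ k /\ All (fun x => Q x b).
Proof.
  pose proof fm_ord as Ok.
  destruct (@fun_set_ex _ Z I k) as [B HB].
  destruct (@sep _ Z B (fun u => forall a, a ∈ k -> All (fun x => a ∈ ap u x))) as [C HC]; [def|].
  assert (HC' : forall u, u ∈ C <-> fun_on I u /\ (forall x, x ∈ I -> ap u x ∈ k) /\
                 forall a, a ∈ k -> All (fun x => a ∈ ap u x)).
  { intros u. rewrite HC, HB. tauto. }
  (* A bound of x ∩ k exists below k, as x has size less than k and k is regular; by fineness it
     exceeds every constant. *)
  assert (NE : exists u, u ∈ C).
  { destruct (@choice_fun_into _ Z I k (fun x b => forall a, a ∈ x -> a ∈ k -> a ∈ b))
      as (u & Fu & Hu); [def| |].
    - intros x Hx. destruct (not_le_small (fm_not_le Hx)) as (b & Hb & g & Hg).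
      destruct (injE Hg) as (T & D & F & J).
      destruct (@fm_regular b (fun t a => app g a t /\ a ∈ k)) as (c & Hc & K); [def|auto| | |].
      + tauto.
      + intros t y y' _ [H1 _] [H2 _]. eauto.
      + exists c. split; auto. intros a Ha Ka. destruct (T a Ha) as (t & Ht & Hat). eauto.
    - exists u. apply HC'. split; auto. split; [intros x Hx; apply (Hu x Hx)|].
      intros a Ha. apply (um_mono fm_umeas (Q := fun x => a ∈ x)); [def|now apply fm_fine_k|].
      intros x Hx Hax. destruct (Hu x Hx) as [_ K]. auto. }
  destruct (ult_wf fm_umeas (C := C)) as (c & Hc & Min); auto.
  { intros u Hu. now apply HC' in Hu. }
  apply HC' in Hc as (Fc & Rc & Ac). exists c. split; auto. split; auto. split; auto.
  intros Q HQ H. apply NNPP. intros N.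
  (* [v] picks a witness for [Q] below c(x). If no constant satisfies [Q] almost everywhere,
     completeness keeps [v] above all constants, contrary to the minimality of [c]. *)
  destruct (@choice_fun_into _ Z I k (fun x b =>
    ((exists b, b ∈ ap c x /\ Q x b) -> b ∈ ap c x /\ Q x b))) as (v & Fv & Hv); [def| |].
  { intros x Hx. destruct (classic (exists b, b ∈ ap c x /\ Q x b)) as [[b [Hb Qb]]|K].
    - exists b. split; auto. apply (@ord_trans _ k b (ap c x)); auto.
    - exists emp. split; [apply limit_emp, fm_limit|tauto]. }
  apply (Min v).
  - apply HC'. split; auto. split; [intros x Hx; apply (Hv x Hx)|].
    intros a Ha.
    assert (Ha' : sc a ∈ k) by (apply limit_sc; auto; apply fm_limit).
    apply (um_and_mono fm_umeas (Q := fun x => exists b, b ∈ ap c x /\ Q x b)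
                  (Q' := fun x => forall b, b ∈ sc a -> ~ Q x b)); [def|def|def|auto| |].
    + apply (um_compl fm_umeas (Q := fun b x => ~ Q x b)); [def|auto|].
      intros b Hb. apply (um_not fm_umeas); [def|]. intros K. apply N. exists b. split; auto.
      now apply (@ord_trans _ k b (sc a)).
    + intros x Hx H1 H2. destruct (Hv x Hx) as [Kv H3]. destruct (H3 H1) as [_ H4].
      apply NNPP. intros Na. apply (H2 (ap v x)); auto. apply ord_le_sc.
      apply ord_not_mem; auto; now apply (@ord_elem _ Z k).
  - apply (um_mono fm_umeas (Q := fun x => exists b, b ∈ ap c x /\ Q x b)); [def|auto|].
    intros x Hx K. destruct (Hv x Hx) as [_ K'].
    exists (ap v x), (ap c x). split; [now apply app_ap with I|]. split; [now apply app_ap with I|].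
    now apply K'.
Qed.


(** Regularity for definable partial functions. Replacement derives it from the clause of [regular]
    on sets, and it saves turning each relation into a function that is a set. *)
Definition regp g := limit_ordinal g /\ forall a (Q : M -> M -> Prop), Def2 Q -> a ∈ g ->
  (forall x y, x ∈ a -> Q x y -> y ∈ g) ->
  (forall x y y', x ∈ a -> Q x y -> Q x y' -> y = y') ->
  exists b, b ∈ g /\ forall x y, x ∈ a -> Q x y -> y ∈ b.

Lemma fm_regp : regp k.
Proof. split; [apply fm_limit|]. intros. now apply fm_regular. Qed.

Lemma regular_regp g : regular g -> regp g.
Proof.
  intros (_ & L & H). split; auto. intros a Q HQ Ha R F.
  destruct (@fun_intro _ Z a (fun x y => Q x y \/ (~ (exists y, Q x y) /\ y = emp)))
    as (h & Fh & Ah).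
  - def.
  - intros x _. destruct (classic (exists y, Q x y)) as [[y Hy]|N]; eauto.
  - intros x y y' Hx [H1|[H1 ->]] [H2|[H2 ->]]; eauto; exfalso; eauto.
  - destruct (H a h Ha) as (b & Hb & K).
    + split; auto. intros x y Hxy. apply Ah in Hxy as [Hx [Hy|[_ ->]]]; eauto.
      now apply limit_emp.
    + exists b. split; auto. intros x y Hx Hy. apply (K x). apply Ah. auto.
Qed.

Lemma inaccessible_regp g : inaccessible g -> regp g.
Proof. intros (_ & H & _). now apply regular_regp. Qed.

Lemma regp_bound g a (P : M -> M -> Prop) : regp g -> Def2 P -> a ∈ g ->
  (forall x, x ∈ a -> exists b, b ∈ g /\ P x b) ->
  exists b, b ∈ g /\ forall x, x ∈ a -> exists y, y ∈ b /\ P x y.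
Proof.
  intros [L R] HP Ha H. assert (Og : ordinal g) by apply L.
  destruct (R a (fun x y => y ∈ g /\ P x y /\ forall z, z ∈ y -> ~ P x z)) as (b & Hb & K);
    [def|auto| | |].
  - tauto.
  - intros x y y' _ (H1 & H2 & H3) (H4 & H5 & H6).
    destruct (ord_lin Og H1 H4) as [E|[E|E]]; auto.
    + destruct (H6 y E H2).
    + destruct (H3 y' E H5).
  - exists b. split; auto. intros x Hx. destruct (@least_in _ Z g (P x)) as (m & Hm & Pm & Km).
    + def.
    + auto.
    + exists m. split; auto. apply (K x); auto. split; auto. split; auto.
      intros z Hz. apply Km; auto. now apply (@ord_trans _ g z m).
Qed.

(** The order type of [A] is at most [g], and were it an element of [g], regularity would bound
    [A]. *)
Lemma unbounded_card_le g A : regp g -> subset A g ->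
  ~ (exists b, b ∈ g /\ forall a, a ∈ A -> a ∈ b) -> card_le g A.
Proof.
  intros [L R] HA N. destruct (order_type (proj1 L) HA) as (r & Or & Hr & h & Hh & S).
  destruct (injE Hh) as (T & D & F & J). destruct Hr as [Hr| ->].
  - destruct N. destruct (R r (fun t y => app h y t)) as (b & Hb & K); [def|auto| | |].
    + intros t y _ Hy. apply HA. now apply D in Hy.
    + eauto.
    + exists b. split; auto. intros a Ha. destruct (T a Ha) as (t & Ht & Hat). eauto.
  - apply equinumerous_card_le, equinumerous_sym. exists h. split; auto.
Qed.

Lemma bounded_not_card_le g b : regp g -> b ∈ g -> ~ card_le g b.
Proof.
  intros [L R] Hb (h & Hh). destruct (injE Hh) as (T & D & F & J).
  destruct (R b (fun t y => app h y t)) as (c & Hc & K); [def|auto| | |].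
  - intros t y _ Hy. now apply D in Hy.
  - eauto.
  - apply (@no_self _ Z c). destruct (T c Hc) as (t & Ht & Hct). eauto.
Qed.

Lemma regular_cardinal g : limit_ordinal g ->
  (forall a h, a ∈ g -> maps h a g -> exists b, b ∈ g /\ forall x y, app h x y -> y ∈ b) ->
  cardinal g.
Proof.
  intros L H. split; [apply L|]. intros a Ha (h & Hh & S).
  destruct (H a h Ha (proj1 Hh)) as (b & Hb & K).
  destruct (S b Hb) as [x Hx]. exact (no_self (K x b Hx)).
Qed.

(** * Inaccessibility of the critical point in the ultrapower *)

Section CriticalFunction.
Context (Ow : is_omega w).
Context (c : M) (Fc : fun_on I c) (Rc : forall x, x ∈ I -> ap c x ∈ k).
Context (Ac : forall a, a ∈ k -> All (fun x => a ∈ ap c x)).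
Context (Pc : forall Q : M -> M -> Prop, Def2 Q -> All (fun x => exists b, b ∈ ap c x /\ Q x b) ->
    exists b, b ∈ k /\ All (fun x => Q x b)).

Lemma crit_limit : All (fun x => limit_ordinal (ap c x)).
Proof.
  apply NNPP. intros N. apply (um_not fm_umeas) in N; [|def].
  destruct (Pc (Q := fun x b => forall y, y ∈ ap c x -> ~ b ∈ y)) as (b & Hb & K); [def| |].
  - apply (um_and_mono fm_umeas (Q := fun x => emp ∈ ap c x) (Q' := fun x => ~ limit_ordinal (ap c x)));
      [def|def|def| |auto|].
    + apply Ac. apply limit_emp, fm_limit.
    + intros x Hx He Nl. apply NNPP. intros N'. apply Nl. split; [|split].
      * apply (@ord_elem _ Z k _ fm_ord). auto.
      * apply not_empty. eauto.
      * intros b Hb. apply NNPP. intros N2. apply N'. exists b. split; auto.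
        intros y Hy Hby. eauto.
  - apply (um_contra fm_umeas (Q := fun x => sc b ∈ ap c x)); [def| |].
    + apply Ac. apply limit_sc; auto. apply fm_limit.
    + apply (um_mono fm_umeas (Q := fun x => forall y, y ∈ ap c x -> ~ b ∈ y)); [def|auto|].
      intros x _ H K'. apply (H _ K'). apply in_sc; auto.
Qed.

(** A cofinal map into c(x) would have a domain a that is constant almost everywhere, by [Pc]. Each
    of its values is then constant too, so the values have a common bound b in [k], and b ∈ c(x)
    almost everywhere. *)
Lemma crit_regular : All (fun x => forall a h, a ∈ ap c x -> maps h a (ap c x) ->
  exists b, b ∈ ap c x /\ forall t y, app h t y -> y ∈ b).
Proof.
  apply NNPP. intros N. apply (um_not fm_umeas) in N; [|def].
  set (P := fun x a h => maps h a (ap c x) /\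
    ~ exists b, b ∈ ap c x /\ forall t y, app h t y -> y ∈ b).
  assert (DP : Def3 P) by (unfold P; def).
  destruct (Pc (Q := fun x a => exists h, P x a h)) as (a & Ha & K); [def| |].
  { refine (um_mono fm_umeas _ N _); [def|].
    intros x Hx Nx. apply NNPP. intros N'. apply Nx. intros a h Ha Hh.
    apply NNPP. intros Nb. apply N'. exists a. split; auto. exists h. split; auto. }
  destruct (@choice_partial _ Z I (fun x h => P x a h)) as (H & FH & HH); [def|].
  assert (A : All (fun x => P x a (ap H x))).
  { refine (um_mono fm_umeas _ K _); [def|]. intros x Hx Kx. auto. }
  destruct (@regp_bound k a (fun t b => All (fun x => app (ap H x) t b))) as (b & Hb & Kb);
    [apply fm_regp|def|auto| |].
  { intros t Ht. apply (Pc (Q := fun x b => app (ap H x) t b)); [def|].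
    refine (um_mono fm_umeas _ A _); [def|]. intros x Hx [[[Fh Dh] Rh] _].
    destruct (proj1 (Dh t) Ht) as [y Hy]. exists y. split; eauto. }
  assert (B : All (fun x => forall t, t ∈ a -> exists y, y ∈ b /\ app (ap H x) t y)).
  { apply (um_compl fm_umeas (Q := fun t x => exists y, y ∈ b /\ app (ap H x) t y)); [def|auto|].
    intros t Ht. destruct (Kb t Ht) as (y & Hy & Ay).
    refine (um_mono fm_umeas _ Ay _); [def|]. eauto. }
  apply (um_contra fm_umeas (Q := fun x => P x a (ap H x))); [def|auto|].
  refine (um_and_mono fm_umeas _ _ _ B (Ac Hb) _); [def|def|def|].
  intros x Hx Bx bx [[[Fh Dh] Rh] Nb]. apply Nb. exists b. split; auto.
  intros t y Hty. destruct (Bx t) as (y' & Hy' & Hty').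
  - apply Dh. eauto.
  - now rewrite (proj2 Fh t y y').
Qed.

Lemma crit_cardinal : All (fun x => cardinal (ap c x)).
Proof.
  refine (um_and_mono fm_umeas _ _ _ crit_limit crit_regular _); [def|def|def|].
  intros x Hx H1 H2. now apply regular_cardinal.
Qed.

(** A counterexample a may be taken constant; its powerset has size at most some b in [k] by
    [comp_Pw], and b ∈ c(x) almost everywhere. *)
Lemma crit_strong_limit : All (fun x => strong_limit (ap c x)).
Proof.
  apply NNPP. intros N. apply (um_not fm_umeas) in N; [|def].
  destruct (Pc (Q := fun x a => ~ card_lt (Pw a) (ap c x))) as (a & Ha & K); [def| |].
  { refine (um_mono fm_umeas _ N _); [def|].
    intros x Hx Nx. apply NNPP. intros N'. apply Nx. intros a p Hap Hp.
    apply is_powerset_Pw in Hp. subst p. apply NNPP. intros N2. apply N'. eauto. }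
  destruct (comp_small (comp_Pw (comp_mem Ha))) as (b & Hb & Lb).
  apply (um_contra fm_umeas (Q := fun x => card_lt (Pw a) (ap c x))); [def| |auto].
  refine (um_and_mono fm_umeas _ _ _ crit_cardinal (Ac Hb) _); [def|def|def|].
  intros x Hx Cx Hbx. split.
  - apply (card_le_trans Lb). apply card_le_sub. apply Cx. auto.
  - intros L. apply (no_card_le_mem Cx Hbx). exact (card_le_trans L Lb).
Qed.

Lemma crit_inaccessible : All (fun x => inaccessible (ap c x)).
Proof.
  refine (um_and_mono fm_umeas _ _ _ crit_cardinal (Q' := fun x => limit_ordinal (ap c x) /\
    (forall a h, a ∈ ap c x -> maps h a (ap c x) ->
       exists b, b ∈ ap c x /\ forall t y, app h t y -> y ∈ b) /\
    strong_limit (ap c x) /\ w ∈ ap c x) _ _); [def|def|def| |].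
  - refine (um_and_mono fm_umeas _ _ _ crit_limit (Q' := fun x =>
      (forall a h, a ∈ ap c x -> maps h a (ap c x) ->
       exists b, b ∈ ap c x /\ forall t y, app h t y -> y ∈ b) /\
      strong_limit (ap c x) /\ w ∈ ap c x) _ _); [def|def|def| |tauto].
    refine (um_and_mono fm_umeas _ _ _ crit_regular (Q' := fun x => strong_limit (ap c x) /\ w ∈ ap c x) _ _);
      [def|def|def| |tauto].
    refine (um_and_mono fm_umeas _ _ _ crit_strong_limit (Ac Hwk) _); [def|def|def|tauto].
  - intros x Hx Cx (Lx & Rx & Sx & wx). split; [split; [auto|exists w; auto]|].
    split; auto. split; auto.
Qed.

End CriticalFunction.

End FineMeasure.

(** * Fast function forcing *)

Section FastForcing.
Context {M : memstruct} {Z : ZFC M}.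
Implicit Types a b c d g h p q r s u v x y z : M.
Context (k F : M) (Rk : regp k) (HF : is_fast_forcing k F).

Lemma reg_ord : ordinal k.
Proof. apply Rk. Qed.

(* For a regular cardinal g, a subset of g has size < g iff it is bounded. *)
Definition fastc p :=
  is_function p /\
  (forall x y, app p x y -> x ∈ k /\ y ∈ k /\ inaccessible x) /\
  (exists b, b ∈ k /\ forall x y, app p x y -> x ∈ b) /\
  (forall g y, app p g y ->
     (forall a b, a ∈ g -> app p a b -> b ∈ g) /\
     exists b, b ∈ g /\ forall a y, a ∈ g -> app p a y -> a ∈ b).

Lemma fast_iff p : fast_condition k p <-> fastc p.
Proof.
  unfold fast_condition, fastc. split.
  - intros (Fp & Vp & Dp & Cp). split; auto. split; auto. split.
    + apply NNPP. intros N. destruct (dom_ex p) as [d Hd].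
      apply (Dp d Hd). apply unbounded_card_le; auto.
      * intros x Hx. apply Hd in Hx as [y Hy]. now apply Vp in Hy.
      * intros (b & Hb & K). apply N. exists b. split; auto. intros x y Hxy. apply K, Hd. eauto.
    + intros g y Hg. destruct (Cp g y Hg) as [C1 C2]. split; auto.
      apply NNPP. intros N.
      destruct (@sep _ Z p (fun z => exists x y, is_opair z x y /\ x ∈ g)) as [r Hr]; [def|].
      destruct (@sep _ Z g (fun x => exists y, app p x y)) as [A HA]; [def|].
      apply (C2 r Hr).
      apply (@card_le_trans _ Z g A r).
      * apply unbounded_card_le.
        -- apply inaccessible_regp. now apply Vp in Hg.
        -- intros x Hx. now apply HA in Hx.
        -- intros (b & Hb & K). apply N. exists b. split; auto. intros a y' Ha Hay.
           apply K, HA. eauto.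
      * apply (@inj_intro _ Z A r (fun x z => exists y, is_opair z x y)).
        -- def.
        -- intros x Hx. apply HA in Hx as (Hx & y' & Hy'). exists (pr x y'). split.
           ++ apply Hr. split; [now apply app_pr|]. exists x, y'. split; auto. now apply is_opair_pr.
           ++ exists y'. now apply is_opair_pr.
        -- intros x z z' _ Hz Hz' (y1 & E1) (y2 & E2). apply Hr in Hz as [Hz _], Hz' as [Hz' _].
           apply is_opair_pr in E1, E2. subst. apply app_pr in Hz, Hz'.
           now rewrite (proj2 Fp x y1 y2).
        -- intros x x' z _ _ _ (y1 & E1) (y2 & E2). apply is_opair_pr in E1, E2.
           rewrite E1 in E2. now apply pr_inj in E2.
  - intros (Fp & Vp & (b & Hb & Bp) & Cp). split; auto. split; auto. split.
    + intros d Hd. assert (Hdb : subset d b) by (intros x Hx; apply Hd in Hx as [y Hy]; eauto).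
      split.
      * apply card_le_sub. intros x Hx. apply (@ord_trans _ k x b); auto. apply reg_ord.
      * intros K. apply (bounded_not_card_le Rk Hb). apply (card_le_trans K). now apply card_le_sub.
    + intros g y Hg. destruct (Cp g y Hg) as (C1 & b' & Hb' & C2). split; auto.
      intros r Hr. assert (Ig : inaccessible g) by now apply Vp in Hg.
      assert (Rg := inaccessible_regp Ig).
      assert (L : card_le r b').
      { apply (@inj_intro _ Z r b' (fun z x => exists y, is_opair z x y)).
        - def.
        - intros z Hz. apply Hr in Hz as (Hz & x & y' & E & Hx). exists x. split; eauto.
          apply (C2 x y'); auto. exists z; auto.
        - intros z x x' _ _ _ (y1 & E1) (y2 & E2). apply is_opair_pr in E1, E2.
          rewrite E1 in E2. now apply pr_inj in E2.
        - intros z z' x Hz Hz' _ (y1 & E1) (y2 & E2). apply Hr in Hz as [Hz _], Hz' as [Hz' _].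
          apply is_opair_pr in E1, E2. subst. apply app_pr in Hz, Hz'.
          now rewrite (proj2 Fp x y1 y2). }
      split.
      * apply (card_le_trans L). apply card_le_sub. apply Rg. auto.
      * intros K. exact (bounded_not_card_le Rg Hb' (card_le_trans K L)).
Qed.

Lemma in_F p : p ∈ F <-> fastc p.
Proof. rewrite (HF p). apply fast_iff. Qed.

Lemma F_function p : p ∈ F -> is_function p.
Proof. intros H. apply in_F in H. apply H. Qed.

Lemma F_pair p z : p ∈ F -> z ∈ p -> exists x y, z = pr x y /\ app p x y.
Proof.
  intros Hp Hz. destruct (proj1 (F_function Hp) z Hz) as (x & y & E). apply is_opair_pr in E.
  subst z. exists x, y. split; auto. now apply app_pr.
Qed.

Lemma subset_app p q : p ∈ F -> (forall x y, app p x y -> app q x y) -> subset p q.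
Proof. intros Hp H z Hz. destruct (F_pair Hp Hz) as (x & y & -> & Hxy). now apply app_pr, H. Qed.

Lemma app_subset p q x y : subset p q -> app p x y -> app q x y.
Proof. rewrite !app_pr. auto. Qed.

Lemma F_sub p q : p ∈ F -> subset q p -> q ∈ F.
Proof.
  intros Hp Hqp. apply in_F in Hp as (Fp & Vp & (b & Hb & Bp) & Cp). apply in_F.
  assert (A : forall x y, app q x y -> app p x y) by (intros x y; now apply app_subset).
  split; [split|split; [|split]]; eauto.
  - intros z Hz. apply Fp. auto.
  - intros x y y' H H'. apply (proj2 Fp x); auto.
  - intros g y Hg. destruct (Cp g y (A g y Hg)) as (C1 & b' & Hb' & C2). split; eauto 6.
Qed.

(** * Factoring a condition at a point of its domain *)

Definition below r c := exists b, b ∈ c /\ forall x y, app r x y -> x ∈ b /\ y ∈ b.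
(** A point of the domain above c is closed under the condition, hence exceeds the value d taken at
    c. So the part of a condition above c lives above d, which is the source of its closure. *)
Definition tail q d := forall x y, app q x y -> d ∈ x.
Definition join r c d q : M := bu r (bu (sg (pr c d)) q).

Lemma app_join r c d q x y :
  app (join r c d q) x y <-> app r x y \/ (x = c /\ y = d) \/ app q x y.
Proof.
  unfold join. rewrite !app_pr, !in_bu, in_sg. split; intros [H|[H|H]]; auto.
  - apply pr_inj in H. auto.
  - destruct H; subst; auto.
Qed.

Lemma subset_join r c d q r' q' :
  subset r r' -> subset q q' -> subset (join r c d q) (join r' c d q').
Proof. intros H1 H2 z. unfold join. rewrite !in_bu. intuition. Qed.

Lemma below_bound_ran g r b : regp g -> is_function r -> b ∈ g ->
  (forall x y, app r x y -> x ∈ b /\ y ∈ g) -> below r g.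
Proof.
  intros [L R] Fr Hb H. destruct (R b (fun x y => app r x y)) as (b' & Hb' & K); [def|auto| | |].
  - intros x y _ Hxy. now apply H in Hxy.
  - intros x y y' _. apply Fr.
  - destruct (ord_max (proj1 L) Hb Hb') as (m & Hm & L1 & L2). exists m. split; auto.
    assert (Om : ordinal m) by (apply (@ord_elem _ Z g); auto; apply L).
    intros x y Hxy. split.
    + apply (@ord_mem_le_trans _ x b m); auto. now apply H in Hxy.
    + apply (@ord_mem_le_trans _ y b' m); auto. apply (K x); auto. now apply H in Hxy.
Qed.

Lemma F_below p : p ∈ F -> below p k.
Proof.
  intros Hp. apply in_F in Hp as (Fp & Vp & (b & Hb & Bp) & Cp).
  apply (@below_bound_ran k p b); auto. intros x y H. split; eauto. now apply Vp in H.
Qed.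

(** A point in the domain of [q] exceeds both [c] and [d], so its closure and boundedness clauses
    survive the addition of [r] and (c, d). At [c] itself they follow from [below r c]. *)
Lemma join_in r c d q : r ∈ F -> below r c -> inaccessible c -> c ∈ k -> d ∈ k -> c ∈ d ->
  q ∈ F -> tail q d -> join r c d q ∈ F.
Proof.
  intros Hr (b & Hb & Br) Ic Hc Hd Hcd Hq Tq.
  assert (Ok := reg_ord). assert (Od : ordinal d) by now apply (@ord_elem _ Z k).
  assert (Oc : ordinal c) by now apply (@ord_elem _ Z k).
  apply in_F in Hr as (Fr & Vr & _ & Cr). apply in_F in Hq as (Fq & Vq & (bq & Hbq & Bq) & Cq).
  assert (Lr : forall x y, app r x y -> x ∈ c /\ y ∈ c).
  { intros x y H. apply Br in H as [H1 H2]. split; now apply (@ord_trans _ c _ b). }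
  assert (Oq : forall x y, app q x y -> ordinal x /\ c ∈ x /\ d ∈ x).
  { intros x y H. assert (Ox : ordinal x) by (apply (@ord_elem _ Z k); auto; now apply Vq in H).
    split; auto. assert (Hdx := Tq x y H). split; auto. now apply (@ord_trans _ x c d). }
  apply in_F. split; [split|split; [|split]].
  - intros z Hz. unfold join in Hz. rewrite !in_bu, in_sg in Hz. destruct Hz as [Hz|[-> |Hz]].
    + now apply Fr.
    + exists c, d. now apply is_opair_pr.
    + now apply Fq.
  - intros x y y' H H'. apply app_join in H as [H|[[-> ->]|H]], H' as [H'|[[E ->]|H']]; auto.
    + now apply (proj2 Fr x).
    + subst. apply Lr in H as [H _]. destruct (no_self H).
    + apply Lr in H as [H _]. apply Oq in H' as (_ & H' & _). destruct (no_cycle2 H H').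
    + apply Lr in H' as [H' _]. destruct (no_self H').
    + apply Oq in H' as (_ & H' & _). destruct (no_self H').
    + apply Lr in H' as [H' _]. apply Oq in H as (_ & H & _). destruct (no_cycle2 H' H).
    + subst. apply Oq in H as (_ & H & _). destruct (no_self H).
    + now apply (proj2 Fq x).
  - intros x y H. apply app_join in H as [H|[[-> ->]|H]]; auto.
  - destruct (ord_max Ok Hc Hbq) as (m & Hm & L1 & L2). exists (sc m).
    split; [apply limit_sc; auto; apply Rk|].
    assert (Om : ordinal m) by now apply (@ord_elem _ Z k).
    intros x y H. apply ord_le_sc. apply app_join in H as [H|[[-> ->]|H]]; auto.
    + apply Lr in H as [H _]. left. now apply (@ord_mem_le_trans _ x c m).
    + apply Bq in H. left. now apply (@ord_mem_le_trans _ x bq m).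
  - intros g y H. apply app_join in H as [H|[[-> ->]|H]].
    + destruct (Lr _ _ H) as [Hg _]. destruct (Cr g y H) as (C1 & b' & Hb' & C2).
      assert (N : forall a t, a ∈ g -> app (join r c d q) a t -> app r a t).
      { intros a t Ha K. apply app_join in K as [K|[[-> ->]|K]]; auto.
        - destruct (no_cycle2 Hg Ha).
        - apply Oq in K as (_ & K & _). destruct (no_cycle3 Hg K Ha). }
      split; [eauto|]. exists b'. split; auto. eauto.
    + assert (N : forall a t, a ∈ c -> app (join r c d q) a t -> app r a t).
      { intros a t Ha K. apply app_join in K as [K|[[-> ->]|K]]; auto.
        - destruct (no_self Ha).
        - apply Oq in K as (_ & K & _). destruct (no_cycle2 K Ha). }
      split.
      * intros a t Ha K. now apply (Lr a t), N.
      * exists b. split; auto. intros a t Ha K. now apply (Br a t), N.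
    + destruct (Oq _ _ H) as (Og & Hcg & Hdg). destruct (Cq g y H) as (C1 & b' & Hb' & C2). split.
      * intros a t Ha K. apply app_join in K as [K|[[-> ->]|K]]; eauto.
        apply Lr in K as [_ K]. now apply (@ord_trans _ g t c).
      * assert (Lg : limit_ordinal g) by (apply (@inaccessible_regp _ Z g); now apply Vq in H).
        destruct (ord_max Og Hcg Hb') as (m & Hm & L1 & L2). exists (sc m).
        split; [now apply limit_sc|].
        assert (Om : ordinal m) by now apply (@ord_elem _ Z g).
        intros a t Ha K. apply ord_le_sc. apply app_join in K as [K|[[-> ->]|K]]; auto.
        -- apply Lr in K as [K _]. left. now apply (@ord_mem_le_trans _ a c m).
        -- left. apply (@ord_mem_le_trans _ a b' m); eauto.
Qed.

(** The clauses of a condition at [c] give the bound of the lower part, and its values are bounded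
    as well by regularity of [c]; the clauses at the points above [c] put these above [d]. *)
Lemma split_at v c d : v ∈ F -> app v c d -> exists r q,
  r ∈ F /\ below r c /\ q ∈ F /\ tail q d /\ v = join r c d q /\
  (forall x y, app v x y -> x ∈ c -> app r x y) /\
  (forall x y, app v x y -> c ∈ x -> app q x y).
Proof.
  intros Hv Hcd. assert (Ok := reg_ord).
  destruct (@sep _ Z v (fun z => exists x y, is_opair z x y /\ x ∈ c)) as [r Hr]; [def|].
  destruct (@sep _ Z v (fun z => exists x y, is_opair z x y /\ c ∈ x)) as [q Hq]; [def|].
  assert (Ar : forall x y, app r x y <-> app v x y /\ x ∈ c).
  { intros x y. rewrite !app_pr, Hr. split; intros [H K]; split; auto.
    - destruct K as (x' & y' & E & K). apply is_opair_pr, pr_inj in E as [-> ->]. auto.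
    - exists x, y. split; auto. now apply is_opair_pr. }
  assert (Aq : forall x y, app q x y <-> app v x y /\ c ∈ x).
  { intros x y. rewrite !app_pr, Hq. split; intros [H K]; split; auto.
    - destruct K as (x' & y' & E & K). apply is_opair_pr, pr_inj in E as [-> ->]. auto.
    - exists x, y. split; auto. now apply is_opair_pr. }
  assert (Fr : r ∈ F) by (apply (F_sub Hv); intros z Hz; now apply Hr in Hz).
  assert (Fq : q ∈ F) by (apply (F_sub Hv); intros z Hz; now apply Hq in Hz).
  pose proof Hv as Hv'. apply in_F in Hv as (Fv & Vv & _ & Cv).
  destruct (Vv c d Hcd) as (Hc & Hd & Ic). destruct (Cv c d Hcd) as (C1 & b & Hb & C2).
  exists r, q. split; auto. split; [|split; auto; split; [|split; [|split]]].
  - apply (@below_bound_ran c r b); auto.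
    + now apply inaccessible_regp.
    + now apply F_function.
    + intros x y H. apply Ar in H as [H Hx]. split; eauto.
  - intros x y H. apply Aq in H as [H Hx]. destruct (Cv x y H) as [C3 _]. eauto.
  - apply set_ext. intros z. unfold join. rewrite !in_bu, in_sg. split.
    + intros Hz. destruct (F_pair Hv' Hz) as (x & y & -> & H). rewrite <- !app_pr, Ar, Aq.
      destruct (Vv x y H) as (Hx & _).
      destruct (ord_lin Ok Hx Hc) as [K|[K|K]]; auto.
      subst x. right. left. now rewrite (proj2 Fv c y d).
    + intros [H|[->|H]].
      * now apply Hr in H.
      * now apply app_pr.
      * now apply Hq in H.
  - intros x y H K. now apply Ar.
  - intros x y H K. now apply Aq.
Qed.

(* [H ⊆ (J × k) × F] is a name for the set of all [(y, b)] with [((y, b), p) ∈ H] for some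
   [p] in the generic filter; [pos] and [neg] say that [v] forces some, respectively no,
   pair [(y, b)] into this set. *)
Definition pos v H y := exists b p, b ∈ k /\ p ∈ F /\ subset p v /\ pr (pr y b) p ∈ H.
Definition neg v H y := forall v', v' ∈ F -> subset v v' -> ~ pos v' H y.
Definition dec v H y := pos v H y \/ neg v H y.

Lemma subset_trans a b c : subset a b -> subset b c -> subset a c.
Proof. intros H K x Hx. auto. Qed.

Lemma pos_mono v v' H y : subset v v' -> pos v H y -> pos v' H y.
Proof.
  intros S (b & p & Hb & Hp & Sp & K). exists b, p. repeat split; auto. now apply subset_trans with v.
Qed.

Lemma neg_mono v v' H y : subset v v' -> neg v H y -> neg v' H y.
Proof. intros S K v2 H2 S2. apply K; auto. now apply subset_trans with v'. Qed.

Lemma dec_mono v v' H y : subset v v' -> dec v H y -> dec v' H y.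
Proof. intros S [K|K]; [left; now apply pos_mono with v|right; now apply neg_mono with v]. Qed.

Lemma dec_ext v H y : v ∈ F -> exists v', v' ∈ F /\ subset v v' /\ dec v' H y.
Proof.
  intros Hv. destruct (classic (exists v', v' ∈ F /\ subset v v' /\ pos v' H y)) as [K|K].
  - destruct K as (v' & H1 & H2 & H3). exists v'. repeat split; auto. now left.
  - exists v. split; auto. split; [intros z; auto|]. right. intros v' H1 H2 H3. eauto.
Qed.

Section Top.
Context (c d : M) (Ic : inaccessible c) (Hc : c ∈ k) (Hd : d ∈ k) (Hcd : c ∈ d).

(** A deciding extension of [join p c d q] still contains (c, d), so it factors at [c] again into an
    extension of [p] and one of [q]. *)
Lemma decide_step p q H y : p ∈ F -> below p c -> q ∈ F -> tail q d ->
  exists r q', r ∈ F /\ below r c /\ subset p r /\ q' ∈ F /\ tail q' d /\ subset q q' /\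
    dec (join r c d q') H y.
Proof.
  intros Hp Bp Hq Tq.
  destruct (@dec_ext (join p c d q) H y) as (v & Hv & Sv & Dv); [now apply join_in|].
  destruct (@split_at v c d Hv) as (r & q' & Hr & Br & Hq' & Tq' & E & Lr & Lq).
  { apply (app_subset Sv). apply app_join. auto. }
  subst v. exists r, q'. repeat split; auto.
  - apply subset_app; auto. intros x t Hx. apply Lr.
    + apply (app_subset Sv). apply app_join. auto.
    + destruct Bp as (b & Hb & K). apply K in Hx as [Hx _].
      apply (@ord_trans _ c x b); auto. apply (@ord_elem _ Z k); auto. apply reg_ord.
  - apply subset_app; auto. intros x t Hx. apply Lq.
    + apply (app_subset Sv). apply app_join. auto.
    + assert (K := Tq _ _ Hx). apply (@ord_trans _ x c d); auto.
      apply (@ord_elem _ Z k); [apply reg_ord|]. apply in_F in Hq as (_ & Vq & _). now apply Vq in Hx.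
Qed.

(** Every point g of a domain is inaccessible and above [d], so [e] ∈ g, and the [e] many bounds
    below g required at the stages have a common bound below g. The whole domain is bounded in the
    same way, by regularity of [k]. *)
Lemma tail_union e s : ord_le e d -> is_function s ->
  (forall t q, app s t q -> t ∈ e /\ q ∈ F /\ tail q d) ->
  (forall t t' q q', app s t q -> app s t' q' -> t ∈ t' -> subset q q') ->
  exists u, u ∈ F /\ tail u d /\ forall z, z ∈ u <-> exists t q, app s t q /\ z ∈ q.
Proof.
  intros Le Fs Vs Ms. assert (Ok := reg_ord).
  assert (Od : ordinal d) by now apply (@ord_elem _ Z k).
  assert (Hek : e ∈ k) by now apply (@ord_le_mem_trans _ e d k).
  assert (Oe : ordinal e) by now apply (@ord_elem _ Z k).
  assert (Lin : forall t t' q q', app s t q -> app s t' q' -> subset q q' \/ subset q' q).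
  { intros t t' q q' H H'. destruct (Vs _ _ H) as [Ht _], (Vs _ _ H') as [Ht' _].
    destruct (ord_lin Oe Ht Ht') as [K|[K|K]]; eauto.
    subst. left. rewrite (proj2 Fs t' q q'); auto. intros z; auto. }
  destruct (ran_ex s) as [r Hr]. exists (Un r).
  assert (Eu : forall z, z ∈ Un r <-> exists t q, app s t q /\ z ∈ q).
  { intros z. rewrite in_Un. split.
    - intros (q & Hq & Hz). apply Hr in Hq as [t Ht]. eauto.
    - intros (t & q & Ht & Hz). exists q. split; auto. apply Hr. eauto. }
  assert (Au : forall x y, app (Un r) x y <-> exists t q, app s t q /\ app q x y).
  { intros x y. rewrite app_pr, Eu. split; intros (t & q & Ht & H); exists t, q; split; auto;
      now apply app_pr. }
  assert (VF : forall t q, app s t q -> fastc q) by (intros t q H; apply in_F; now apply Vs in H).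
  assert (Tu : tail (Un r) d).
  { intros x y H. apply Au in H as (t & q & Ht & H). apply Vs in Ht as (_ & _ & Tq). eauto. }
  split; [|split; auto].
  apply in_F. split; [split|split; [|split]].
  - intros z Hz. apply Eu in Hz as (t & q & Ht & Hz). destruct (VF t q Ht) as [Fq _]. now apply Fq.
  - intros x y y' H H'. apply Au in H as (t & q & Ht & H), H' as (t' & q' & Ht' & H').
    destruct (VF t q Ht) as [Fq _], (VF t' q' Ht') as [Fq' _].
    destruct (Lin t t' q q' Ht Ht') as [K|K].
    + apply (proj2 Fq' x); auto. now apply (app_subset K).
    + apply (proj2 Fq x); auto. now apply (app_subset K).
  - intros x y H. apply Au in H as (t & q & Ht & H). destruct (VF t q Ht) as (_ & Vq & _). eauto.
  - destruct (@regp_bound _ Z k e (fun t b => forall q x y, app s t q -> app q x y -> x ∈ b))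
      as (b & Hb & K); [auto|def|auto| |].
    + intros t Ht. destruct (classic (exists q, app s t q)) as [[q Hq]|N].
      * destruct (VF t q Hq) as (_ & _ & (b & Hb & Bq) & _). exists b. split; auto.
        intros q' x y Hq' H. rewrite (proj2 Fs t q' q) in H by auto. eauto.
      * exists emp. split; [apply limit_emp, Rk|]. intros q x y Hq. destruct N. eauto.
    + exists b. split; auto. intros x y H. apply Au in H as (t & q & Ht & H).
      destruct (K t) as (b' & Hb' & Kb'); [now apply Vs in Ht|].
      apply (@ord_trans _ b x b'); eauto. now apply (@ord_elem _ Z k).
  - intros g y H. apply Au in H as (t0 & q0 & Ht0 & H).
    destruct (VF t0 q0 Ht0) as (_ & Vq0 & _ & Cq0).
    destruct (Vq0 g y H) as (Hg & _ & Ig). assert (Og : ordinal g) by now apply (@ord_elem _ Z k).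
    destruct (Cq0 g y H) as (C1 & b0 & Hb0 & C2). split.
    + intros a b Ha Hab. apply Au in Hab as (t & q & Ht & Hab).
      destruct (Lin t t0 q q0 Ht Ht0) as [K|K].
      * apply (C1 a); auto. now apply (app_subset K).
      * destruct (VF t q Ht) as (_ & _ & _ & Cq).
        destruct (Cq g y (app_subset K H)) as [C3 _]. eauto.
    + assert (Heg : e ∈ g).
      { apply (@ord_le_mem_trans _ e d g); auto. apply Vs in Ht0 as (_ & _ & T0). eauto. }
      assert (Rg := inaccessible_regp Ig).
      destruct (@regp_bound _ Z g e (fun t b => forall q x y, app s t q -> x ∈ g -> app q x y -> x ∈ b))
        as (b & Hb & K); [auto|def|auto| |].
      * intros t Ht. destruct (classic (exists q, app s t q)) as [[q Hq]|N].
        (* An earlier condition is part of [q0] and inherits its bound [b0]; a later one contains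
           the point g and so has a bound of its own at g. *)
        -- destruct (Lin t t0 q q0 Hq Ht0) as [K|K].
           ++ exists b0. split; auto. intros q' x y' Hq' Hx Hxy.
              rewrite (proj2 Fs t q' q) in Hxy by auto. apply (C2 x y'); auto.
              now apply (app_subset K).
           ++ destruct (VF t q Hq) as (_ & _ & _ & Cq).
              destruct (Cq g y (app_subset K H)) as (_ & b & Hb & C4). exists b. split; auto.
              intros q' x y' Hq' Hx Hxy. rewrite (proj2 Fs t q' q) in Hxy by auto. eauto.
        -- exists emp. split; [apply limit_emp, Rg|]. intros q x y' Hq. destruct N. eauto.
      * exists b. split; auto. intros a y' Ha Hay. apply Au in Hay as (t & q & Ht & Hay).
        destruct (K t) as (b' & Hb' & Kb'); [now apply Vs in Ht|].
        apply (@ord_trans _ b a b'); eauto. now apply (@ord_elem _ Z g).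
Qed.

(** A decision depends on the lower part as well, so a tail can settle the name [H] only up to an
    extension r of the given lower part p. *)
Definition handled H p q y :=
  exists r, r ∈ F /\ below r c /\ subset p r /\ dec (join r c d q) H y.

(** Recursion of length [e], an increasing sequence of tails: stage t takes the union of the earlier
    tails and settles the task numbered t. Decisions persist to the union of all tails. *)
Lemma decide_all A e y : ord_le e d -> card_le A e ->
  (forall H p, pr H p ∈ A -> p ∈ F /\ below p c) ->
  exists q, q ∈ F /\ tail q d /\ forall H p, pr H p ∈ A -> handled H p q y.
Proof.
  intros Le (g & Hg) HA. destruct (injE Hg) as (Tg & Dg & Fg & Jg).
  assert (Ok := reg_ord). assert (Od : ordinal d) by now apply (@ord_elem _ Z k).
  assert (Oe : ordinal e) by (destruct Le as [Le| ->]; auto; now apply (@ord_elem _ Z d)).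
  destruct (@choice_partial _ Z (Pw F) (fun s y => y ∈ s)) as (ch & Fch & Hch); [def|].
  set (OK := fun t s q => q ∈ F /\ tail q d /\ (forall t' u, app s t' u -> subset u q) /\
                   forall H p, app g (pr H p) t -> handled H p q y).
  assert (DO : Def3 OK) by (unfold OK, handled, tail, below, dec, neg, pos, join; def).
  set (E := fun t s q => exists S, (forall z, z ∈ S <-> OK t s z) /\ q ∈ S /\ q = ap ch S).
  assert (HE : Def3 E) by (unfold E; def).
  assert (Efun : forall x s y y', E x s y -> E x s y' -> y = y').
  { intros x s z z' (S & HS & _ & ->) (S' & HS' & _ & ->). f_equal. apply set_ext.
    intros t. now rewrite (HS t), (HS' t). }
  pose proof (@wf_eps _ Z) as wf. pose proof (@def_eps M) as HR.
  set (rv := rec_val (fun y x : M => y ∈ x) E).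
  assert (Drv : Def2 rv) by (apply def_rec_val; auto).
  assert (RO : forall t q, rv t q -> q ∈ F /\ tail q d /\ (forall t' u, t' ∈ t -> rv t' u -> subset u q) /\
                   forall H p, app g (pr H p) t -> handled H p q y).
  { intros t q Hq. destruct (rec_val_eq wf Efun Hq) as (s & _ & As & (S & HS & HqS & _) & _).
    apply HS in HqS as (H1 & H2 & H3 & H4). repeat split; auto.
    intros t' u Ht' Hu. apply (H3 t'). apply As. auto. }
  assert (T : forall t, t ∈ e -> exists q, rv t q).
  { apply rec_total; auto.
    - intros x x' Hx Hx'. now apply (@ord_trans _ e x' x).
    - intros t s Ht Fs As Ps.
      assert (As' : forall x u, app s x u <-> x ∈ t /\ rv x u) by exact As.
      destruct (@tail_union t s) as (u & Hu & Tu & Eu); auto.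
      { left. now apply (@ord_mem_le_trans _ t e d). }
      { intros x q Hx. apply As' in Hx as [Hx Hq]. apply RO in Hq as (H1 & H2 & _). auto. }
      { intros x x' q q' Hx Hx' Hxx'. apply As' in Hx as [Hx Hq], Hx' as [Hx' Hq'].
        apply RO in Hq' as (_ & _ & H3 & _). eauto. }
      assert (Su : forall t' q, app s t' q -> subset q u).
      { intros t' q H z Hz. apply Eu. eauto. }
      assert (NE : exists q, OK t s q).
      { destruct (classic (exists H p, app g (pr H p) t)) as [(H & p & Hp)|N].
        - destruct (HA H p) as [Fp Bp]; [now apply Dg in Hp|].
          destruct (@decide_step p u H y) as (r & q & Hr & Br & Spr & Hq & Tq & Suq & Dq); auto.
          exists q. split; auto. split; auto. split.
          + intros t' q' Hq'. apply (@subset_trans q' u q); eauto.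
          + intros H' p' Hp'. pose proof (Jg _ _ _ Hp Hp') as E1. apply pr_inj in E1 as [<- <-].
            exists r. auto.
        (* The number t belongs to no task, and the union of the earlier tails is kept. *)
        - exists u. split; auto. split; auto. split; auto. intros H p Hp. destruct N. eauto. }
      destruct (@sep _ Z F (OK t s)) as [S HS]; [def|].
      assert (HS' : forall z, z ∈ S <-> OK t s z).
      { intros z. rewrite HS. split; [tauto|]. intros K. split; auto. apply K. }
      exists (ap ch S), S. split; auto. split; auto. apply Hch.
      + apply in_Pw. intros z Hz. now apply HS in Hz.
      + destruct NE as [q Hq]. exists q. now apply HS'. }
  destruct (@fun_intro _ Z e rv) as (h & Fh & Ah); auto.
  { intros x v v' _. now apply rec_val_fun. }
  destruct (@tail_union e h) as (q & Hq & Tq & Eq); auto.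
  { apply Fh. }
  { intros t q Ht. apply Ah in Ht as [Ht Hq]. apply RO in Hq as (H1 & H2 & _). auto. }
  { intros t t' q q' Ht Ht' Htt. apply Ah in Ht as [Ht Hq], Ht' as [Ht' Hq'].
    apply RO in Hq' as (_ & _ & H3 & _). eauto. }
  exists q. split; auto. split; auto. intros H p Hp.
  destruct (Tg _ Hp) as (t & Ht & Hgt). destruct (T t Ht) as [q0 Hq0].
  assert (S0 : subset q0 q) by (intros z Hz; apply Eq; exists t, q0; split; auto; apply Ah; auto).
  apply RO in Hq0 as (_ & _ & _ & H4). destruct (H4 H p Hgt) as (r & Hr & Br & Sr & Dr).
  exists r. repeat split; auto. apply (dec_mono (v := join r c d q0)); auto.
  apply subset_join; auto. intros z; auto.
Qed.

End Top.
End FastForcing.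

(** * A measure guiding the fast function *)

Section GuidedMeasure.
Context {M : memstruct} {Z : ZFC M}.
Implicit Types a b c d g h k l p q r s t u v w x y z A F I J U : M.

(** A choice from fewer than [k] candidates is constant almost everywhere. *)
Lemma comp_pick k I U A (Q : M -> M -> Prop) : umeas k I U -> comp I U A -> Def2 Q ->
  almost_all I U (fun x => exists y, y ∈ A /\ Q y x) ->
  exists y, y ∈ A /\ almost_all I U (Q y).
Proof.
  intros Um HA HQ H. apply NNPP. intros N.
  refine (um_contra Um _ H _); [def|].
  apply (um_mono Um (Q := fun x => forall y, y ∈ A -> ~ Q y x)); [def| |].
  - apply (HA (fun y x => ~ Q y x)); [def|]. intros y Hy. apply (um_not Um); [def|].
    intros K. eauto.
  - intros x _ K (y & Hy & Qy). exact (K y Hy Qy).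
Qed.

Lemma strongly_compact_regp k : strongly_compact k -> regp k.
Proof.
  intros [[Ck (w & Ow & Hwk)] H]. assert (Hw := is_omega_like Ow).
  destruct (H k) as (I & U & HU); [apply Ck|right; auto|].
  refine (fm_regp Ck Hw Hwk _ _ HU); [apply Ck|right; auto].
Qed.

(* [t] and [w] represent, in the ultrapower [j] by [U], the seed of the measure and the
   part [{(k, d)} ∪ q] of a condition of [j(F)]; [q] decides every name at the seed. *)
Record guided k F l J I U t w : Prop := {
  gd_umeas : umeas k I U;
  gd_t_fun : fun_on I t;
  gd_w_fun : fun_on I w;
  gd_t : forall x, x ∈ I -> ap t x ∈ J;
  gd_fine : forall a, a ∈ l -> almost_all I U (fun x => a ∈ ap t x);
  gd_join : forall r, r ∈ F -> almost_all I U (fun x => bu r (ap w x) ∈ F);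
  gd_dec : forall H p, subset H (pd (pd J k) F) -> p ∈ F ->
    exists r, r ∈ F /\ subset p r /\
      almost_all I U (fun x => dec k F (bu r (ap w x)) H (ap t x));
  gd_top : almost_all I U (fun x => exists c d, d ∈ k /\ app (ap w x) c d /\
    (forall a, a ∈ c <-> a ∈ k /\ a ∈ ap t x) /\ card_le (ap t x) d);
  gd_press : forall Q : M -> M -> Prop, Def2 Q ->
    almost_all I U (fun x => exists b, b ∈ k /\ b ∈ ap t x /\ Q x b) ->
    exists b, b ∈ k /\ almost_all I U (fun x => Q x b)
}.

(** The measure lives on a large theta, so that every name has a code, which by fineness lies in
    almost every index x. Only the names coded in x are settled by w(x), and every name is thereby
    settled almost everywhere. *)
Lemma guided_ex k F l J : strongly_compact k -> is_fast_forcing k F ->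
  ordinal l -> ord_le k l -> is_Pkl k l J -> exists I U t w, guided k F l J I U t w.
Proof.
  intros SC HF Ol Hkl HJ. assert (Rk := strongly_compact_regp SC).
  destruct SC as [[Ck (w0 & Ow & Hwk)] SC]. assert (Hw := is_omega_like Ow).
  assert (Ok : ordinal k) by apply Ck.
  set (N := Pw (pd (pd J k) F)).
  destruct (well_ordering N) as (th0 & Oth0 & g & Hg).
  destruct (injE Hg) as (Tg & Dg & Fg & Jg).
  (* theta is the maximum of l, needed for fineness, and of an ordinal that codes all names. *)
  assert (TH : exists th, ordinal th /\ ord_le l th /\ ord_le th0 th).
  { destruct (ord_le_or Ol Oth0) as [K|K].
    - exists th0. split; auto. split; auto. right; auto.
    - exists l. split; auto. split; [right|left]; auto. }
  destruct TH as (th & Oth & Hlth & Hth0).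
  assert (Hkth : ord_le k th) by now apply (@ord_le_trans _ k l th).
  destruct (SC th Oth Hkth) as (I & U & HU).
  assert (Um := fm_umeas Ck Hw Hwk HU).
  destruct (fm_critical Ck Hw Hwk Oth Hkth HU) as (c & Fc & Rc & Ac & Pc).
  assert (Inac := crit_inaccessible Ck Hw Hwk Oth Hkth HU Ow Rc Ac Pc).
  assert (Small : forall A, comp I U A -> exists b, b ∈ k /\ card_le A b).
  { intros A. now apply (comp_small Ck Hw Hwk Oth Hkth HU). }
  (* The seed is x ∩ l with its part below k replaced by c(x), so that its intersection with k
     represents k; fineness below k survives because [c] exceeds all constants. *)
  destruct (@choice_fun _ Z I (fun x y => forall a, a ∈ y <-> a ∈ l /\ (a ∈ ap c x \/ (a ∈ x /\ ~ a ∈ k))))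
    as (t & Ft & At); [def|intros x _; apply sep; def|].
  assert (Et : forall x a, x ∈ I -> (a ∈ ap t x <-> a ∈ l /\ (a ∈ ap c x \/ (a ∈ x /\ ~ a ∈ k)))).
  { intros x a Hx. now apply At. }
  assert (Etk : forall x a, x ∈ I -> (a ∈ ap c x <-> a ∈ k /\ a ∈ ap t x)).
  { intros x a Hx. rewrite Et; auto. split.
    - intros Ha. assert (Hak : a ∈ k) by (apply (@ord_trans _ k a (ap c x)); auto).
      split; auto. split; auto. now apply (@ord_mem_le_trans _ a k l).
    - tauto. }
  assert (Ct : forall x, x ∈ I -> comp I U (ap t x)).
  { intros x Hx. apply (@comp_sub _ _ _ _ _ _ _ Ck Hw Hwk HU (bu (ap c x) x)).
    - apply (comp_bu Ck Hw Hwk HU); [apply (comp_mem Ck Hw Hwk HU)|apply (comp_idx Ck Hw Hwk HU)]; auto.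
    - intros a Ha. apply Et in Ha; auto. apply in_bu. tauto. }
  assert (Tin : forall x, x ∈ I -> ap t x ∈ J).
  { intros x Hx. apply HJ. split; [intros a Ha; apply Et in Ha; tauto|].
    destruct (Small _ (Ct x Hx)) as (b & Hb & Lb). split.
    - apply (card_le_trans Lb). apply card_le_sub. now apply Ok.
    - apply (comp_not_le Ck Hw Hwk Oth Hkth HU). auto. }
  (* Conditions bounded by b are subsets of b × b, hence there are fewer than k of them. *)
  assert (Cb : forall b, b ∈ k -> forall A, A ∈ Pw F ->
    (forall r, r ∈ A -> forall x y, app r x y -> x ∈ b /\ y ∈ b) -> comp I U A).
  { intros b Hb A HA HA'. apply (@comp_sub _ _ _ _ _ _ _ Ck Hw Hwk HU (Pw (pd b b))).
    - apply (comp_Pw Ck Hw Hwk HU). apply (comp_pd Ck Hw Hwk HU); now apply (comp_mem Ck Hw Hwk HU).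
    - intros r Hr. apply in_Pw. intros z Hz. apply in_Pw in HA.
      destruct (F_pair Rk HF (HA r Hr) Hz) as (x & y & -> & Hxy). apply pr_in_pd. eauto. }
  set (P := fun x v => exists d q, d ∈ k /\ ap c x ∈ d /\ q ∈ F /\ tail q d /\
    v = bu (sg (pr (ap c x) d)) q /\ card_le (ap t x) d /\
    forall H p, H ∈ N -> p ∈ F -> below p (ap c x) -> (exists o, app g H o /\ o ∈ x) ->
      handled k F (ap c x) d H p q (ap t x)).
  assert (DP : Def2 P) by (unfold P, handled, tail, below, dec, neg, pos, join; def).
  destruct (@choice_fun _ Z I (fun x v => inaccessible (ap c x) -> P x v)) as (w & Fw & Hwf); [def| |].
  { intros x Hx. destruct (classic (inaccessible (ap c x))) as [Ic|NI]; [|exists emp; tauto].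
    assert (Hc := Rc x Hx). assert (Oc : ordinal (ap c x)) by now apply (@ord_elem _ Z k).
    destruct (@sep _ Z N (fun H => exists o, app g H o /\ o ∈ x)) as [Nx HNx]; [def|].
    destruct (@sep _ Z F (fun p => below p (ap c x))) as [Fx HFx]; [unfold below; def|].
    assert (CN : comp I U Nx).
    { apply (@comp_image _ _ _ _ _ _ _ Ck Hw Hwk HU x Nx (fun o H => app g H o)).
      - def.
      - now apply (comp_idx Ck Hw Hwk HU).
      - intros H HH. apply HNx in HH as (_ & o & Ho & Hox). eauto.
      - eauto. }
    assert (CF : comp I U Fx).
    { apply (@Cb (ap c x)); auto.
      - apply in_Pw. intros p Hp. now apply HFx in Hp.
      - intros r Hr a y Ha. apply HFx in Hr as (_ & b & Hb & Br). apply Br in Ha as [H1 H2].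
        split; now apply (@ord_trans _ (ap c x) _ b). }
    (* d is taken above three ordinals: the number e of pairs of a name coded in x and a condition
       below c(x), the size e' of the seed, and c(x). *)
    destruct (Small _ (comp_pd Ck Hw Hwk HU CN CF)) as (e & He & Le).
    destruct (Small _ (Ct x Hx)) as (e' & He' & Le').
    assert (Hsc : sc (ap c x) ∈ k) by (apply limit_sc; auto; apply Rk).
    destruct (ord_max Ok He He') as (d1 & Hd1 & L1 & L2).
    destruct (ord_max Ok Hd1 Hsc) as (d & Hd & L3 & L4).
    assert (Od : ordinal d) by now apply (@ord_elem _ Z k).
    assert (Hcd : ap c x ∈ d).
    { apply (@ord_mem_le_trans _ (ap c x) (sc (ap c x)) d); auto. apply in_sc; auto. }
    destruct (@decide_all _ _ _ _ Rk HF _ _ Ic Hc Hd Hcd (pd Nx Fx) e (ap t x)) as (q & Hq & Tq & Kq).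
    - now apply (@ord_le_trans _ e d1 d).
    - auto.
    - intros H p Hp. apply pr_in_pd in Hp as [_ Hp]. now apply HFx in Hp.
    - exists (bu (sg (pr (ap c x) d)) q). intros _. exists d, q. repeat split; auto.
      + apply (card_le_trans Le'). apply card_le_sub. apply ord_le_sub; auto.
        now apply (@ord_le_trans _ e' d1 d).
      + intros H p HN Fp Bp Ho. apply Kq. apply pr_in_pd. split; [apply HNx|apply HFx]; auto. }
  exists I, U, t, w. constructor; auto.
  - intros a Ha. destruct (classic (a ∈ k)) as [Hak|Nak].
    + refine (um_mono Um _ (Ac a Hak) _); [def|]. intros x Hx Hax. now apply Etk in Hax.
    + refine (um_mono Um _ (@fm_fine _ _ _ _ _ _ HU a _) _); [def| |].
      * now apply (@ord_mem_le_trans _ a l th).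
      * intros x Hx Hax. apply Et; auto.
  - intros r Hr. destruct (F_below Rk HF Hr) as (b & Hb & Br).
    refine (um_and_mono Um _ _ _ Inac (Ac b Hb) _); [def|def|def|].
    intros x Hx Ix bx. destruct (Hwf x Hx Ix) as (d & q & Hd & Hcd & Hq & Tq & -> & _).
    apply (join_in Rk HF (d := d)); auto. exists b. auto.
  - intros H p SH Hp. destruct (F_below Rk HF Hp) as (b & Hb & Bp).
    assert (HN : H ∈ N) by now apply in_Pw.
    destruct (Tg H HN) as (o & Ho & Hgo).
    assert (A1 : almost_all I U (fun x => o ∈ x)).
    { apply (fm_fine HU). now apply (@ord_mem_le_trans _ o th0 th). }
    assert (A2 : almost_all I U (fun x => o ∈ x /\ b ∈ ap c x)).
    { refine (um_and_mono Um _ _ _ A1 (Ac b Hb) _); [def|def|def|auto]. }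
    (* The extension r obtained at x depends on x. Its bound is made constant first, by [Pc]; fewer
       than k conditions have this bound, so then r itself becomes constant. *)
    destruct (Pc (fun x b => exists r, r ∈ F /\ (forall a y, app r a y -> a ∈ b /\ y ∈ b) /\
      subset p r /\ dec k F (bu r (ap w x)) H (ap t x))) as (b1 & Hb1 & K1).
    { unfold dec, neg, pos. def. }
    { refine (um_and_mono Um _ _ _ Inac A2 _); [def|def|unfold dec, neg, pos; def|].
      intros x Hx Ix [ox bx]. destruct (Hwf x Hx Ix) as (d & q & Hd & Hcd & Hq & Tq & -> & _ & Kh).
      destruct (Kh H p) as (r & Hr & (b2 & Hb2 & Br) & Spr & Dr); auto.
      - exists b. auto.
      - eauto.
      - exists b2. split; auto. exists r. auto. }
    destruct (@sep _ Z F (fun r => forall a y, app r a y -> a ∈ b1 /\ y ∈ b1)) as [A HA]; [def|].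
    destruct (@comp_pick k I U A (fun r x => r ∈ F /\ subset p r /\ dec k F (bu r (ap w x)) H (ap t x)))
      as (r & Hr & Ar); auto.
    + apply (@Cb b1); auto.
      * apply in_Pw. intros r Hr. now apply HA in Hr.
      * intros r Hr. now apply HA in Hr.
    + unfold dec, neg, pos. def.
    + refine (um_mono Um _ K1 _); [unfold dec, neg, pos; def|].
      intros x _ (r & Hr & Br & Spr & Dr). exists r. split; auto. apply HA. auto.
    + exists r. destruct (um_ex Um Ar) as (_ & _ & Fr & Spr & _). split; auto. split; auto.
      refine (um_mono Um _ Ar _); [unfold dec, neg, pos; def|]. tauto.
  - refine (um_mono Um _ Inac _); [def|].
    intros x Hx Ix. destruct (Hwf x Hx Ix) as (d & q & Hd & Hcd & Hq & Tq & -> & Ld & _).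
    exists (ap c x), d. split; auto. split; [|split; auto].
    apply app_pr. apply in_bu. left. now apply in_sg.
  - intros Q HQ H. apply Pc; auto. refine (um_mono Um _ H _); [def|].
    intros x Hx (b & Hb & Hbt & Qb). exists b. split; auto. now apply Etk.
Qed.

End GuidedMeasure.

(** * Names and generic extensions *)

Section GenericExtension.
Context {V W : memstruct} {ZV : ZFC V} {ZW : ZFC W} (i : V -> W) (F : V) (G : W).
Context (hG : generic_extension i F (fun q p => subset p q) G).

Lemma i_in a b : i a ∈ i b <-> a ∈ b.
Proof. apply (ge_mem hG). Qed.

Lemma i_inj a b : i a = i b -> a = b.
Proof. apply (ge_inj hG). Qed.

Lemma i_elem a (y : W) : y ∈ i a <-> exists b, y = i b /\ b ∈ a.
Proof.
  split.
  - intros H. destruct (ge_transitive hG H) as [b ->]. exists b. split; auto. now apply i_in.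
  - intros (b & -> & H). now apply i_in.
Qed.

Lemma i_ext a (u : W) : (forall y, y ∈ u <-> exists b, y = i b /\ b ∈ a) -> i a = u.
Proof. intros H. apply set_ext. intros y. now rewrite (H y), i_elem. Qed.

Lemma i_subset a b : subset (i a) (i b) <-> subset a b.
Proof.
  split.
  - intros H x Hx. apply i_in, H, i_in, Hx.
  - intros H y Hy. apply i_elem in Hy as (x & -> & Hx). apply i_in. auto.
Qed.

Lemma i_up a b : i (up a b) = up (i a) (i b).
Proof.
  apply i_ext. intros y. rewrite in_up. split.
  - intros [->| ->]; [exists a|exists b]; rewrite in_up; auto.
  - intros (x & -> & Hx). apply in_up in Hx as [->| ->]; auto.
Qed.

Lemma i_pr a b : i (pr a b) = pr (i a) (i b).
Proof. unfold pr, sg. now rewrite !i_up. Qed.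

Lemma i_sc a : i (sc a) = sc (i a).
Proof.
  apply i_ext. intros y. rewrite in_sc, i_elem. split.
  - intros [(b & -> & H)|E]; [exists b|exists a]; rewrite in_sc; auto.
  - intros (b & -> & H). apply in_sc in H as [H| ->]; eauto.
Qed.

Lemma i_emp : i emp = emp.
Proof. apply i_ext. intros y. split; [intros H; destruct (in_emp H)|intros (b & _ & H); destruct (in_emp H)]. Qed.

Lemma i_app g x y : app (i g) (i x) (i y) <-> app g x y.
Proof. rewrite !app_pr, <- i_pr. apply i_in. Qed.

Lemma i_pr_inv (X Y : W) z : pr X Y = i z -> exists x y, X = i x /\ Y = i y /\ z = pr x y.
Proof.
  intros E.
  assert (H1 : up X Y ∈ i z) by (rewrite <- E; unfold pr; apply in_up; auto).
  apply i_elem in H1 as (u & Eu & _).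
  assert (HX : X ∈ i u) by (rewrite <- Eu; apply in_up; auto).
  assert (HY : Y ∈ i u) by (rewrite <- Eu; apply in_up; auto).
  apply i_elem in HX as (x & -> & _), HY as (y & -> & _). exists x, y. repeat split; auto.
  apply i_inj. rewrite <- E. symmetry. apply i_pr.
Qed.

Lemma i_app_inv g (X Y : W) : app (i g) X Y -> exists x y, X = i x /\ Y = i y /\ app g x y.
Proof.
  intros H. apply app_pr, i_elem in H as (z & E & Hz).
  destruct (i_pr_inv E) as (x & y & -> & -> & ->). exists x, y. repeat split; auto. now apply app_pr.
Qed.

Lemma i_ordinal a : ordinal a -> ordinal (i a).
Proof.
  intros Ha. apply ord_intro.
  - intros x Hx y Hy. apply i_elem in Hx as (b & -> & Hb). apply i_elem in Hy as (c & -> & Hc).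
    apply i_in. now apply (@ord_trans _ a c b).
  - intros x y Hx Hy. apply i_elem in Hx as (b & -> & Hb), Hy as (c & -> & Hc).
    destruct (ord_lin Ha Hb Hc) as [H|[H|H]]; [left|right;left|right;right].
    + now apply i_in.
    + congruence.
    + now apply i_in.
Qed.

Lemma i_ordinal_inv a : ordinal (i a) -> ordinal a.
Proof.
  intros Ha. apply ord_intro.
  - intros x Hx y Hy. apply i_in. apply i_in in Hx, Hy. now apply (@ord_trans _ (i a) (i y) (i x)).
  - intros x y Hx Hy. apply i_in in Hx, Hy.
    destruct (ord_lin Ha Hx Hy) as [H|[H|H]]; [left|right;left|right;right].
    + now apply i_in.
    + now apply i_inj.
    + now apply i_in.
Qed.

Lemma i_omega_like w : omega_like w -> omega_like (i w).
Proof.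
  intros (Ow & He & Hs & Hc). split; [now apply i_ordinal|]. rewrite <- i_emp.
  split; [now apply i_in|]. split.
  - intros n Hn. apply i_elem in Hn as (m & -> & Hm). rewrite <- i_sc. apply i_in. auto.
  - intros n Hn. apply i_elem in Hn as (m & -> & Hm). destruct (Hc m Hm) as [->|(p & Hp & ->)].
    + auto.
    + right. exists (i p). split; [now apply i_in|]. apply i_sc.
Qed.

Lemma i_card_le a b : card_le a b -> card_le (i a) (i b).
Proof.
  intros (g & Hg). destruct (injE Hg) as (T & D & Fn & J).
  apply (@inj_intro _ ZW (i a) (i b) (fun x y => app (i g) x y)).
  - def.
  - intros x Hx. apply i_elem in Hx as (x0 & -> & Hx). destruct (T x0 Hx) as (y & Hy & Hxy).
    exists (i y). split; [now apply i_in|now apply i_app].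
  - intros x y y' _ _ _ H H'. apply i_app_inv in H as (x0 & y0 & -> & -> & H).
    apply i_app_inv in H' as (x1 & y1 & E & -> & H'). apply i_inj in E. subst. f_equal. eauto.
  - intros x x' y _ _ _ H H'. apply i_app_inv in H as (x0 & y0 & -> & -> & H).
    apply i_app_inv in H' as (x1 & y1 & -> & E & H'). apply i_inj in E. subst. f_equal. eauto.
Qed.

Lemma G_in_F p : i p ∈ G -> p ∈ F.
Proof.
  intros H. destruct (gf_sub (ge_filter hG) H) as (q & Hq & E). apply i_inj in E. now subst.
Qed.

Lemma G_elem (x : W) : x ∈ G -> exists p, x = i p /\ p ∈ F.
Proof. intros H. destruct (gf_sub (ge_filter hG) H) as (q & Hq & E). eauto. Qed.

Lemma G_down p q : p ∈ F -> subset p q -> i q ∈ G -> i p ∈ G.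
Proof. intros Hp S Hq. apply (gf_up (ge_filter hG) (q := q)); auto. now apply G_in_F. Qed.

Lemma G_directed p q : i p ∈ G -> i q ∈ G -> exists r, i r ∈ G /\ subset p r /\ subset q r.
Proof. apply (gf_directed (ge_filter hG)). Qed.

Lemma G_nonempty : exists p, i p ∈ G.
Proof.
  destruct (proj1 (not_empty _) (gf_nonempty (ge_filter hG))) as [x Hx].
  destruct (G_elem Hx) as (p & -> & _). eauto.
Qed.

(** Density below [p] becomes density everywhere by adding the conditions incompatible with [p],
    none of which lies in the filter. *)
Lemma generic_below p (Q : V -> Prop) : Def1 Q -> i p ∈ G ->
  (forall p', p' ∈ F -> subset p p' -> exists p'', p'' ∈ F /\ subset p' p'' /\ Q p'') ->
  exists q, q ∈ F /\ i q ∈ G /\ subset p q /\ Q q.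
Proof.
  intros HQ Hp H.
  destruct (@sep _ ZV F (fun d => (subset p d /\ Q d) \/
    ~ exists e, e ∈ F /\ subset p e /\ subset d e)) as [D HD]; [def|].
  destruct (gf_generic (ge_filter hG) (D := D)) as (d & Hd & Gd).
  - split; [intros d Hd; now apply HD in Hd|]. intros d Hd.
    destruct (classic (exists e, e ∈ F /\ subset p e /\ subset d e)) as [(e & He & S1 & S2)|N].
    + destruct (H e He S1) as (q & Hq & S3 & Qq). exists q. split.
      * apply HD. split; auto. left. split; auto. intros x Hx. auto.
      * intros x Hx. auto.
    + exists d. split; [apply HD; auto|intros x; auto].
  - apply HD in Hd as [Fd [[S Qd]|N]]; [eauto|].
    destruct N. destruct (G_directed Hp Gd) as (r & Gr & S1 & S2).
    exists r. split; auto. now apply G_in_F.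
Qed.

(** The conditions that are in [B] or have no extension in [B] are dense. *)
Lemma generic_avoid (B : V -> Prop) : Def1 B -> (forall v, i v ∈ G -> ~ B v) ->
  exists r, i r ∈ G /\ forall v, v ∈ F -> subset r v -> ~ B v.
Proof.
  intros HB N. destruct G_nonempty as [p Gp].
  destruct (@generic_below p (fun q => B q \/ forall v, v ∈ F -> subset q v -> ~ B v))
    as (q & Fq & Gq & _ & [Bq|K]); [def|auto| | |eauto].
  - intros p' Fp' _. destruct (classic (exists v, v ∈ F /\ subset p' v /\ B v)) as [(v & H1 & H2 & H3)|K].
    + exists v. auto.
    + exists p'. split; auto. split; [intros x; auto|]. right. intros v H1 H2 H3. eauto.
  - destruct (N q Gq Bq).
Qed.

Definition rank_rel (r t : V) := exists p, app t r p.
Definition rank_step (t s v : V) := forall z, z ∈ v <-> exists r u, app s r u /\ (z ∈ u \/ z = u).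

(** The rank of a name, computed in [V], bounds its value whenever that is an ordinal, by induction
    on names inside [W]. So every ordinal of [W] is at most an ordinal of [V], and [V] is
    transitive. *)
Lemma ordinal_ground (l : W) : ordinal l -> exists b, l = i b.
Proof.
  intros Ol. destruct (ge_val hG l) as (t0 & (T & Ht0 & HT) & (h & Fh & Hl & Hh)).
  assert (HR : Def2 rank_rel) by (unfold rank_rel; def).
  assert (HE : Def3 rank_step) by (unfold rank_step; def).
  assert (Efun : forall x s y y', rank_step x s y -> rank_step x s y' -> y = y').
  { intros x s y y' H H'. apply set_ext. intros z. now rewrite (H z), (H' z). }
  assert (wf : forall C : V, (exists x, x ∈ C) -> exists x, x ∈ C /\ forall y, y ∈ C -> ~ rank_rel y x)
    by apply wf_name.
  set (rv := rec_val rank_rel rank_step).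
  assert (Drv : Def2 rv) by (apply def_rec_val; auto).
  assert (cl : forall x y, x ∈ T -> rank_rel y x -> y ∈ T).
  { intros x y Hx (p & Hp). apply app_pr in Hp. destruct (HT x Hx _ Hp) as (r & p' & E & Hr & _).
    apply is_opair_pr, pr_inj in E as [-> _]. auto. }
  assert (Tot : forall t, t ∈ T -> exists v, rv t v).
  { apply rec_total; auto.
    intros t s _ _ _ _. destruct (ran_ex s) as [r Hr].
    exists (bu (Un r) r). intros z. rewrite in_bu, in_Un. split.
    - intros [(u & Hu & Hz)|Hz]; [apply Hr in Hu as [x Hx]|apply Hr in Hz as [x Hx]]; eauto.
    - intros (x & u & Hx & [Hz| ->]); [left; exists u; split; auto|right]; apply Hr; eauto. }
  assert (Ord : forall t v, rv t v -> ordinal v).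
  { apply (@name_ind _ ZV (fun t => forall v, rv t v -> ordinal v)); [def|].
    intros t IH v Hv. destruct (rec_val_eq wf Efun Hv) as (s & _ & As & Es & _).
    assert (As' : forall y u, app s y u <-> rank_rel y t /\ rv y u) by exact As.
    assert (Ou : forall r u, app s r u -> ordinal u).
    { intros r u H. apply As' in H as [(p & Hp) H]. eauto. }
    apply ord_set.
    - intros x Hx y Hy. apply Es in Hx as (r & u & Hr & Hx). apply Es. exists r, u. split; auto.
      left. destruct Hx as [Hx| ->]; auto. apply (@ord_trans _ u y x); eauto.
    - intros x Hx. apply Es in Hx as (r & u & Hr & [Hx| ->]); eauto.
      apply (@ord_elem _ ZV u); eauto. }
  destruct (@fun_intro _ ZV T rv) as (g & Fg & Ag); auto.
  { intros x y y' _. now apply rec_val_fun. }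
  assert (Main : forall tau, tau ∈ i T -> forall u, app h tau u -> ordinal u ->
                 forall o, app (i g) tau o -> subset u o).
  { apply (@name_ind _ ZW (fun tau => tau ∈ i T -> forall u, app h tau u -> ordinal u ->
                 forall o, app (i g) tau o -> subset u o)); [def|].
    intros tau IH Ht u Hu Ou o Ho v Hv.
    apply i_app_inv in Ho as (t & o0 & -> & -> & Ho). apply Ag in Ho as [Tt Ho].
    destruct (Hh _ _ Hu) as [_ K]. apply K in Hv as (r & p & Gp & Hr & Hrv).
    assert (Ov : ordinal v) by (apply (@ord_elem _ ZW u); auto; apply K; eauto).
    destruct (i_app_inv Hr) as (r0 & p0 & -> & -> & Hr0).
    assert (Tr : r0 ∈ T) by (apply (cl t); auto; exists p0; auto).
    destruct (Tot r0 Tr) as [o1 Ho1].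
    assert (Sv : subset v (i o1)).
    { apply (IH (i r0) (i p0)); auto; [now apply i_in|]. apply i_app, Ag. auto. }
    assert (O1 : o1 ∈ o0).
    { destruct (rec_val_eq wf Efun Ho) as (s & _ & As & Es & _). apply Es. exists r0, o1.
      split; auto. apply As. split; auto. exists p0; auto. }
    apply (@ord_le_mem_trans _ v (i o1) (i o0)).
    - apply i_ordinal. eauto.
    - apply ord_sub_mem; auto. apply i_ordinal. eauto.
    - now apply i_in. }
  destruct (Tot t0 Ht0) as [o Ho].
  assert (Sl : subset l (i o)).
  { apply (Main (i t0)); auto; [now apply i_in|]. apply i_app, Ag. auto. }
  destruct (@ord_sub_mem _ ZW l (i o)) as [K|K]; auto.
  - apply i_ordinal. eauto.
  - apply i_elem in K as (b & -> & _). eauto.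
  - eauto.
Qed.

(** * Forcing equality with a set of the ground model *)

Section CheckForcing.
Context (T A : V) (TA : transitive_set A).
Context (HT : forall s, s ∈ T -> forall z, z ∈ s -> exists r p, is_opair z r p /\ r ∈ T /\ p ∈ F).

Definition tri (S t a p : V) : Prop := pr (pr t a) p ∈ S.

(* The clauses of the recursion for [p ⊩ t = ǎ].  They are monotone in [S], so that
   the relation is obtained as a greatest fixed point, without recursion. *)
Definition forcing_step (S t a p : V) :=
  (forall r q, app t r q -> forall p', p' ∈ F -> subset p p' -> subset q p' ->
     exists p'' b, p'' ∈ F /\ subset p' p'' /\ b ∈ a /\ tri S r b p'') /\
  (forall b, b ∈ a -> forall p', p' ∈ F -> subset p p' ->
     exists p'' r q, p'' ∈ F /\ subset p' p'' /\ app t r q /\ subset q p'' /\ tri S r b p'').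

Definition postfixed (S : V) := forall t a p, tri S t a p -> t ∈ T /\ a ∈ A /\ p ∈ F /\ forcing_step S t a p.

Lemma name_mem t r q : t ∈ T -> app t r q -> r ∈ T /\ q ∈ F.
Proof.
  intros Ht H. apply app_pr in H. destruct (HT Ht H) as (r' & q' & E & Hr & Hq).
  apply is_opair_pr, pr_inj in E as [-> ->]. auto.
Qed.

Lemma forcing_step_mono S S' t a p : subset S S' -> forcing_step S t a p -> forcing_step S' t a p.
Proof.
  intros K [H1 H2]. split.
  - intros r q H p' Hp' S1 S2. destruct (H1 r q H p' Hp' S1 S2) as (p'' & b & ? & ? & ? & Ht).
    exists p'', b. repeat split; auto. now apply K.
  - intros b Hb p' Hp' S1. destruct (H2 b Hb p' Hp' S1) as (p'' & r & q & ? & ? & ? & ? & Ht).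
    exists p'', r, q. repeat split; auto. now apply K.
Qed.

(** [R] is the union of all [postfixed] sets. A triple satisfying the clauses over [R] can be added
    to [R] without losing this property, so it is already there. *)
Lemma forcing_ex : exists R, forall t a p, tri R t a p <-> t ∈ T /\ a ∈ A /\ p ∈ F /\ forcing_step R t a p.
Proof.
  set (O := pd (pd T A) F).
  destruct (@sep _ ZV O (fun z => exists S, subset S O /\ postfixed S /\ z ∈ S)) as [R HR];
    [unfold postfixed, forcing_step, tri; def|].
  assert (Post : postfixed R).
  { intros t a p H. apply HR in H as [H (S & SO & HS & K)].
    destruct (HS t a p K) as (H1 & H2 & H3 & H4). repeat split; auto;
    (assert (SR : subset S R) by (intros z Hz; apply HR; split; [auto|exists S; auto])); apply (forcing_step_mono SR H4). }
  exists R. intros t a p. split; [apply Post|].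
  intros (H1 & H2 & H3 & H4).
  assert (HO : pr (pr t a) p ∈ O) by (unfold O; rewrite !pr_in_pd; auto).
  apply HR. split; auto.
  exists (bu R (sg (pr (pr t a) p))). split; [|split; [|apply in_bu; right; now apply in_sg]].
  { intros z Hz. apply in_bu in Hz as [Hz|Hz]; [now apply HR in Hz|]. apply in_sg in Hz. now subst. }
  assert (SR : subset R (bu R (sg (pr (pr t a) p)))) by (intros z Hz; apply in_bu; auto).
  intros t' a' p' H. apply in_bu in H as [H|H].
  - destruct (Post t' a' p' H) as (J1 & J2 & J3 & J4). repeat split; auto; apply (forcing_step_mono SR J4).
  - apply in_sg, pr_inj in H as [E ->]. apply pr_inj in E as [-> ->].
    repeat split; auto; apply (forcing_step_mono SR H4).
Qed.

Context (R : V) (HR : forall t a p, tri R t a p <-> t ∈ T /\ a ∈ A /\ p ∈ F /\ forcing_step R t a p).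

Lemma forcing_mono t a p p' : tri R t a p -> p' ∈ F -> subset p p' -> tri R t a p'.
Proof.
  intros H Hp' S. apply HR in H as (H1 & H2 & H3 & [J1 J2]). apply HR. repeat split; auto.
  - intros r q Hr p1 Hp1 S1 S2. apply (J1 r q); auto. intros x Hx. auto.
  - intros b Hb p1 Hp1 S1. apply (J2 b Hb); auto. intros x Hx. auto.
Qed.

Context (h : W).
Context (Hh : forall s u, app h s u ->
      (forall r p, p ∈ G -> app s r p -> exists y, app h r y) /\
      (forall y, y ∈ u <-> exists r p, p ∈ G /\ app s r p /\ app h r y)).

(** From truth to forcing, genericity yields a condition that satisfies the clauses or refutes one
    of them persistently; a refutation contradicts the induction hypothesis at a member. From
    forcing to truth, each clause gives a set dense below p. *)
Lemma truth_step t a u : t ∈ T -> a ∈ A -> app h (i t) u ->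
  (forall r q b v, app t r q -> b ∈ A -> app h (i r) v ->
     (v = i b <-> exists p, i p ∈ G /\ tri R r b p)) ->
  (u = i a <-> exists p, i p ∈ G /\ tri R t a p).
Proof.
  intros Ht Ha Hu IH. destruct (Hh Hu) as [Hr Eu].
  assert (Aa : forall b, b ∈ a -> b ∈ A) by (intros b Hb; exact (TA Ha Hb)).
  assert (Mem : forall y, y ∈ u <-> exists r q, i q ∈ G /\ app t r q /\ app h (i r) y).
  { intros y. rewrite Eu. split.
    - intros (r & q & Gq & H & K). apply i_app_inv in H as (r0 & q0 & -> & -> & H). eauto.
    - intros (r & q & Gq & H & K). exists (i r), (i q). split; auto. split; auto. now apply i_app. }
  split.
  - intros ->. destruct G_nonempty as [p0 G0].
    (* The two persistent failures of the clauses: under [F1] a name in t is used whose value can be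
       forced equal to no member of a; under [F2] a member of a is never reached. *)
    set (F1 := fun p => exists r q, app t r q /\ subset q p /\
      forall p' b, p' ∈ F -> subset p p' -> b ∈ a -> ~ tri R r b p').
    set (F2 := fun p => exists b, b ∈ a /\
      forall p' r q, p' ∈ F -> subset p p' -> app t r q -> subset q p' -> ~ tri R r b p').
    destruct (@generic_below p0 (fun p => forcing_step R t a p \/ F1 p \/ F2 p)) as (p & Fp & Gp & _ & HQ);
      [unfold forcing_step, F1, F2, tri; def|auto| |].
    { intros p' Fp' _. apply NNPP. intros N. apply N. exists p'. split; auto.
      split; [intros x; auto|]. left. split.
      - intros r q Hrq p1 Fp1 S1 S2. apply NNPP. intros N1. apply N. exists p1. split; auto.
        split; auto. right. left. exists r, q. split; auto. split; auto.
        intros p2 b Fp2 S3 Hb K. apply N1. exists p2, b. auto.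
      - intros b Hb p1 Fp1 S1. apply NNPP. intros N1. apply N. exists p1. split; auto.
        split; auto. right. right. exists b. split; auto.
        intros p2 r q Fp2 S3 Hrq S4 K. apply N1. exists p2, r, q. auto. }
    destruct HQ as [HQ|[(r & q & Hrq & S1 & N)|(b & Hb & N)]].
    + exists p. split; auto. apply HR. auto.
    + exfalso. destruct (name_mem Ht Hrq) as [Tr Fq].
      assert (Gq : i q ∈ G) by (apply (@G_down q p); auto).
      destruct (Hr (i r) (i q) Gq) as [y Hy]; [now apply i_app|].
      assert (Hyu : y ∈ i a) by (apply Mem; eauto).
      apply i_elem in Hyu as (b & -> & Hb).
      destruct (proj1 (IH r q b (i b) Hrq (Aa b Hb) Hy) eq_refl) as (p2 & Gp2 & K).
      destruct (G_directed Gp Gp2) as (e & Ge & S2 & S3). assert (Fe := G_in_F Ge).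
      apply (N e b); auto. now apply (forcing_mono K).
    + exfalso. assert (Hyu : i b ∈ i a) by now apply i_in.
      apply Mem in Hyu as (r & q & Gq & Hrq & Hy).
      destruct (proj1 (IH r q b (i b) Hrq (Aa b Hb) Hy) eq_refl) as (p2 & Gp2 & K).
      destruct (G_directed Gp Gp2) as (e & Ge & S2 & S3).
      destruct (G_directed Ge Gq) as (e' & Ge' & S4 & S5). assert (Fe := G_in_F Ge').
      apply (N e' r q); auto.
      * intros x Hx. auto.
      * apply (forcing_mono K); auto. intros x Hx. auto.
  - intros (p & Gp & K). apply HR in K as (_ & _ & Fp & [J1 J2]). symmetry. apply i_ext.
    intros y. rewrite Mem. split.
    + intros (r & q & Gq & Hrq & Hy). destruct (G_directed Gp Gq) as (e & Ge & S1 & S2).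
      destruct (@generic_below e (fun d => exists b, b ∈ a /\ tri R r b d))
        as (d & Fd & Gd & _ & b & Hb & Kb); [unfold tri; def|auto| |].
      * intros p' Fp' S3. destruct (J1 r q Hrq p' Fp') as (p'' & b & ? & ? & ? & ?).
        -- intros x Hx. auto.
        -- intros x Hx. auto.
        -- exists p''. eauto.
      * exists b. split; auto. apply (IH r q b y); eauto.
    + intros (b & -> & Hb).
      destruct (@generic_below p (fun d => exists r q, app t r q /\ subset q d /\ tri R r b d))
        as (d & Fd & Gd & _ & r & q & Hrq & Sq & Kd); [unfold tri; def|auto| |].
      * intros p' Fp' S3. destruct (J2 b Hb p' Fp' S3) as (p'' & r & q & ? & ? & ? & ? & ?).
        exists p''. eauto 7.
      * destruct (name_mem Ht Hrq) as [Tr Fq].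
        assert (Gq : i q ∈ G) by (apply (@G_down q d); auto).
        destruct (Hr (i r) (i q) Gq) as [y Hy]; [now apply i_app|].
        exists r, q. split; auto. split; auto.
        rewrite <- (proj2 (IH r q b y Hrq (Aa b Hb) Hy)); eauto.
Qed.

Lemma truth t a u : t ∈ T -> a ∈ A -> app h (i t) u ->
  (u = i a <-> exists p, i p ∈ G /\ tri R t a p).
Proof.
  (* The induction on names takes place in [W], so the claim must be definable there; the relation
     [tri R] of [V] is replaced by membership in the parameter [i R]. *)
  assert (C : forall t a, (exists p, p ∈ G /\ pr (pr (i t) (i a)) p ∈ i R) <->
                          exists p, i p ∈ G /\ tri R t a p).
  { intros t0 a0. split.
    - intros (p & Gp & Kp). destruct (G_elem Gp) as (p0 & -> & _). exists p0. split; auto.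
      rewrite <- !i_pr in Kp. now apply i_in in Kp.
    - intros (p & Gp & Kp). exists (i p). split; auto. rewrite <- !i_pr. now apply i_in. }
  assert (K : forall tau, tau ∈ i T -> forall u b, app h tau u -> b ∈ i A ->
    (u = b <-> exists p, p ∈ G /\ pr (pr tau b) p ∈ i R)).
  { apply (@name_ind _ ZW (fun tau => tau ∈ i T -> forall u b, app h tau u -> b ∈ i A ->
      (u = b <-> exists p, p ∈ G /\ pr (pr tau b) p ∈ i R))); [def|].
    intros tau IH Htau v b Hv Hb. apply i_elem in Htau as (t0 & -> & Ht0), Hb as (a0 & -> & Ha0).
    rewrite C. apply truth_step; auto.
    intros r q b v' Hrq Hb Hv'. rewrite <- C. apply (IH (i r) (i q)); auto.
    - now apply i_app.
    - apply i_in. now destruct (name_mem Ht0 Hrq).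
    - now apply i_in. }
  intros Ht Ha Hu. rewrite <- C. apply K; auto; now apply i_in.
Qed.

End CheckForcing.

(** An element a enters [y] through a pair (r, q) of the name whose r has value a; [H] collects the
    conditions below such a q that force r to equal a. A transitive set containing [A] serves as
    range of the possible values. *)
Lemma nice_name (A : V) (y : W) : exists H, subset H (pd A F) /\
  forall a, a ∈ A -> (i a ∈ y <-> exists p, i p ∈ G /\ pr a p ∈ H).
Proof.
  destruct (ge_val hG y) as (t0 & (T & Ht0 & HT) & (h & Fh & Hy & Hh)).
  destruct (tc_ex A) as (B & TB & HB).
  destruct (@forcing_ex T B) as [R HR].
  destruct (@sep _ ZV (pd A F) (fun z => exists a p r q, z = pr a p /\ app t0 r q /\ q ∈ F /\
    subset q p /\ tri R r a p)) as [H EH]; [unfold tri; def|].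
  exists H. split; [intros z Hz; now apply EH in Hz|].
  intros a Ha. assert (Ba : a ∈ B) by exact (TB A HB a Ha).
  destruct (Hh _ _ Hy) as [Hr Ey]. rewrite Ey. split.
  - intros (r' & q' & Gq & Hrq & Hra). apply i_app_inv in Hrq as (r & q & -> & -> & Hrq).
    destruct (name_mem HT Ht0 Hrq) as [Tr Fq].
    destruct (proj1 (truth TB HT HR Hh Tr Ba Hra) eq_refl) as (p & Gp & K).
    destruct (G_directed Gp Gq) as (e & Ge & S1 & S2). assert (Fe := G_in_F Ge).
    exists e. split; auto. apply EH. split; [now apply pr_in_pd|].
    exists a, e, r, q. repeat split; auto. now apply (forcing_mono HR K).
  - intros (p & Gp & Hp). apply EH in Hp as (_ & a' & p' & r & q & E & Hrq & Fq & S & K).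
    apply pr_inj in E as [<- <-]. destruct (name_mem HT Ht0 Hrq) as [Tr _].
    assert (Gq : i q ∈ G) by (apply (@G_down q p); auto).
    destruct (Hr (i r) (i q) Gq) as [v Hv]; [now apply i_app|].
    exists (i r), (i q). split; auto. split; [now apply i_app|].
    rewrite <- (proj2 (truth TB HT HR Hh Tr Ba Hv)); eauto.
Qed.

End GenericExtension.

(** * The lifted measure *)

Section LiftedMeasure.
Context {V W : memstruct} {ZV : ZFC V} {ZW : ZFC W} (i : V -> W) (k F : V) (G f : W).
Context (hG : generic_extension i F (fun q p => subset p q) G) (hf : is_union f G).
Context (l J I U t w : V) (Gd : guided k F l J I U t w).
Context (Ck : cardinal k) (HJ : is_Pkl k l J).
Context (Ol : ordinal l) (Hkl : ord_le k l).

Local Notation All := (almost_all I U).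

Lemma gd_ord : ordinal k.
Proof. apply Ck. Qed.

(** * Positive and negative decisions at the seed *)

Definition Pos r K := All (fun x => pos k F (bu r (ap w x)) K (ap t x)).
Definition Neg r K := All (fun x => neg k F (bu r (ap w x)) K (ap t x)).
Definition inK K y := exists b p, i p ∈ G /\ pr (pr y b) p ∈ K.

(** [Pos] quantifies over [V]. As a set of [V], its extension becomes a parameter for [W], which
    makes the quantifier of the lifted measure definable there. *)
Lemma pos_set_ex : exists pos_set, forall z, z ∈ pos_set <->
  exists r K, z = pr r K /\ r ∈ F /\ subset K (pd (pd J k) F) /\ Pos r K.
Proof.
  destruct (@sep _ ZV (pd F (Pw (pd (pd J k) F))) (fun z => exists r K, z = pr r K /\ Pos r K))
    as [pos_set HP0]; [unfold Pos, pos; def|].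
  exists pos_set. intros z. rewrite HP0. split.
  - intros (Hz & r & K & -> & HP). apply pr_in_pd in Hz as [Hr HK]. apply in_Pw in HK. eauto 6.
  - intros (r & K & -> & Hr & HK & HP). rewrite pr_in_pd, in_Pw. eauto 6.
Qed.

Definition pos_set : V := proj1_sig (constructive_indefinite_description _ pos_set_ex).

Lemma in_pos_set r K : pr r K ∈ pos_set <-> r ∈ F /\ subset K (pd (pd J k) F) /\ Pos r K.
Proof.
  unfold pos_set. destruct constructive_indefinite_description as [p Hp]. simpl. rewrite Hp. split.
  - intros (r' & K' & E & H). apply pr_inj in E as [-> ->]. auto.
  - eauto 6.
Qed.

(* "For almost all [y], [Q y]" in the measure of the generic extension: [K] names a set of
   [y] with [Q y], and a condition [r ∪ w] with [r] in [G] forces the seed into it. *)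
Definition Mall (Q : W -> Prop) := exists r K, r ∈ G /\ pr r K ∈ i pos_set /\
  forall y b p, p ∈ G -> pr (pr y b) p ∈ K -> Q y.

Lemma Mall_iff Q : Mall Q <-> exists r K, i r ∈ G /\ subset K (pd (pd J k) F) /\ Pos r K /\
  forall y, inK K y -> Q (i y).
Proof.
  split.
  - intros (r & K & Gr & HP & H). apply (i_elem hG) in HP as (z & E & Hz).
    destruct (i_pr_inv hG E) as (r0 & K0 & -> & -> & ->). apply in_pos_set in Hz as (Fr & SK & HP).
    exists r0, K0. repeat split; auto. intros y (b & p & Gp & Hp).
    apply (H (i y) (i b) (i p)); auto. rewrite <- !(i_pr hG). now apply (i_in hG).
  - intros (r & K & Gr & SK & HP & H). exists (i r), (i K). split; auto. split.
    + rewrite <- (i_pr hG). apply (i_in hG). apply in_pos_set. split; auto. now apply (G_in_F hG).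
    + intros y b p Gp Hp. apply (i_elem hG) in Hp as (z & E & Hz).
      destruct (i_pr_inv hG E) as (z1 & p0 & E1 & -> & ->). destruct (i_pr_inv hG E1) as (y0 & b0 & -> & -> & ->).
      apply H. exists b0, p0. auto.
Qed.

Lemma K_mem K y b p : subset K (pd (pd J k) F) -> pr (pr y b) p ∈ K -> y ∈ J /\ b ∈ k /\ p ∈ F.
Proof. intros S H. apply S in H. rewrite !pr_in_pd in H. tauto. Qed.

Lemma inK_J K y : subset K (pd (pd J k) F) -> inK K y -> y ∈ J.
Proof. intros S (b & p & _ & H). now destruct (K_mem S H). Qed.

Lemma pos_inK v K y : i v ∈ G -> pos k F v K y -> inK K y.
Proof.
  intros Gv (b & p & Hb & Fp & S & H). exists b, p. split; auto. now apply (@G_down _ _ _ _ _ hG p v).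
Qed.

Lemma neg_inK v K y : subset K (pd (pd J k) F) -> i v ∈ G -> neg k F v K y -> ~ inK K y.
Proof.
  intros SK Gv N (b & p & Gp & H). destruct (G_directed hG Gv Gp) as (e & Ge & S1 & S2).
  apply (N e); auto; [now apply (G_in_F hG)|]. destruct (K_mem SK H) as (_ & Hb & Fp).
  exists b, p. auto.
Qed.

Lemma subset_bu_l (a b c : V) : subset a b -> subset (bu a c) (bu b c).
Proof. intros H x. rewrite !in_bu. intuition. Qed.

Lemma subset_bu (a b c : V) : subset a b -> subset a (bu b c).
Proof. intros H x Hx. rewrite in_bu. auto. Qed.

Lemma Pos_mono r e K : subset r e -> Pos r K -> Pos e K.
Proof.
  intros S H. refine (um_mono (gd_umeas Gd) _ H _); [unfold pos; def|].
  intros x _. apply pos_mono. now apply subset_bu_l.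
Qed.

Lemma Neg_mono r e K : subset r e -> Neg r K -> Neg e K.
Proof.
  intros S H. refine (um_mono (gd_umeas Gd) _ H _); [unfold neg, pos; def|].
  intros x _. apply neg_mono. now apply subset_bu_l.
Qed.

(** The bridge from the ultrapower to V[f]: for each e the condition e ∪ w(x) is in [F] for almost
    all x, so no condition in the filter can exclude all v with [B v y], and genericity finds
    one. *)
Lemma seed_generic r (B : V -> V -> Prop) : Def2 B -> i r ∈ G ->
  (forall e, e ∈ F -> subset r e -> All (fun x => B (bu e (ap w x)) (ap t x))) ->
  exists v y, i v ∈ G /\ y ∈ J /\ B v y.
Proof.
  intros HB Gr H. apply NNPP. intros N.
  destruct (@generic_avoid _ _ _ _ _ _ hG (fun v => exists y, y ∈ J /\ B v y)) as (r' & Gr' & K).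
  { def. }
  { intros v Gv (y & Hy & Bv). apply N. exists v, y. auto. }
  destruct (G_directed hG Gr Gr') as (e & Ge & S1 & S2). assert (Fe := G_in_F hG Ge).
  assert (A : All (fun x => B (bu e (ap w x)) (ap t x) /\ bu e (ap w x) ∈ F)).
  { refine (um_and_mono (gd_umeas Gd) _ _ _ (H e Fe S1) (gd_join Gd Fe) _); [def|def|def|auto]. }
  destruct (um_ex (gd_umeas Gd) A) as (x & Hx & Bx & Fx).
  apply (K (bu e (ap w x)) Fx).
  - now apply subset_bu.
  - exists (ap t x). split; auto. now apply (gd_t Gd).
Qed.

Lemma Mall_both Q Q' : Mall Q -> Mall Q' -> exists y, y ∈ J /\ Q (i y) /\ Q' (i y).
Proof.
  intros H H'. apply Mall_iff in H as (r & K & Gr & SK & HP & HQ).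
  apply Mall_iff in H' as (r' & K' & Gr' & SK' & HP' & HQ').
  destruct (G_directed hG Gr Gr') as (e0 & Ge & S1 & S2).
  destruct (@seed_generic e0 (fun v y => pos k F v K y /\ pos k F v K' y)) as (v & y & Gv & Hy & P1 & P2).
  - unfold pos. def.
  - auto.
  - intros e Fe Se.
    refine (um_and_mono (gd_umeas Gd) _ _ _ (Pos_mono (r := r) (e := e) _ HP) (Pos_mono (r := r') (e := e) _ HP') _);
      try (unfold pos; def); auto; now apply subset_trans with e0.
  - exists y. split; auto. split; [apply HQ|apply HQ']; now apply pos_inK with v.
Qed.

Lemma Mall_ex Q : Mall Q -> exists y, y ∈ J /\ Q (i y).
Proof. intros H. destruct (Mall_both H H) as (y & Hy & HQ & _). eauto. Qed.

Lemma Mall_mono (Q Q' : W -> Prop) : Mall Q -> (forall y, y ∈ J -> Q (i y) -> Q' (i y)) -> Mall Q'.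
Proof.
  intros H HQ. apply Mall_iff in H as (r & K & Gr & SK & HP & H). apply Mall_iff.
  exists r, K. repeat split; auto. intros y Hy. apply HQ; auto. now apply inK_J with K.
Qed.

(** By [gd_dec] the conditions that decide [K] at the seed almost everywhere are dense; for one in
    the filter, the ultrafilter [U] selects the answer. *)
Lemma dichotomy K : subset K (pd (pd J k) F) ->
  exists r, i r ∈ G /\ (Pos r K \/ Neg r K).
Proof.
  intros SK. destruct (G_nonempty hG) as [p Gp].
  destruct (@generic_below _ _ _ _ _ _ hG p (fun r => All (fun x => dec k F (bu r (ap w x)) K (ap t x))))
    as (r & Fr & Gr & _ & Hr); [unfold dec, neg, pos; def|auto| |].
  - intros p' Fp' _. destruct (gd_dec Gd SK Fp') as (r & Fr & S & Hr). eauto.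
  - exists r. split; auto.
    destruct (um_ultra (gd_umeas Gd) (Q := fun x => pos k F (bu r (ap w x)) K (ap t x))) as [H|H];
      [unfold pos; def|left; exact H|right].
    refine (um_and_mono (gd_umeas Gd) _ _ _ Hr H _); try (unfold dec, neg, pos; def).
    intros x _ [D|D] N; tauto.
Qed.

Lemma name_of (A : V) (Q : W -> W -> Prop) : Def2 Q -> subset A (pd J k) ->
  exists K, subset K (pd (pd J k) F) /\
   (forall y b p, pr (pr y b) p ∈ K -> pr y b ∈ A) /\
   forall y b, pr y b ∈ A -> (Q (i y) (i b) <-> exists p, i p ∈ G /\ pr (pr y b) p ∈ K).
Proof.
  intros HQ SA. destruct (@sep _ ZW (i A) (fun z => exists y b, z = pr y b /\ Q y b)) as [S HS]; [def|].
  destruct (nice_name hG A S) as (K & SK & HK). exists K. split; [|split].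
  - intros z Hz. apply SK in Hz. apply in_pd in Hz as (x & p & Hx & Hp & ->).
    apply pr_in_pd. auto.
  - intros y b p H. apply SK in H. now apply pr_in_pd in H.
  - intros y b Hyb. rewrite <- (HK _ Hyb), HS, (i_pr hG). split.
    + intros H. split; [rewrite <- (i_pr hG); now apply (i_in hG)|eauto].
    + intros (_ & y' & b' & E & H). apply pr_inj in E as [-> ->]. auto.
Qed.

Lemma emp_k : emp ∈ k.
Proof.
  destruct (um_omega (gd_umeas Gd)) as (w0 & Hw & Hwk).
  apply (@ord_trans _ k emp w0); auto; [apply gd_ord|]. apply Hw.
Qed.

Lemma name_of_set (Q : W -> Prop) : Def1 Q -> exists K, subset K (pd (pd J k) F) /\
   forall y, y ∈ J -> (Q (i y) <-> inK K y).
Proof.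
  (* A set of points y is named as the set of pairs (y, 0). *)
  intros HQ. destruct (@name_of (pd J (sg emp)) (fun y b => Q y)) as (K & SK & HA & HK).
  - def.
  - intros z Hz. apply in_pd in Hz as (y & b & Hy & Hb & ->). apply in_sg in Hb. subst.
    apply pr_in_pd. split; auto. apply emp_k.
  - exists K. split; auto. intros y Hy. rewrite (HK y emp); [|apply pr_in_pd; split; auto; now apply in_sg].
    split.
    + intros (p & Gp & Hp). exists emp, p. auto.
    + intros (b & p & Gp & Hp). exists p. split; auto.
      pose proof (HA _ _ _ Hp) as E. apply pr_in_pd in E as [_ E]. apply in_sg in E. now subst.
Qed.

(** [Mall] speaks of positive decisions only, so a name K' for [Q] is decided as well. If K' were
    negative too, [seed_generic] would give a y outside both named sets, while [Q] holds outside the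
    first. *)
Lemma Neg_Mall r K (Q : W -> Prop) : Def1 Q -> subset K (pd (pd J k) F) -> i r ∈ G -> Neg r K ->
  (forall y, y ∈ J -> ~ inK K y -> Q (i y)) -> Mall Q.
Proof.
  intros HQ SK Gr HN H. destruct (name_of_set HQ) as (K' & SK' & HK').
  destruct (dichotomy SK') as (r' & Gr' & [HP|HN']).
  - apply Mall_iff. exists r', K'. repeat split; auto. intros y Hy. apply HK'; auto.
    now apply inK_J with K'.
  - exfalso. destruct (G_directed hG Gr Gr') as (e0 & Ge & S1 & S2).
    destruct (@seed_generic e0 (fun v y => neg k F v K y /\ neg k F v K' y)) as (v & y & Gv & Hy & N1 & N2).
    + unfold neg, pos. def.
    + auto.
    + intros e Fe Se.
      refine (um_and_mono (gd_umeas Gd) _ _ _ (Neg_mono (r := r) (e := e) _ HN) (Neg_mono (r := r') (e := e) _ HN') _);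
        try (unfold neg, pos; def); auto; now apply subset_trans with e0.
    + apply (neg_inK SK' Gv N2). apply HK'; auto. apply H; auto. now apply neg_inK with v.
Qed.

Lemma Mall_ultra (Q : W -> Prop) : Def1 Q -> Mall Q \/ Mall (fun y => ~ Q y).
Proof.
  intros HQ. destruct (name_of_set HQ) as (K & SK & HK).
  destruct (dichotomy SK) as (r & Gr & [HP|HN]).
  - left. apply Mall_iff. exists r, K. repeat split; auto. intros y Hy. apply HK; auto.
    now apply inK_J with K.
  - right. apply (@Neg_Mall r K); auto; [def|]. intros y Hy N HQ'. apply N. now apply HK.
Qed.

(** Once the index is constant, the part of [K] with this index is itself a name, and its positive
    decision concerns the single predicate at [b]. *)
Lemma Mall_value r K (Q : W -> W -> Prop) b : subset K (pd (pd J k) F) -> i r ∈ G ->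
  All (fun x => exists p, p ∈ F /\ subset p (bu r (ap w x)) /\ pr (pr (ap t x) b) p ∈ K) -> b ∈ k ->
  (forall y p, y ∈ J -> i p ∈ G -> pr (pr y b) p ∈ K -> Q (i y) (i b)) -> Mall (fun y => Q y (i b)).
Proof.
  intros SK Gr H Hb HQ.
  destruct (@sep _ ZV K (fun z => exists y p, z = pr (pr y b) p)) as [K' HK']; [def|].
  apply Mall_iff. exists r, K'. split; auto. split; [|split].
  - intros z Hz. apply SK. now apply HK' in Hz.
  - refine (um_mono (gd_umeas Gd) _ H _); [unfold pos; def|].
    intros x _ (p & Fp & S & Hp). exists b, p. repeat split; auto. apply HK'. split; eauto.
  - intros y (b' & p & Gp & Hp). apply HK' in Hp as (Hp & y' & p' & E).
    apply pr_inj in E as [E _]. apply pr_inj in E as [_ ->].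
    apply (HQ y p); auto. now destruct (K_mem SK Hp).
Qed.

(** A single name collects the counterexamples (y, b) for all b in [a]. A positive decision has a
    constant index b by the completeness of [U], against the hypothesis at b; a negative one is the
    claim. *)
Lemma Mall_compl (Q : W -> W -> Prop) a : Def2 Q -> a ∈ k ->
  (forall b, b ∈ a -> Mall (Q (i b))) -> Mall (fun y => forall b, b ∈ i a -> Q b y).
Proof.
  intros HQ Ha H. assert (Ok := gd_ord).
  destruct (@name_of (pd J a) (fun y b => ~ Q b y)) as (K & SK & HA & HK).
  - def.
  - intros z Hz. apply in_pd in Hz as (y & b & Hy & Hb & ->). apply pr_in_pd. split; auto.
    now apply (@ord_trans _ k b a).
  - destruct (dichotomy SK) as (r & Gr & [HP|HN]).
    + exfalso.
      assert (E : exists b, b ∈ a /\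
        All (fun x => exists p, p ∈ F /\ subset p (bu r (ap w x)) /\ pr (pr (ap t x) b) p ∈ K)).
      { apply NNPP. intros N.
        refine (um_contra (gd_umeas Gd) _ HP _); [unfold pos; def|].
        apply (um_mono (gd_umeas Gd) (Q := fun x => forall b, b ∈ a -> ~ exists p, p ∈ F /\
          subset p (bu r (ap w x)) /\ pr (pr (ap t x) b) p ∈ K)); [unfold pos; def| |].
        - apply (um_compl (gd_umeas Gd) (Q := fun b x => ~ exists p, p ∈ F /\
          subset p (bu r (ap w x)) /\ pr (pr (ap t x) b) p ∈ K)); [def|auto|].
          intros b Hb. apply (um_not (gd_umeas Gd)); [def|]. intros K'. eauto.
        - intros x _ N' (b & p & Hb & Fp & S & Hp). apply (N' b); eauto.
          apply HA in Hp. now apply pr_in_pd in Hp. }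
      destruct E as (b & Hb & Ab).
      assert (Kb : Mall (fun y => ~ Q (i b) y)).
      { apply (@Mall_value r K (fun y b => ~ Q b y) b); auto.
        - now apply (@ord_trans _ k b a).
        - intros y p Hy Gp Hp. apply (HK y b); eauto. }
      destruct (Mall_both (H b Hb) Kb) as (y & _ & H1 & H2). auto.
    + apply (@Neg_Mall r K); auto; [def|]. intros y Hy N b Hb.
      apply (i_elem hG) in Hb as (b0 & -> & Hb). apply NNPP. intros NQ. apply N.
      destruct (proj1 (HK y b0 (proj2 (pr_in_pd _ _ _ _) (conj Hy Hb))) NQ) as (p & Gp & Hp).
      exists b0, p. auto.
Qed.

(** The same method with the pairs (y, b) where b ∈ y: the index of a positive decision is below the
    critical point, so [gd_press] makes it constant. *)
Lemma Mall_press (Q : W -> W -> Prop) : Def2 Q ->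
  Mall (fun y => exists b, b ∈ i k /\ b ∈ y /\ Q y b) -> exists b, b ∈ k /\ Mall (fun y => Q y (i b)).
Proof.
  intros HQ H.
  destruct (@sep _ ZV (pd J k) (fun z => exists y b, z = pr y b /\ b ∈ y)) as [A HA]; [def|].
  assert (HA' : forall y b, pr y b ∈ A <-> y ∈ J /\ b ∈ k /\ b ∈ y).
  { intros y b. rewrite HA, pr_in_pd. split.
    - intros [[H1 H2] (y' & b' & E & H3)]. apply pr_inj in E as [-> ->]. auto.
    - intros (H1 & H2 & H3). eauto 6. }
  destruct (@name_of A Q) as (K & SK & KA & HK); [def|intros z Hz; now apply HA in Hz|].
  destruct (dichotomy SK) as (r & Gr & [HP|HN]).
  - destruct (@gd_press _ _ _ _ _ _ _ _ _ _ Gd (fun x b =>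
      exists p, p ∈ F /\ subset p (bu r (ap w x)) /\ pr (pr (ap t x) b) p ∈ K)) as (b & Hb & Ab); [def| |].
    + refine (um_mono (gd_umeas Gd) _ HP _); [def|].
      intros x _ (b & p & Hb & Fp & S & Hp). exists b. split; auto. split; [|eauto].
      apply KA, HA' in Hp. tauto.
    + exists b. split; auto. apply (@Mall_value r K Q b); auto.
      intros y p Hy Gp Hp. apply (HK y b); eauto.
  - exfalso. assert (N : Mall (fun y => ~ exists b, b ∈ i k /\ b ∈ y /\ Q y b)).
    { apply (@Neg_Mall r K); auto; [def|]. intros y Hy N (b & Hb & Hby & Qb). apply N.
      apply (i_elem hG) in Hb as (b0 & -> & Hb). apply (i_in hG) in Hby.
      destruct (proj1 (HK y b0 (proj2 (HA' y b0) (conj Hy (conj Hb Hby)))) Qb) as (p & Gp & Hp).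
      exists b0, p. auto. }
    destruct (Mall_both H N) as (y & _ & H1 & H2). auto.
Qed.

Lemma Mall_ground (K : V) (Q : W -> Prop) : subset K (pd (pd J k) F) ->
  (forall r, i r ∈ G -> Pos r K) -> (forall y, inK K y -> Q (i y)) -> Mall Q.
Proof.
  intros SK HP HQ. destruct (G_nonempty hG) as [r Gr]. apply Mall_iff. exists r, K. auto.
Qed.

Lemma Mall_fine a : a ∈ l -> Mall (fun y => i a ∈ y).
Proof.
  intros Ha. destruct (@sep _ ZV (pd (pd J k) F) (fun z => exists y b p, z = pr (pr y b) p /\ a ∈ y))
    as [K HK]; [def|].
  apply (@Mall_ground K).
  - intros z Hz. now apply HK in Hz.
  - intros r Gr. assert (Fr := G_in_F hG Gr).
    refine (um_mono (gd_umeas Gd) _ (gd_fine Gd Ha) _); [unfold pos; def|].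
    intros x Hx Hax. exists emp, r. split; [apply emp_k|]. split; auto.
    split; [apply subset_bu; intros z; auto|]. apply HK. split; [|eauto 6].
    rewrite !pr_in_pd. split; auto. split; [now apply (gd_t Gd)|apply emp_k].
  - intros y (b & p & Gp & Hp). apply HK in Hp as (_ & y' & b' & p' & E & Hy).
    apply pr_inj in E as [E _]. apply pr_inj in E as [-> _]. now apply (i_in hG).
Qed.

(** The name consists of triples in which the condition p itself contains (y ∩ k, d). The condition
    r ∪ w(x) is such a p at the seed, and any such p in the filter is part of f. *)
Lemma Mall_top : Mall (fun y => exists c d, d ∈ i k /\ app f c d /\
  (forall a, a ∈ c <-> a ∈ i k /\ a ∈ y) /\ card_le y d).
Proof.
  set (T := fun y d p => exists c, app p c d /\ (forall a, a ∈ c <-> a ∈ k /\ a ∈ y) /\ card_le y d).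
  destruct (@sep _ ZV (pd (pd J k) F) (fun z => exists y d p, z = pr (pr y d) p /\ T y d p))
    as [K HK]; [unfold T; def|].
  apply (@Mall_ground K).
  - intros z Hz. now apply HK in Hz.
  - intros r Gr. assert (Fr := G_in_F hG Gr).
    refine (um_and_mono (gd_umeas Gd) _ _ _ (gd_top Gd) (gd_join Gd Fr) _); [def|def|unfold pos; def|].
    intros x Hx (c & d & Hd & Hcd & Ec & Lc) Fx. exists d, (bu r (ap w x)).
    split; auto. split; auto. split; [intros z; auto|]. apply HK. split.
    + rewrite !pr_in_pd. split; auto. split; auto. now apply (gd_t Gd).
    + exists (ap t x), d, (bu r (ap w x)). split; auto. exists c. split; auto.
      apply app_pr, in_bu. right. now apply app_pr.
  - intros y (d & p & Gp & Hp). pose proof Hp as Hp'. apply HK in Hp as (Hp & y' & d' & p' & E & c & Hc & Ec & Lc).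
    apply pr_inj in E as [E ->]. apply pr_inj in E as [-> ->].
    exists (i c), (i d'). split; [|split; [|split]].
    + apply (i_in hG). rewrite !pr_in_pd in Hp. tauto.
    + apply app_pr. apply hf. exists (i p'). split; auto. apply app_pr. now apply (i_app hG).
    + intros a. rewrite !(i_elem hG). split.
      * intros (b & -> & Hb). apply Ec in Hb as [H1 H2]. split; eauto.
      * intros [(b & -> & Hb) (b' & E & Hb')]. apply (i_inj hG) in E. subst. exists b'.
        split; auto. apply Ec. auto.
    + now apply (i_card_le hG).
Qed.

(** The lifted quantifier is complete and fine before it is known to be a measure on the right set.
    If [k] were collapsed, it would give a y in [J] containing all of [k], although y has size less
    than [k] in [V]. *)
Lemma no_collapse b : b ∈ k -> ~ card_le (i k) (i b).
Proof.
  intros Hb (g & Hg). destruct (injE Hg) as (T & D & Fn & Jn).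
  assert (M : Mall (fun y => forall c, c ∈ i b -> forall a, app g a c -> a ∈ y)).
  { apply (@Mall_compl (fun c y => forall a, app g a c -> a ∈ y)); [def|auto|].
    intros c Hc. destruct (classic (exists a, app g a (i c))) as [[a Ha]|N].
    - assert (Ka : a ∈ i k) by now apply D in Ha.
      apply (i_elem hG) in Ka as (a0 & -> & Ka).
      apply (Mall_mono (Q := fun y => i a0 ∈ y)).
      + apply Mall_fine. apply (@ord_mem_le_trans _ a0 k l); auto.
      + intros y _ Hy a Ha'. now rewrite (Jn a (i a0) (i c)).
    - destruct (@Mall_ultra (fun y => forall a, app g a (i c) -> a ∈ y)) as [M|M]; [def|auto|].
      destruct (Mall_ex M) as (y & _ & Ny). destruct Ny. intros a Ha. destruct N. eauto. }
  destruct (Mall_ex M) as (y & Hy & Ky). apply HJ in Hy as (_ & _ & N). apply N.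
  apply card_le_sub. intros a Ha. apply (i_in hG) in Ha. destruct (T _ Ha) as (c & Hc & Hac).
  apply (i_in hG). eauto.
Qed.

Lemma J_small y : y ∈ J -> subset (i y) (i l) /\ card_lt (i y) (i k).
Proof.
  intros Hy. apply HJ in Hy as (S & L & N). split; [now apply (i_subset hG)|].
  split; [now apply (i_card_le hG)|]. intros K.
  destruct (not_le_small Ck N) as (b & Hb & Lb). apply (no_collapse Hb).
  apply (card_le_trans K). now apply (i_card_le hG).
Qed.

(** [P] is computed in [W] and may have new elements; the measure concentrates on the image of [J],
    which is part of [P] because [k] is not collapsed. *)
Lemma lifted_measure : exists P mu, fine_measure (i k) (i l) P mu /\ umeas (i k) P mu /\
  forall Q, Def1 Q -> (almost_all P mu Q <-> Mall Q).
Proof.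
  destruct (@sep _ ZW (Pw (i l)) (fun x => card_lt x (i k))) as [P HP]; [def|].
  destruct (@sep _ ZW (Pw P) (fun s => Mall (fun y => y ∈ s))) as [mu Hmu]; [unfold Mall; def|].
  assert (HP' : is_Pkl (i k) (i l) P) by (intros x; rewrite HP, in_Pw; tauto).
  assert (JP : forall y, y ∈ J -> i y ∈ P) by (intros y Hy; apply HP'; now apply J_small).
  assert (E : forall Q, almost_all P mu Q -> Mall Q).
  { intros Q (s & Hs & K). apply Hmu in Hs as [_ Hs]. apply (Mall_mono Hs). intros y _ Hy. now apply K in Hy. }
  assert (E' : forall Q, Def1 Q -> Mall Q -> almost_all P mu Q).
  { intros Q HQ H. destruct (@sep _ ZW P Q HQ) as [s Hs]. exists s. split; auto. apply Hmu.
    split; [apply in_Pw; intros x Hx; now apply Hs in Hx|].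
    apply (Mall_mono H). intros y Hy HQy. apply Hs. auto. }
  assert (Um : umeas (i k) P mu).
  { constructor.
    - destruct (um_omega (gd_umeas Gd)) as (w0 & Hw & Hwk). exists (i w0).
      split; [now apply (i_omega_like hG)|now apply (i_in hG)].
    - intros Q Q' HQ' H K. apply E'; auto. apply (Mall_mono (E _ H)). auto.
    - intros Q H. destruct (Mall_ex (E _ H)) as (y & Hy & HQ). eauto.
    - intros Q HQ. destruct (Mall_ultra HQ) as [H|H]; [left|right]; apply E'; auto. def.
    - intros Q a HQ Ha H. apply (i_elem hG) in Ha as (a0 & -> & Ha). apply E'; [def|].
      apply Mall_compl; auto. intros b Hb. apply E. apply H. now apply (i_in hG). }
  exists P, mu. split; [|split; auto; intros Q HQ; split; auto].
  split; auto. split.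
  - apply umeas_complete_ultrafilter; auto.
    + apply (i_ordinal hG). apply gd_ord.
    + intros a Ha. apply Hmu in Ha as [Ha _]. now apply in_Pw.
  - intros a b Ha Eb. apply (i_elem hG) in Ha as (a0 & -> & Ha).
    assert (A : almost_all P mu (fun y => i a0 ∈ y)) by (apply E'; [def|now apply Mall_fine]).
    destruct A as (s & Hs & K). enough (s = b) by (subst; auto). apply set_ext. intros x.
    now rewrite (K x), (Eb x).
Qed.

End LiftedMeasure.

(** * Ultrapowers and the theorem of Łoś *)

(** For a fixed formula, satisfaction by values of definable terms is definable; thus it can be
    measured by [U]. The terms are generalised to follow the shift of variables at a quantifier. *)
Lemma def_sat {M : memstruct} phi : forall T : nat -> (nat -> M) -> M,
  (forall n, DF (T n)) -> Definable (fun e => sat (fun n => T n e) phi).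
Proof.
  induction phi as [m n|m n| |a IHa b IHb|a IHa]; intros T HT; simpl.
  - pose proof (HT m). pose proof (HT n). def.
  - pose proof (HT m). pose proof (HT n). def.
  - def.
  - apply def_imp; auto.
  - apply (@def_all _ (fun x e => sat (scons x (fun n => T n e)) a)).
    apply (@def_iff _ (fun e => sat (fun n => match n with 0 => fun e => e 0
                                    | S m => fun e => T m (fun n => e (S n)) end e) a)).
    + apply IHa. intros [|n]; [def|]. apply (DF_ren S (HT n)).
    + intros e. apply sat_ext. intros [|n]; reflexivity.
Qed.

Section Ultrapower.
Context {M : memstruct} {Z : ZFC M}.
Implicit Types a b c d g h p s u v x y z : M.
Context (k X U : M) (HU : umeas k X U).

Local Notation All := (almost_all X U).

Lemma almost_all_ext (Q Q' : M -> Prop) : (forall x, x ∈ X -> (Q x <-> Q' x)) -> All Q <-> All Q'.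
Proof.
  intros H. split; intros (s & Hs & K); exists s; split; auto; intros x;
    rewrite (K x); split; intros [H1 H2]; split; auto; now apply H.
Qed.

Lemma ult_mem_ap g g' : fun_on X g -> fun_on X g' ->
  (ult_mem X U g g' <-> All (fun x => ap g x ∈ ap g' x)).
Proof.
  intros H H'. apply almost_all_ext. intros x Hx. split.
  - intros (y & y' & H1 & H2 & H3). now rewrite (ap_eq (proj1 H) H1), (ap_eq (proj1 H') H2).
  - intros K. exists (ap g x), (ap g' x). repeat split; auto; now apply app_ap with X.
Qed.

Lemma ult_eq_ap g g' : fun_on X g -> fun_on X g' ->
  (ult_eq X U g g' <-> All (fun x => ap g x = ap g' x)).
Proof.
  intros H H'. apply almost_all_ext. intros x Hx. split.
  - intros (y & H1 & H2). now rewrite (ap_eq (proj1 H) H1), (ap_eq (proj1 H') H2).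
  - intros K. exists (ap g x). split; [|rewrite K]; now apply app_ap with X.
Qed.

Lemma ult_eq_sym g g' : ult_eq X U g g' -> ult_eq X U g' g.
Proof.
  intros H. refine (um_mono HU _ H _); [def|]. intros x _ (y & H1 & H2). eauto.
Qed.

Lemma ult_mem_eq_l g g' v : fun_on X g -> fun_on X g' -> fun_on X v ->
  ult_eq X U g g' -> ult_mem X U g v -> ult_mem X U g' v.
Proof.
  intros H H' Hv E K. apply (ult_eq_ap H H') in E. apply (ult_mem_ap H Hv) in K.
  apply (ult_mem_ap H' Hv). refine (um_and_mono HU _ _ _ E K _); [def|def|def|].
  intros x _ -> ?. auto.
Qed.

Lemma ult_mem_eq_r g g' v : fun_on X g -> fun_on X g' -> fun_on X v ->
  ult_eq X U g g' -> ult_mem X U v g -> ult_mem X U v g'.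
Proof.
  intros H H' Hv E K. apply (ult_eq_ap H H') in E. apply (ult_mem_ap Hv H) in K.
  apply (ult_mem_ap Hv H'). refine (um_and_mono HU _ _ _ E K _); [def|def|def|].
  intros x _ -> ?. auto.
Qed.

Lemma ult_class_fun g a : ult_class X U g a -> fun_on X g.
Proof. intros (h & _ & H & K). now destruct (K _ _ H). Qed.

(* It suffices to collapse the functions into a transitive set containing the range of [g]. *)
Lemma ult_class_ex g : fun_on X g -> exists a, ult_class X U g a.
Proof.
  intros Hg. destruct (tc_ex g) as (T & HT & HgT).
  assert (RT : forall x, x ∈ X -> ap g x ∈ T).
  { intros x Hx. apply (HT (up x (ap g x))); [|apply in_up; auto].
    apply (HT (pr x (ap g x))); [|unfold pr; apply in_up; auto].
    apply (HT g HgT). apply app_pr. now apply app_ap with X. }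
  destruct (@fun_set_ex _ Z X T) as [D HD'].
  destruct (@mostowski _ Z D (fun v u => ult_mem X U v u)) as (h & Fh & Eh).
  { def. }
  { intros C HC NE. apply (ult_wf HU); auto. intros u Hu. apply HC in Hu. now apply HD' in Hu. }
  assert (Dg : g ∈ D) by (apply HD'; auto).
  exists (ap h g), h. split; [apply Fh|]. split; [now apply app_ap with D|].
  intros u b Hub. apply (app_ap_iff _ _ Fh) in Hub as [Du ->].
  assert (Fu := proj1 (proj1 (HD' u) Du)). assert (Ru := proj2 (proj1 (HD' u) Du)).
  split; auto. split.
  - intros v Fv Hvu.
    destruct (@choice_fun _ Z X (fun x y => (ap v x ∈ T /\ y = ap v x) \/ (~ ap v x ∈ T /\ y = g)))
      as (v' & Fv' & Ev); [def| |].
    { intros x _. destruct (classic (ap v x ∈ T)); eauto. }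
    assert (Dv' : v' ∈ D).
    { apply HD'. split; auto. intros x Hx. destruct (Ev x Hx) as [[H ->]|[_ ->]]; auto. }
    exists v', (ap h v'). split; [|now apply app_ap with D].
    apply ult_eq_ap; auto. apply (ult_mem_ap Fv Fu) in Hvu.
    refine (um_mono HU _ Hvu _); [def|]. intros x Hx Hm. destruct (Ev x Hx) as [[_ E]|[N _]]; auto.
    destruct N. exact (HT _ (Ru x Hx) _ Hm).
  - intros y. rewrite (Eh u y Du). split.
    + intros (v & Dv & Hm & ->). exists v. split; auto. now apply app_ap with D.
    + intros (v & Hm & Hy). apply (app_ap_iff _ _ Fh) in Hy as [Dv ->]. eauto.
Qed.

(** The attempts are defined on different representatives; at a minimal function of disagreement,
    every member has representatives in both attempts, with equal values. *)
Lemma ult_class_unique u u' b b' :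
  ult_eq X U u u' -> ult_class X U u b -> ult_class X U u' b' -> b = b'.
Proof.
  intros E (h & Fh & Hub & Hh) Hu'.
  destruct (dom_ex h) as [D HD]. apply NNPP. intros Ne.
  destruct (@sep _ Z D (fun u => exists b u' b', app h u b /\ ult_eq X U u u' /\
    ult_class X U u' b' /\ b <> b')) as [C HC]; [def|].
  destruct (ult_wf HU (C := C)) as (m & Hm & Min).
  { intros v Hv. apply HC in Hv as (_ & b1 & _ & _ & Hv & _). now destruct (Hh _ _ Hv). }
  { exists u. apply HC. split; [apply HD; eauto|]. exists b, u', b'. auto. }
  apply HC in Hm as (_ & b1 & m' & b2 & Hb1 & Em & Hm' & Nb).
  destruct (Hh _ _ Hb1) as (Fm & Cm & Mm).
  pose proof Hm' as (h' & Fh' & Hb2 & Hh').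
  destruct (Hh' _ _ Hb2) as (Fm' & Cm' & Mm').
  assert (Ag : forall v y v' y', app h v y -> ult_mem X U v m -> ult_eq X U v v' ->
    ult_class X U v' y' -> y = y').
  { intros v y v' y' H1 H2 H3 H4. apply NNPP. intros N. apply (Min v); auto.
    apply HC. split; [apply HD; eauto|]. exists y, v', y'. auto. }
  assert (CL : forall v y, app h' v y -> ult_class X U v y) by (intros v y H; exists h'; auto).
  apply Nb. apply set_ext. intros y. rewrite (Mm y), (Mm' y). split.
  - intros (v & Hv & Hy). assert (Fv : fun_on X v) by now destruct (Hh _ _ Hy).
    assert (Hv' : ult_mem X U v m') by now apply (@ult_mem_eq_r m m' v).
    destruct (Cm' v Fv Hv') as (v' & y' & E1 & Hy').
    assert (Fv' : fun_on X v') by now destruct (Hh' _ _ Hy').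
    rewrite (Ag v y v' y' Hy Hv E1 (CL _ _ Hy')). exists v'. split; auto.
    now apply (@ult_mem_eq_l v v' m').
  - intros (v & Hv & Hy). assert (Fv : fun_on X v) by now destruct (Hh' _ _ Hy).
    assert (Hv' : ult_mem X U v m) by (apply (@ult_mem_eq_r m' m v); auto; now apply ult_eq_sym).
    destruct (Cm v Fv Hv') as (v' & y' & E1 & Hy').
    assert (Fv' : fun_on X v') by now destruct (Hh _ _ Hy').
    assert (Hm2 : ult_mem X U v' m) by now apply (@ult_mem_eq_l v v' m).
    rewrite <- (Ag v' y' v y Hy' Hm2 (ult_eq_sym E1) (CL _ _ Hy)). eauto.
Qed.

Lemma in_ult_class g a y : ult_class X U g a ->
  (y ∈ a <-> exists v, fun_on X v /\ ult_mem X U v g /\ ult_class X U v y).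
Proof.
  intros (h & Fh & Hga & Hh). destruct (Hh _ _ Hga) as (Fg & Cg & Mg).
  assert (CL : forall v y, app h v y -> ult_class X U v y) by (intros v z H; exists h; auto).
  rewrite (Mg y). split.
  - intros (v & Hv & Hy). exists v. split; [now destruct (Hh _ _ Hy)|auto].
  - intros (v & Fv & Hv & Hy). destruct (Cg v Fv Hv) as (v' & y' & E & Hy').
    assert (Fv' : fun_on X v') by now destruct (Hh _ _ Hy').
    exists v'. split; [now apply (@ult_mem_eq_l v v' g)|].
    rewrite (@ult_class_unique v v' y y'); auto.
Qed.

(** If v and g differed almost everywhere, a function choosing elements of one outside the other
    would have its class in [y], yet equal to the class of a member of the other; the induction
    hypothesis makes the two functions agree. *)
Lemma ult_class_inj : forall y v g, ult_class X U v y -> ult_class X U g y -> ult_eq X U v g.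
Proof.
  apply (@eps_ind _ Z (fun y => forall v g, ult_class X U v y -> ult_class X U g y -> ult_eq X U v g)).
  { def. }
  intros y IH.
  assert (K : forall v g, ult_class X U v y -> ult_class X U g y ->
    All (fun x => exists z, z ∈ ap v x /\ ~ z ∈ ap g x) -> False).
  { intros v g Hv Hg H. assert (Fv := ult_class_fun Hv). assert (Fg := ult_class_fun Hg).
    destruct (@choice_partial _ Z X (fun x z => z ∈ ap v x /\ ~ z ∈ ap g x)) as (d & Fd & Hd); [def|].
    assert (A1 : All (fun x => ap d x ∈ ap v x)).
    { refine (um_mono HU _ H _); [def|]. intros x Hx K. now apply Hd. }
    assert (A2 : All (fun x => ~ ap d x ∈ ap g x)).
    { refine (um_mono HU _ H _); [def|]. intros x Hx K. now apply Hd. }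
    destruct (ult_class_ex Fd) as [z Hz].
    assert (Hzy : z ∈ y) by (apply (in_ult_class z Hv); exists d; split; auto; split; auto;
      now apply ult_mem_ap).
    pose proof Hzy as Hzy'. apply (in_ult_class z Hg) in Hzy' as (d' & Fd' & Hm & Hz').
    assert (E := IH z Hzy d d' Hz Hz').
    assert (Hm2 : ult_mem X U d g) by (apply (@ult_mem_eq_l d' d g); auto; now apply ult_eq_sym).
    apply (ult_mem_ap Fd Fg) in Hm2.
    apply (um_contra HU (Q := fun x => ap d x ∈ ap g x)); auto. def. }
  intros v g Hv Hg. assert (Fv := ult_class_fun Hv). assert (Fg := ult_class_fun Hg).
  apply ult_eq_ap; auto. apply NNPP. intros N. apply (um_not HU) in N; [|def].
  destruct (um_ultra HU (Q := fun x => exists z, z ∈ ap v x /\ ~ z ∈ ap g x)) as [H|H]; [def| |].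
  - exact (K v g Hv Hg H).
  - apply (K g v Hg Hv). refine (um_and_mono HU _ _ _ N H _); [def|def|def|].
    intros x _ Ne Nz. apply NNPP. intros N2. apply Ne. apply set_ext. intros z.
    split; intros Hz; apply NNPP; intros N3; [apply Nz|apply N2]; eauto.
Qed.

Lemma ult_class_mem g g' a a' : ult_class X U g a -> ult_class X U g' a' ->
  (a ∈ a' <-> All (fun x => ap g x ∈ ap g' x)).
Proof.
  intros H H'. assert (Fg := ult_class_fun H). assert (Fg' := ult_class_fun H').
  rewrite <- (ult_mem_ap Fg Fg'), (in_ult_class a H'). split.
  - intros (v & Fv & Hm & Hv). apply (@ult_mem_eq_l v g g'); auto. now apply (@ult_class_inj a).
  - intros Hm. exists g. auto.
Qed.

Lemma ult_class_eq g g' a a' : ult_class X U g a -> ult_class X U g' a' ->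
  (a = a' <-> All (fun x => ap g x = ap g' x)).
Proof.
  intros H H'. assert (Fg := ult_class_fun H). assert (Fg' := ult_class_fun H').
  rewrite <- (ult_eq_ap Fg Fg'). split.
  - intros ->. now apply (@ult_class_inj a').
  - intros E. exact (ult_class_unique E H H').
Qed.

(** The atomic cases are the isomorphism of the ultrapower with its collapse. For a quantifier, a
    function choosing counterexamples represents an element at which the statement fails. *)
Lemma los phi : forall (e : nat -> M) (a : nat -> ultrapower X U),
  (forall n, ult_class X U (e n) (proj1_sig (a n))) ->
  (sat a phi <-> All (fun x => sat (fun n => ap (e n) x) phi)).
Proof.
  assert (DS : forall (e : nat -> M) phi, Def1 (fun x => sat (fun n => ap (e n) x) phi)).
  { intros e psi. unfold Def1. apply (@def_sat _ psi (fun n e' => ap (e n) (e' 0))).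
    intros n. def. }
  induction phi as [m n|m n| |p IHp q IHq|p IHp]; intros e a Ha; cbn [sat].
  - exact (ult_class_mem (Ha m) (Ha n)).
  - rewrite <- (ult_class_eq (Ha m) (Ha n)). split; [now intros ->|].
    destruct (a m) as [x Hx], (a n) as [y Hy]. simpl. intros ->. now rewrite (proof_irrelevance _ Hx Hy).
  - split; [tauto|]. intros H. now destruct (um_ex HU H) as (x & _ & []).
  - rewrite (IHp e a Ha), (IHq e a Ha). pose proof (DS e p) as Dp. pose proof (DS e q) as Dq. split.
    + intros H. destruct (um_ultra HU Dp) as [K|K].
      * refine (um_mono HU _ (H K) _); [now apply def_imp|tauto].
      * refine (um_mono HU _ K _); [now apply def_imp|tauto].
    + intros H K. refine (um_and_mono HU _ _ Dq H K _); [now apply def_imp|auto|auto].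
  - assert (Dq : Def2 (fun x y => sat (scons y (fun n => ap (e n) x)) p)).
    { unfold Def2.
      apply (@def_iff _ (fun e' => sat (fun n => match n with 0 => fun e' => e' 1
                                    | S m => fun e' => ap (e m) (e' 0) end e') p)).
      - apply def_sat. intros [|n]; def.
      - intros e'. apply sat_ext. intros [|n]; reflexivity. }
    assert (Dv : forall v, Def1 (fun x => sat (scons (ap v x) (fun n => ap (e n) x)) p)).
    { intros v. apply (def_sub2 (a := fun e => e 0) (b := fun e => ap v (e 0)) Dq); def. }
    assert (St : forall v (b : ultrapower X U), ult_class X U v (proj1_sig b) ->
      (sat (scons b a) p <-> All (fun x => sat (scons (ap v x) (fun n => ap (e n) x)) p))).
    { intros v b Hv. rewrite (IHp (scons v e) (scons b a)).
      - apply almost_all_ext. intros x _. apply sat_ext. intros [|n]; reflexivity.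
      - intros [|n]; simpl; auto. }
    split.
    + intros H. apply NNPP. intros N. apply (um_not HU) in N; [|exact (DS e (FAll p))].
      destruct (@choice_partial _ Z X (fun x y => ~ sat (scons y (fun n => ap (e n) x)) p))
        as (v & Fv & Hv); [now apply def_not|].
      destruct (ult_class_ex Fv) as [b Hb].
      set (b' := exist (in_ult X U) b (ex_intro _ v (conj Fv Hb)) : ultrapower X U).
      assert (K := proj1 (St v b' Hb) (H b')).
      destruct (um_ex HU (um_and HU (Q := fun x => sat (scons (ap v x) (fun n => ap (e n) x)) p)
        (Q' := fun x => ~ forall y, sat (scons y (fun n => ap (e n) x)) p)
        (Dv v)
        (def_not (DS e (FAll p))) K N)) as (x & Hx & K1 & K2).
      apply (Hv x Hx); auto. now apply not_all_ex_not in K2.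
    + intros H b. destruct (proj2_sig b) as (v & Fv & Hv). apply (St v b Hv).
      refine (um_mono HU (Dv v) H _). intros x _ K. apply K.
Qed.

Lemma const_ex a : exists c, fun_on X c /\ forall x, x ∈ X -> ap c x = a.
Proof.
  apply (@choice_fun _ Z X (fun x y => y = a)); [def|eauto].
Qed.

Lemma ult_value v a : a ∈ k -> All (fun x => ap v x ∈ a) -> exists b, b ∈ a /\ All (fun x => ap v x = b).
Proof.
  intros Ha H. apply NNPP. intros N.
  refine (um_contra HU _ H _); [def|].
  apply (um_mono HU (Q := fun x => forall b, b ∈ a -> ap v x <> b)); [def| |].
  - apply (um_compl HU (Q := fun b x => ap v x <> b)); [def|auto|].
    intros b Hb. apply (um_not HU); [def|]. intros K. eauto.
  - intros x _ K Hx. exact (K _ Hx eq_refl).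
Qed.

(** The collapse of [g] is [b] when the functions below [g] are, almost everywhere, the constants
    with value in [b], and these constants collapse to their values. This covers both the elements
    of [k] and [k] itself. *)
Lemma ult_class_transfer g a b : ordinal k -> fun_on X g -> (forall y, y ∈ b -> y ∈ k) ->
  (forall v, fun_on X v -> All (fun x => ap v x ∈ ap g x) -> exists y, y ∈ b /\ All (fun x => ap v x = y)) ->
  (forall y, y ∈ b -> All (fun x => y ∈ ap g x)) ->
  (forall y c, y ∈ b -> fun_on X c -> (forall x, x ∈ X -> ap c x = y) -> ult_class X U c y) ->
  ult_class X U g a -> a = b.
Proof.
  intros Ok Fg Hb Hv Hy Hc Ha. apply set_ext. intros y. rewrite (in_ult_class y Ha). split.
  - intros (v & Fv & Hm & Hvy). apply (ult_mem_ap Fv Fg) in Hm.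
    destruct (Hv v Fv Hm) as (y' & Hy' & E). destruct (const_ex y') as (c & Fc & Ec).
    enough (y = y') by now subst.
    apply (ult_class_eq Hvy (Hc y' c Hy' Fc Ec)). refine (um_mono HU _ E _); [def|].
    intros x Hx ->. symmetry. auto.
  - intros Hyb. destruct (const_ex y) as (c & Fc & Ec). exists c. split; auto. split; auto.
    apply ult_mem_ap; auto. refine (um_mono HU _ (Hy y Hyb) _); [def|].
    intros x Hx K. now rewrite Ec.
Qed.

(** The embedding fixes every ordinal below [k]: by induction, as a function into a ∈ [k] is
    constant almost everywhere. *)
Lemma ult_class_small : ordinal k -> forall a, a ∈ k -> forall c, fun_on X c ->
  (forall x, x ∈ X -> ap c x = a) -> ult_class X U c a.
Proof.
  intros Ok. apply (@eps_ind _ Z (fun a => a ∈ k -> forall c, fun_on X c ->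
    (forall x, x ∈ X -> ap c x = a) -> ult_class X U c a)); [def|].
  intros a IH Ha c Fc Ec. destruct (ult_class_ex Fc) as [a' Ha'].
  assert (Kb : forall y, y ∈ a -> y ∈ k) by (intros y Hy; now apply (@ord_trans _ k y a)).
  rewrite <- (@ult_class_transfer c a' a); auto.
  - intros v Fv Hv. apply ult_value; auto. refine (um_mono HU _ Hv _); [def|].
    intros x Hx. now rewrite Ec.
  - intros y Hy. apply (um_true HU); [def|]. intros x Hx. now rewrite Ec.
Qed.

Lemma ult_class_critical g : ordinal k -> fun_on X g ->
  (forall v, fun_on X v -> All (fun x => ap v x ∈ ap g x) -> exists y, y ∈ k /\ All (fun x => ap v x = y)) ->
  (forall y, y ∈ k -> All (fun x => y ∈ ap g x)) -> ult_class X U g k.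
Proof.
  intros Ok Fg Hv Hy. destruct (ult_class_ex Fg) as [a Ha].
  rewrite <- (@ult_class_transfer g a k); auto.
  intros y c Hyk Fc Ec. now apply ult_class_small.
Qed.

End Ultrapower.

(** Definability by one formula in all structures at once, without parameters: Łoś compares the same
    formula in [W] and in the ultrapower, whereas [Definable] concerns a single structure. *)
Definition UDef (Q : forall M : memstruct, (nat -> M) -> Prop) :=
  exists phi, forall (M : memstruct) (e : nat -> M), sat e phi <-> Q M e.

Lemma ud_mem m n : UDef (fun M e => e m ∈ e n).
Proof. exists (FMem m n). simpl. tauto. Qed.

Lemma ud_eq m n : UDef (fun M e => e m = e n).
Proof. exists (FEq m n). simpl. tauto. Qed.

Lemma ud_imp Q Q' : UDef Q -> UDef Q' -> UDef (fun M e => Q M e -> Q' M e).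
Proof. intros [p H] [q K]. exists (FImp p q). simpl. intros M e. now rewrite H, K. Qed.

Lemma ud_false : UDef (fun M e => False).
Proof. exists FBot. simpl. tauto. Qed.

Lemma ud_all (Q : forall M : memstruct, M -> (nat -> M) -> Prop) :
  UDef (fun M e => Q M (e 0) (fun n => e (S n))) -> UDef (fun M e => forall x, Q M x e).
Proof.
  intros [p H]. exists (FAll p). simpl. intros M e. split; intros K x; apply (H M (scons x e)), K.
Qed.

Lemma ud_iff Q Q' : UDef Q -> (forall M e, Q M e <-> Q' M e) -> UDef Q'.
Proof. intros [p H] K. exists p. intros M e. now rewrite H. Qed.

Lemma ud_not Q : UDef Q -> UDef (fun M e => ~ Q M e).
Proof. intros H. exact (ud_imp H ud_false). Qed.

Lemma ud_and Q Q' : UDef Q -> UDef Q' -> UDef (fun M e => Q M e /\ Q' M e).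
Proof.
  intros H H'. apply (ud_iff (ud_not (ud_imp H (ud_not H')))).
  intros M e. destruct (classic (Q M e)), (classic (Q' M e)); tauto.
Qed.

Lemma ud_or Q Q' : UDef Q -> UDef Q' -> UDef (fun M e => Q M e \/ Q' M e).
Proof.
  intros H H'. apply (ud_iff (ud_imp (ud_not H) H')).
  intros M e. destruct (classic (Q M e)), (classic (Q' M e)); tauto.
Qed.

Lemma ud_equiv Q Q' : UDef Q -> UDef Q' -> UDef (fun M e => Q M e <-> Q' M e).
Proof. intros H H'. apply ud_and; apply ud_imp; auto. Qed.

Lemma ud_ex (Q : forall M : memstruct, M -> (nat -> M) -> Prop) :
  UDef (fun M e => Q M (e 0) (fun n => e (S n))) -> UDef (fun M e => exists x, Q M x e).
Proof.
  intros H. apply (ud_iff (ud_not (ud_all (Q := fun M x e => ~ Q M x e) (ud_not H)))).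
  intros M e. split; [apply not_all_not_ex|firstorder].
Qed.

Ltac ud_step :=
  cbv beta;
  lazymatch goal with
  | |- UDef (fun M e => e _ ∈ e _) => apply ud_mem
  | |- UDef (fun M e => e _ = e _) => apply ud_eq
  | |- UDef (fun M e => @?A M e /\ @?B M e) => apply (@ud_and A B)
  | |- UDef (fun M e => @?A M e \/ @?B M e) => apply (@ud_or A B)
  | |- UDef (fun M e => @?A M e <-> @?B M e) => apply (@ud_equiv A B)
  | |- UDef (fun M e => ~ @?A M e) => apply (@ud_not A)
  | |- UDef (fun M e => exists x : carrier _, @?Q M e x) => apply (@ud_ex (fun M x e => Q M e x))
  | |- UDef (fun M e => forall x : carrier _, @?Q M e x) => apply (@ud_all (fun M x e => Q M e x))
  | |- UDef (fun M e => @?A M e -> @?B M e) => apply (@ud_imp A B)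
  | |- UDef _ => progress unfold is_cardinality, cardinal, equinumerous, bijection, injection, maps,
      fun_on, is_function, is_dom, app, is_opair, is_upair, ordinal, transitive_set, subset, is_empty, ord_le
  end.

Lemma ud_app : UDef (fun M e => app (e 0) (e 1) (e 2)).
Proof. repeat ud_step. Qed.

Lemma ud_is_cardinality : UDef (fun M e => is_cardinality (e 0) (e 1)).
Proof. repeat ud_step. Qed.

Lemma ud_ord_le : UDef (fun M e => ord_le (e 0) (e 1)).
Proof. repeat ud_step. Qed.

(** * The Menas property *)

Lemma cardinality_ex {M : memstruct} {Z : ZFC M} (x d : M) : ordinal d -> card_le x d ->
  exists c, is_cardinality c x /\ ord_le c d.
Proof.
  intros Od (g & Hg). destruct (image_ex Hg) as (a & Ha & E).
  destruct (order_type Od Ha) as (b & Ob & Lb & E').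
  destruct (@least_ord _ Z (fun c => equinumerous x c) b) as (c & Oc & Ec & Lc & Min); [def|auto| |].
  - exact (equinumerous_trans E E').
  - exists c. split; [|now apply (@ord_le_trans _ c b d)]. split; auto. split; auto.
    intros y Hy Eq. apply (Min y Hy). apply (equinumerous_trans Ec). now apply equinumerous_sym.
Qed.

Theorem theorem1p12 (V W : memstruct) (i : V -> W) (kappa F : V) (G f : W)
  (hV : ZFC V)
  (hkappa : strongly_compact kappa)
  (hF : is_fast_forcing kappa F)
  (hG : generic_extension i F (fun q p => subset p q) G)
  (hf : is_union f G) :
  menas_property (i kappa) f.
Proof.
  assert (ZW : ZFC W) by apply (ge_zfc hG).
  intros l' Ol' Hl'. destruct (ordinal_ground hG Ol') as [l ->].
  assert (Ol : ordinal l) by now apply (i_ordinal_inv hG).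
  assert (Hl : ord_le kappa l).
  { destruct Hl' as [H|H]; [left; now apply (i_in hG)|right; now apply (i_inj hG)]. }
  destruct (@sep _ hV (Pw l) (fun x => card_lt x kappa)) as [J HJ0]; [def|].
  assert (HJ : is_Pkl kappa l J) by (intros x; rewrite HJ0, in_Pw; tauto).
  destruct (guided_ex hkappa hF Ol Hl HJ) as (I & U & t & w & Gd).
  assert (Ck : cardinal kappa) by apply hkappa.
  destruct (lifted_measure hG Gd Ck HJ Ol Hl) as (P & mu & FM & Um & EM).
  assert (Ok : ordinal (i kappa)) by (apply (i_ordinal hG); apply Ck).
  exists P, mu. split; auto.
  destruct (const_ex P f) as (jc & Fjc & Ejc).
  (* The function x ↦ x ∩ kappa represents kappa: functions below it are constant by [Mall_press],
     and by fineness it exceeds all constants. *)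
  destruct (@choice_fun _ ZW P (fun x y => forall a, a ∈ y <-> a ∈ i kappa /\ a ∈ x))
    as (kf & Fkf & Akf); [def|intros x _; apply sep; def|].
  assert (Ekf : forall x a, x ∈ P -> (a ∈ ap kf x <-> a ∈ i kappa /\ a ∈ x)).
  { intros x a Hx. now apply Akf. }
  destruct (@choice_fun _ ZW P (fun x y => y = x)) as (idf & Fid & Eid); [def|eauto|].
  (* A value of f at x ∩ kappa that bounds the size of x; membership in [i kappa] makes it an
     ordinal, above which no cardinality of x is found. *)
  set (T := fun x d => d ∈ i kappa /\ app f (ap kf x) d /\ card_le x d).
  assert (DT : Def2 T) by (unfold T; def).
  destruct (@choice_partial _ ZW P T) as (bf & Fbf & Hbf); [def|].
  set (S := fun x c => is_cardinality c x /\ ord_le c (ap bf x)).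
  assert (DS : Def2 S) by (unfold S; def).
  destruct (@choice_partial _ ZW P S) as (cf & Fcf & Hcf); [def|].
  assert (AT : almost_all P mu (fun x => T x (ap bf x))).
  { refine (um_mono Um _ (proj2 (EM _ _) (Mall_top hG hf Gd)) _); [def|def|].
    intros x Hx (c & d & Hd & Hcd & Ec & Lc). apply Hbf; auto. exists d. split; auto. split; auto.
    replace (ap kf x) with c; auto. apply set_ext. intros a. now rewrite (Ec a), Ekf. }
  assert (AS : almost_all P mu (fun x => S x (ap cf x))).
  { refine (um_mono Um _ AT _); [def|]. intros x Hx (Hd & _ & Lx). apply Hcf; auto.
    apply cardinality_ex; auto. now apply (@ord_elem _ ZW (i kappa)). }
  assert (CK : ult_class P mu kf (i kappa)).
  { apply (ult_class_critical Um); auto.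
    - intros v Fv Hv.
      destruct (Mall_press hG Gd Ck (Q := fun x b => ap v x = b))
        as (b & Hb & Kb); [def| |].
      + apply EM; [def|]. refine (um_mono Um _ Hv _); [def|].
        intros x Hx H. apply Ekf in H as [H1 H2]; auto. eauto.
      + exists (i b). split; [now apply (i_in hG)|]. apply EM; [def|exact Kb].
    - intros y Hy. apply (i_elem hG) in Hy as (y0 & -> & Hy).
      assert (A : almost_all P mu (fun x => i y0 ∈ x)).
      { apply EM; [def|]. apply (Mall_fine hG Gd Ck). now apply (@ord_mem_le_trans _ y0 kappa l). }
      refine (um_mono Um _ A _); [def|]. intros x Hx H. apply Ekf; auto. split; auto.
      now apply (i_in hG). }
  destruct (ult_class_ex Um Fjc) as [jf Hjf].
  destruct (ult_class_ex Um Fid) as [idmu Hid].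
  destruct (ult_class_ex Um Fbf) as [b Hb].
  destruct (ult_class_ex Um Fcf) as [c Hc].
  set (inN := fun a g (Fg : fun_on P g) (Hg : ult_class P mu g a) =>
    exist (in_ult P mu) a (ex_intro _ g (conj Fg Hg)) : ultrapower P mu).
  exists (inN _ _ Fjc Hjf), (inN _ _ Fkf CK), (inN _ _ Fid Hid). split; [|split; [|split]].
  - exists jc. split; auto. split; auto. intros x Hx. rewrite <- (Ejc x Hx). now apply app_ap with P.
  - reflexivity.
  - exists idf. split; auto. split; auto. intros x Hx. rewrite <- (Eid x Hx) at 2. now apply app_ap with P.
  - exists (inN _ _ Fbf Hb), (inN _ _ Fcf Hc). split; [|split].
    (* The environments list the elements of the ultrapower and, in the same order, the functions
       representing them; Łoś reduces the claim to almost all x. *)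
    + destruct ud_app as [phi Hphi].
      apply (Hphi _ (scons (inN _ _ Fjc Hjf) (scons (inN _ _ Fkf CK) (fun _ => inN _ _ Fbf Hb)))).
      apply (los Um phi (e := scons jc (scons kf (fun _ => bf)))).
      { intros [|[|n]]; simpl; auto. }
      apply (almost_all_ext mu (Q := fun x => app (ap jc x) (ap kf x) (ap bf x))).
      { intros x _. symmetry. apply (Hphi W). }
      refine (um_mono Um _ AT _); [def|]. intros x Hx (_ & H & _). now rewrite Ejc.
    + destruct ud_is_cardinality as [phi Hphi].
      apply (Hphi _ (scons (inN _ _ Fcf Hc) (fun _ => inN _ _ Fid Hid))).
      apply (los Um phi (e := scons cf (fun _ => idf))).
      { intros [|n]; simpl; auto. }
      apply (almost_all_ext mu (Q := fun x => is_cardinality (ap cf x) (ap idf x))).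
      { intros x _. symmetry. apply (Hphi W). }
      refine (um_mono Um _ AS _); [def|]. intros x Hx (H & _). now rewrite Eid.
    + destruct ud_ord_le as [phi Hphi].
      apply (Hphi _ (scons (inN _ _ Fcf Hc) (fun _ => inN _ _ Fbf Hb))).
      apply (los Um phi (e := scons cf (fun _ => bf))).
      { intros [|n]; simpl; auto. }
      apply (almost_all_ext mu (Q := fun x => ord_le (ap cf x) (ap bf x))).
      { intros x _. symmetry. apply (Hphi W). }
      refine (um_mono Um _ AS _); [def|]. intros x Hx (_ & H). exact H.
Qed.
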